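(* The map $T$ admits a unique absolutely continuous (with respect to Lebesgue measure on $S^1\times[0,1]$) invariant probability measure $m$. Moreover, this measure is ergodic. Finally, the density $h=\frac{\mathrm{d}m}{\mathrm{d}\mathrm{Leb}}$ is Lipschitz on every compact subset of $S^1\times(0,1]$.
   Context: $S^1=\mathbb{R}/\mathbb{Z}$. For a real number $a\in(0,1)$, let $T_a:[0,1]\to[0,1]$ be given by $T_a(x)=x(1+2^a x^a)$ if $0\le x\le 1/2$ and $T_a(x)=2x-1$ if $1/2<x\le 1$. Let $\alpha:S^1\to(0,1)$ be a function with minimum $\alpha_{\min}$ and maximum $\alpha_{\max}$ such that: $\alpha$ is $C^2$; $0<\alpha_{\min}<\alpha_{\max}<1$; $\alpha$ takes the value $\alpha_{\min}$ at a unique point $x_0$, and $\alpha''(x_0)>0$; $\alpha_{\max}<\frac32\alpha_{\min}$. Let $F:S^1\to S^1$, $F(\omega)=4\omega$, and let $T:S^1\times[0,1]\to S^1\times[0,1]$ be $T(\omega,x)=(F(\omega),T_{\alpha(\omega)}(x))$. $\mathrm{Leb}$ is Lebesgue measure on $S^1\times[0,1]$. A density is defined only almost everywhere; ''$h$ is Lipschitz'' on a set means that $h$ coincides almost everywhere with a version which is Lipschitz there, for the distance $d((\omega_1,x_1),(\omega_2,x_2))=|\omega_1-\omega_2|+|x_1-x_2|$. *)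

(* Defs.v *)
From HB Require Import structures.
From mathcomp Require Import all_boot all_order all_algebra.
From mathcomp Require Import generic_quotient ring_quotient.
From mathcomp Require Import all_classical all_reals all_analysis measurable_realfun.
From mathcomp Require Import lra.

Set Implicit Arguments.
Unset Strict Implicit.
Unset Printing Implicit Defensive.

Import Order.TTheory GRing.Theory Num.Theory.
Import numFieldNormedType.Exports.

Local Open Scope classical_set_scope.
Local Open Scope ring_scope.

(* [int_num_subdef] is the predicate behind [Num.int]: it is the constant that
   carries the additive subgroup structure. *)
Definition int_subgroup (R : realType) : zmodClosed R :=
  GRing.ZmodClosed.clone R (@Num.int_num_subdef R) _.

(* S^1 = R/Z, as a quotient group with the quotient topology and its Borel
   sigma-algebra. *)
Definition circle (R : realType) : Type :=
  quotient_topology (Quotient.quot (int_subgroup R)).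

Section circle_structure.
Variable R : realType.

HB.instance Definition _ := PointedTopological.on (circle R).
HB.instance Definition _ := GRing.Zmodule.copy (circle R)
  (Quotient.quot (int_subgroup R)).
HB.instance Definition _ :=
  @isMeasurable.Build (sigma_display (@open (circle R))) (circle R)
  <<s @open (circle R) >> (@sigma_algebra0 _ _ _)
  (@sigma_algebraC _ _) (@sigma_algebra_bigcup _ _ _).

Definition circle_proj (t : R) : circle R :=
  \pi_(quotient_topology (Quotient.quot (int_subgroup R)))%qT t.

Lemma circle_projD (s t : R) :
  circle_proj (s + t) = circle_proj s + circle_proj t.
Proof. exact: (Quotient.pi_add (int_subgroup R) s t). Qed.

Lemma circle_projP (s t : R) :
  reflect (circle_proj s = circle_proj t) (s - t \is a Num.int).
Proof.
have /= E := Quotient.idealrBE (int_subgroup R) s t.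
apply: (iffP idP) => st; first exact: (eqP (etrans (esym E) st)).
have : s - t \in int_subgroup R by rewrite E; apply/eqP.
exact.
Qed.

Lemma circle_proj_surj (w : circle R) : exists t, circle_proj t = w.
Proof. by exists (repr w); exact: reprK. Qed.

Lemma continuous_circle_proj : continuous circle_proj.
Proof. exact: pi_continuous. Qed.

Lemma measurable_circle_proj :
  measurable_fun setT (circle_proj : measurableTypeR R -> circle R).
Proof.
apply: (measurability (@open (circle R))) => //.
move=> _ [B oB <-]; rewrite setTI.
by apply: open_measurable; move/continuousP: continuous_circle_proj; apply.
Qed.

End circle_structure.

(* The quotient distance on R/Z: the infimum is over all representatives. *)
Definition circle_dist (R : realType) (w1 w2 : circle R) : R :=
  inf [set d | exists s t : R,
    [/\ circle_proj s = w1, circle_proj t = w2 & d = `|s - t|]].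

(* Functions on R/Z are differentiated through their 1-periodic lifts. *)
Section circle_calculus.
Variable R : realType.
Implicit Type f : circle R -> R.

Definition circle_lift f : R -> R := f \o @circle_proj R.

Definition circle_C2 f : Prop :=
  [/\ forall t, derivable (circle_lift f) t 1,
      forall t, derivable (derive1 (circle_lift f)) t 1 &
      continuous (derive1n 2 (circle_lift f))].

(* The value does not depend on the representative [repr w] of [w]. *)
Definition circle_derive2 f (w : circle R) : R := derive1n 2 (circle_lift f) (repr w).

End circle_calculus.

(* The ambient type is S^1 x R; the phase space of the dynamics is its subset
   [strip], on which all the notions below are taken. *)
Notation cylinder R := (circle R * measurableTypeR R)%type.

Definition strip (R : realType) : set (cylinder R) :=
  [set p | 0 <= (p.2 : R) <= 1].

Section lebesgue.
Variable R : realType.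

Definition itv01 : set (measurableTypeR R) := `[0, 1]%classic.

Lemma measurable_itv01 : measurable itv01.
Proof. exact: measurable_itv. Qed.

Lemma lty_itv01 : (lebesgue_measure itv01 < +oo)%E.
Proof. by rewrite lebesgue_measure_itv/= lte_fin ltr01 sube0 ltry. Qed.

Definition leb01 : {finite_measure set (measurableTypeR R) -> \bar R} :=
  mfrestr measurable_itv01 lty_itv01.

Definition leb_circle : set (circle R) -> \bar R :=
  pushforward leb01 (@circle_proj R).

Let leb_circle0 : leb_circle set0 = 0%E.
Proof. by rewrite /leb_circle /pushforward preimage_set0 measure0. Qed.
Let leb_circle_ge0 A : (0 <= leb_circle A)%E.
Proof. exact: (measure_ge0 leb01). Qed.
Let leb_circle_sigma_additive : semi_sigma_additive leb_circle.
Proof.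
exact: (@measure_semi_sigma_additive _ _ _
  (measure_function_pushforward__canonical__measure_function_Measure
    leb01 (@measurable_circle_proj R))).
Qed.

HB.instance Definition _ := isMeasure.Build _ _ _ leb_circle
  leb_circle0 leb_circle_ge0 leb_circle_sigma_additive.

Let leb_circle_fin : fin_num_fun leb_circle.
Proof.
move=> A mA; apply: (fin_num_measure leb01).
by rewrite -[X in measurable X]setTI; exact: measurable_circle_proj.
Qed.

HB.instance Definition _ :=
  Measure_isFinite.Build _ _ _ leb_circle leb_circle_fin.

(* Lebesgue measure on S^1 x [0, 1], as a measure on the cylinder that
   vanishes off the strip. *)
Definition leb_strip : set (cylinder R) -> \bar R :=
  (leb_circle \x leb01)%E.

HB.instance Definition _ := Measure.on leb_strip.

Lemma leb_strip_prod A B : measurable A -> measurable B ->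
  (leb_strip (A `*` B) = leb_circle A * leb01 B)%E.
Proof. exact: product_measure1E. Qed.

Let leb_strip_fin : fin_num_fun leb_strip.
Proof.
suff lty : (leb_strip setT < +oo)%E by exact: lty_fin_num_fun.
have -> : leb_strip setT = (leb_circle setT * leb01 setT)%E.
  by rewrite -leb_strip_prod// setXTT.
by rewrite ltey_eq fin_numM// fin_num_measure.
Qed.

HB.instance Definition _ :=
  Measure_isFinite.Build _ _ _ leb_strip leb_strip_fin.

End lebesgue.

Section dynamics.
Variable R : realType.

Definition T_ (a x : R) : R :=
  if x <= 2^-1 then x * (1 + 2 `^ a * x `^ a) else 2 * x - 1.

Lemma T_itv (a x : R) : 0 < a -> 0 <= x <= 1 -> 0 <= T_ a x <= 1.
Proof.
move=> a0 /andP[x0 x1]; rewrite /T_; case: ifPn => [x2|]; last first.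
  by rewrite -ltNge => x2; lra.
rewrite -powRM//.
have y0 : 0 <= (2 * x) `^ a by exact: powR_ge0.
have y1 : (2 * x) `^ a <= 1.
  rewrite -[leRHS](congr1 (@^~ a) (powR1 R)).
  by apply: ge0_ler_powR; rewrite ?nnegrE; lra.
apply/andP; split; first by apply: mulr_ge0 => //; lra.
nra.
Qed.

Definition F_ (w : circle R) : circle R := w *+ 4.

Lemma F_proj (t : R) : F_ (circle_proj t) = circle_proj (4 * t).
Proof. by rewrite /F_ mulr_natl !(mulrS _ 3, mulrS _ 2, mulr2n) !circle_projD. Qed.

Definition skew_map (alpha : circle R -> R) (p : cylinder R) : cylinder R :=
  (F_ p.1, T_ (alpha p.1) p.2).

Lemma skew_strip (alpha : circle R -> R) : (forall w, 0 < alpha w) ->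
  forall p, strip p -> strip (skew_map alpha p).
Proof. by move=> alpha0 p; exact: T_itv. Qed.

End dynamics.

Section ergodic_theory.
Context d (X : measurableType d) (R : realType).
Variables (S : set X) (f : X -> X) (m : set X -> \bar R).

(* Invariance and ergodicity of a measure m carried by S for the self-map of S
   that f induces: the preimage of A under it is S `&` f @^-1` A. *)
Definition invariant_on : Prop :=
  forall A, measurable A -> A `<=` S -> m (S `&` f @^-1` A) = m A.

Definition ergodic_on : Prop :=
  forall A, measurable A -> A `<=` S -> S `&` f @^-1` A = A ->
    m A = 0%E \/ m (S `\` A) = 0%E.

End ergodic_theory.

Section regularity.
Variable R : realType.

Definition cylinder_dist (p q : cylinder R) : R :=
  circle_dist p.1 q.1 + `|(p.2 : R) - (q.2 : R)|.

Definition lipschitz_on (K : set (cylinder R)) (g : cylinder R -> R) : Prop :=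
  exists L : R, forall p q, K p -> K q -> `|g p - g q| <= L * cylinder_dist p q.

(* h agrees almost everywhere with a function that is Lipschitz on K. *)
Definition ae_lipschitz_on (K : set (cylinder R)) (h : cylinder R -> \bar R) :
    Prop :=
  exists g : cylinder R -> R,
    ae_eq (@leb_strip R) setT h (EFin \o g) /\ lipschitz_on K g.

End regularity.

(* Main.v *)
Require Import Defs.
From HB Require Import structures.
From mathcomp Require Import all_boot all_order all_algebra.
From mathcomp Require Import all_classical all_reals all_analysis measurable_realfun.
From mathcomp Require Import zify ring lra.

(** Densities are studied through their lifts [H t x], [1]-periodic in the
    angle [t], under the transfer operator [transfer], the sum over the eight
    inverse branches of the skew product. Everything rests on a cone of
    functions preserved by this operator, the [harnack] functions: in the
    fibre, [H] decreases and [x ^+ 2 * H] increases; in the angle, [H] varies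
    at most by the factor [expR (B * `|s - t|)]. Preservation in the fibre is
    a computation on the left branch ([jacobian_cone]). In the angle,
    preimages are [4] times closer than points, which leaves room for the
    variation of the exponent ([left_term_exponent], [harnack_branch]). The
    cone conditions bound the oscillation of a function on every region
    [e <= x], so they are at once a source of compactness and the reason for
    the Lipschitz regularity of the final density.

    Near [x = 0] the map is tangent to the identity, and mass might accumulate
    there. It does not, as all exponents are at most some [g < 1]: a bound by
    [A * x `^ (- g)], which is integrable, is inherited by the image of a
    density of bounded mass as soon as [A] is large ([transfer_power_bound],
    [tame_iter]). The averages of the iterates of the uniform density
    therefore stay in a set of dominated cone functions ([tame]). Their
    pointwise limit along an ultrafilter exists, stays in this set, commutes
    with integrals ([ulim_integral]) and is fixed by the operator: it is the
    density [inv_density]. The duality [strip_duality], which is Tonelli's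
    theorem and a change of variables on each branch, makes it invariant.

    Two fixed densities of the same mass coincide ([fixed_unique]). Their
    maximum is fixed too, because it lies below its image and has the same
    mass. The set where one of them is smaller than the maximum is open and
    forward invariant; if it is not empty, it spreads by expansion to the
    bottom of a fibre above an integer ([open_forward_fills]), that is, of the
    fibre above the fixed point [0] of the circle. As one of the two densities
    equals the maximum there, the densities are ordered, hence equal.

    Every limit of averages of a tame density is therefore a multiple of
    [inv_density], whatever the initial density: the integrals over the
    preimages of a set [D] become, on average, the product of the mass of the
    initial density and of the measure of [D]. The functions with this
    property form a linear space closed in [L^1], which contains enough
    Lipschitz functions to contain the indicators of boxes, thus all
    indicators by a Dynkin argument, thus all integrable functions
    ([equidistributed_integrable]). For the density of an invariant probability
    measure the averages are constant, so this measure is the one of density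
    [inv_density]. Ergodicity follows, since conditioning on an invariant set
    of positive measure gives an invariant probability measure. *)

Set Implicit Arguments.
Unset Strict Implicit.
Unset Printing Implicit Defensive.

Import Order.TTheory GRing.Theory Num.Theory.
Import numFieldNormedType.Exports.

Local Open Scope classical_set_scope.
Local Open Scope ring_scope.
Local Open Scope charge_scope.

(** * The left branch and its inverse *)

Section left_branch.
Variable R : realType.
Implicit Types a b x y z v : R.

Definition left_map a y := y * (1 + (2 * y) `^ a).

Definition left_deriv a y := 1 + (1 + a) * (2 * y) `^ a.

Definition left_inv a x :=
  xget 0 [set y | 0 < y <= 2^-1 /\ left_map a y = x].

Lemma left_deriv_gt0 a y : 0 < a -> 0 < left_deriv a y.
Proof.
by move=> a0; rewrite /left_deriv; have := powR_ge0 (2 * y) a; nra.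
Qed.

Lemma T_left a y : 0 <= y <= 2^-1 -> T_ a y = left_map a y.
Proof. by move=> /andP[y0 y1]; rewrite /T_ y1 -powRM. Qed.

Lemma T_right a y : 2^-1 < y -> T_ a y = 2 * y - 1.
Proof. by move=> y1; rewrite /T_ leNgt y1. Qed.

Lemma powR_le1 a v : 0 < a -> 0 <= v <= 1 -> v `^ a <= 1.
Proof.
move=> a0 /andP[v0 v1]; rewrite -[leRHS](congr1 (@^~ a) (powR1 R)).
by apply: ge0_ler_powR; rewrite ?nnegrE// ltW.
Qed.

Lemma powR_double_le a y z : 0 < a -> 0 <= y <= z -> (2 * y) `^ a <= (2 * z) `^ a.
Proof.
by move=> a0 /andP[y0 yz]; apply: ge0_ler_powR; rewrite ?nnegrE; lra.
Qed.

Lemma left_map_lt a y z : 0 < a -> 0 <= y < z -> left_map a y < left_map a z.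
Proof.
move=> a0 /andP[y0 yz]; rewrite /left_map.
have h : (2 * y) `^ a <= (2 * z) `^ a by apply: powR_double_le => //; lra.
have := powR_ge0 (2 * y) a; nra.
Qed.

Lemma left_map_le a y z : 0 < a -> 0 <= y <= z -> left_map a y <= left_map a z.
Proof.
move=> a0 /andP[y0]; rewrite le_eqVlt => /predU1P[->//|yz].
by apply/ltW/left_map_lt => //; rewrite y0.
Qed.

Lemma left_map_ge a y : 0 <= y -> y <= left_map a y.
Proof. by move=> y0; rewrite /left_map; have := powR_ge0 (2 * y) a; nra. Qed.

Lemma left_map_half a : left_map a 2^-1 = 1.
Proof. by rewrite /left_map divff ?powR1//; lra. Qed.

Lemma is_derive_powR_double a y : 0 < y ->
  is_derive y 1 (fun z => (2 * z) `^ a) (2 * a * (2 * y) `^ (a - 1)).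
Proof.
move=> y0.
have y20 : 0 < 2 * y by lra.
have D1 : is_derive y 1 (fun z : R => 2 * z) (2 : R).
  by apply: is_derive_eq; rewrite /GRing.scale/= mulr1.
have D2 := is_derive1_powR a y20.
have := @is_derive1_comp R (@powR R ^~ a) (fun z : R => 2 * z) y _ _ D2 D1.
by move=> h; apply: (is_derive_eq h); rewrite /GRing.scale/=; lra.
Qed.

Lemma is_derive_left_map a y : 0 < y ->
  is_derive y 1 (left_map a) (left_deriv a y).
Proof.
move=> y0; have D1 := is_derive_powR_double a y0.
have y20 : 0 < 2 * y by lra.
rewrite /left_map; apply: is_derive_eq.
rewrite /left_deriv /GRing.scale/= add0r.
have -> : (2 * y) `^ a = 2 * y * (2 * y) `^ (a - 1).
  rewrite -{2}(powRr1 (ltW y20)) -powRD; first by congr (_ `^ _); lra.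
  by apply/implyP => _; rewrite gt_eqF.
lra.
Qed.

Lemma continuous_left_map a y : 0 < y -> {for y, continuous (left_map a)}.
Proof.
move=> y0; apply/differentiable_continuous/derivable1_diffP.
by case: (is_derive_left_map a y0).
Qed.

Lemma left_inv_ex a x : 0 < a -> 0 < x <= 1 ->
  exists y, 0 < y <= 2^-1 /\ left_map a y = x.
Proof.
move=> a0 /andP[x0 x1].
have [|||y] := @IVT R (left_map a) (x / 2) 2^-1 x.
- lra.
- apply: continuous_in_subspaceT => y /[!inE]/=; rewrite in_itv/= => /andP[xy _].
  by apply: continuous_left_map; lra.
- rewrite left_map_half ge_min le_max x1 orbT andbT.
  rewrite /left_map; have : (2 * (x / 2)) `^ a <= 1 by apply: powR_le1 => //; lra.
  by have := powR_ge0 (2 * (x / 2)) a; move: (powR _ _) => u; nra.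
- by rewrite in_itv/= => /andP[xy yh] <-; exists y; split => //; lra.
Qed.

Lemma left_invP a x : 0 < a -> 0 < x <= 1 ->
  0 < left_inv a x <= 2^-1 /\ left_map a (left_inv a x) = x.
Proof.
move=> a0 x01; rewrite /left_inv; case: xgetP => [y _ //|].
by have [y yP] := left_inv_ex a0 x01 => /(_ y).
Qed.

Lemma left_mapK a y : 0 < a -> 0 < y <= 2^-1 -> left_inv a (left_map a y) = y.
Proof.
move=> a0 /andP[y0 y1].
have [|/andP[z0 _] e] := @left_invP a (left_map a y) a0.
  rewrite (lt_le_trans y0 (left_map_ge _ (ltW y0)))//=.
  by rewrite -(left_map_half a) left_map_le// y1 andbT ltW.
have [lt|lt|//] := ltgtP (left_inv a (left_map a y)) y.
- by have := @left_map_lt a _ _ a0; move/(_ _ _ (introT andP (conj (ltW z0) lt))); rewrite e ltxx.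
- by have := @left_map_lt a _ _ a0; move/(_ _ _ (introT andP (conj (ltW y0) lt))); rewrite e ltxx.
Qed.

Lemma left_inv_lt a x x' : 0 < a -> 0 < x <= 1 -> 0 < x' <= 1 -> x < x' ->
  left_inv a x < left_inv a x'.
Proof.
move=> a0 hx hx' xx'; rewrite ltNge; apply/negP => h.
have [/andP[y0 _] e] := left_invP a0 hx'; have [_ e'] := left_invP a0 hx.
have := @left_map_le a _ _ a0 (introT andP (conj (ltW y0) h)).
by rewrite e e' leNgt xx'.
Qed.

Lemma left_inv_le a x x' : 0 < a -> 0 < x <= 1 -> 0 < x' <= 1 -> x <= x' ->
  left_inv a x <= left_inv a x'.
Proof.
move=> a0 hx hx'; rewrite le_eqVlt => /predU1P[->//|h].
exact/ltW/left_inv_lt.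
Qed.

(** The derivative in the exponent is [- s * expR (- a * s)], where
    [s = - ln v], and [b * s * expR (- b * s) <= 1]. *)
Lemma powR_exponent_lip v b a a' : 0 < v <= 1 -> 0 < b -> b <= a -> a <= a' ->
  v `^ a - v `^ a' <= (a' - a) / b.
Proof.
move=> /andP[v0 v1] b0 ba aa'.
rewrite /powR gt_eqF//; set s := - ln v.
have s0 : 0 <= s by rewrite /s oppr_ge0 ln_le0.
have -> : a * ln v = - (a * s) by rewrite /s; lra.
have -> : a' * ln v = - (a * s) + - ((a' - a) * s) by rewrite /s; lra.
rewrite expRD; have h1 := expR_ge1Dx (- ((a' - a) * s)).
have h2 := expR_ge1Dx (a * s); have h3 := expR_gt0 (- (a * s)).
have h4 : expR (a * s) * expR (- (a * s)) = 1 by rewrite -expRD subrr expR0.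
rewrite ler_pdivlMr//.
move: h1 h2 h3 h4; move: (expR (- ((a' - a) * s))) (expR (a * s)) (expR (- (a * s))) => e1 e2 e3 h1 h2 h3 h4.
have h5 : b * s * e3 <= 1.
  rewrite -[leRHS]h4 ler_pM2r//; apply: le_trans h2; nra.
apply: (@le_trans _ _ (e3 * ((a' - a) * s) * b)); last by nra.
rewrite ler_pM2r//; nra.
Qed.

(** With [u = (2 * y) `^ a], the quotient is the square of [left_map a y / y]
    over the derivative: the factor by which the left branch changes
    [x ^+ 2 * H]. *)
Lemma jacobian_cone a u v : 0 < a <= 1 -> 0 <= u <= v ->
  (1 + u) ^+ 2 / (1 + (1 + a) * u) <= (1 + v) ^+ 2 / (1 + (1 + a) * v).
Proof.
move=> /andP[a0 a1] /andP[u0 uv].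
rewrite ler_pdivrMr; last nra.
rewrite mulrAC ler_pdivlMr; last nra.
rewrite -subr_ge0.
have -> : (1 + v) ^+ 2 * (1 + (1 + a) * u) - (1 + u) ^+ 2 * (1 + (1 + a) * v) =
  (v - u) * (1 - a + u + v + (1 + a) * (u * v)) by ring.
have uv0 : 0 <= u * v by apply: mulr_ge0; lra.
by apply: mulr_ge0; nra.
Qed.

(** The cone condition in the [x] variable lets the point move by the factor
    [(1 + u) / (1 + u')] at a bounded cost, and [u] is Lipschitz in the
    exponent with constant [1 / b]. *)
Lemma left_term_exponent (f : R -> R) b a a' x :
  0 < b -> b <= a <= 1 -> b <= a' <= 1 -> 0 < x <= 1 ->
  (forall y, 0 <= f y) ->
  (forall y z, 0 < y -> y <= z -> z <= 1 -> f z <= f y) ->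
  (forall y z, 0 < y -> y <= z -> z <= 1 -> y ^+ 2 * f y <= z ^+ 2 * f z) ->
  f (left_inv a x) / left_deriv a (left_inv a x) <=
  f (left_inv a' x) / left_deriv a' (left_inv a' x) *
    expR ((2 / b + 1) * `|a - a'|).
Proof.
move=> b0 /andP[ba a1] /andP[ba' a'1] x01 f0 fd fi.
have a0 : 0 < a by lra.
have a'0 : 0 < a' by lra.
have [/andP[]] := left_invP a0 x01; have [/andP[]] := left_invP a'0 x01.
move: (left_inv a x) (left_inv a' x) => y y' y'0 y'1 e' y0 y1 e.
have D := left_deriv_gt0 y a0; have D' := left_deriv_gt0 y' a'0.
have [aa'|aa'] := leP a a'.
- have yy' : y <= y'.
    rewrite leNgt; apply/negP => lt; suff : left_map a' y' < left_map a y.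
      by rewrite e e' ltxx.
    apply: lt_le_trans (left_map_lt a'0 (introT andP (conj (ltW y'0) lt))) _.
    rewrite /left_map ler_pM2l// lerD2l ger_powR//; lra.
  set u := (2 * y) `^ a; set u' := (2 * y') `^ a'.
  have u'0 : 0 <= u' by exact: powR_ge0.
  have u'u : u' <= u.
    by move: e'; rewrite -e /left_map -/u -/u'; nra.
  have uu' : u - u' <= (a' - a) / b.
    have h := @powR_exponent_lip (2 * y) b a a'.
    have : (2 * y) `^ a' <= u' by apply: powR_double_le => //; lra.
    have : (2 * y) `^ a - (2 * y) `^ a' <= (a' - a) / b by apply: h => //; lra.
    by rewrite -/u; lra.
  have h1 : f y <= f y' * (1 + (u - u')) ^+ 2.
    have h2 := fi _ _ y0 yy' (ltac:(lra)).
    have h3 : y' = y * ((1 + u) / (1 + u')).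
      apply: (@mulIf _ (1 + u')); first by rewrite gt_eqF//; lra.
      rewrite mulrA divfK; last by rewrite gt_eqF//; lra.
      by move: e'; rewrite -e /left_map.
    have h4 : (1 + u) / (1 + u') <= 1 + (u - u') by rewrite ler_pdivrMr; nra.
    have h5 : 0 <= (1 + u) / (1 + u') by rewrite divr_ge0; lra.
    have y20 : 0 < y ^+ 2 by exact: exprn_gt0.
    have : y ^+ 2 * f y <= y ^+ 2 * (((1 + u) / (1 + u')) ^+ 2 * f y').
      by rewrite mulrA -exprMn -h3.
    rewrite ler_pM2l// mulrC => /le_trans; apply; apply: ler_wpM2l => //.
    by rewrite ler_sqr ?nnegrE; lra.
  have h2 : (left_deriv a y)^-1 <= (left_deriv a' y')^-1 * (1 + (a' - a)).
    rewrite ler_pdivlMl// ler_pdivrMr// /left_deriv -/u -/u'.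
    have : (1 + a') * u' <= (1 + a') * u by apply: ler_wpM2l; lra.
    have : 0 <= (a' - a) * (a * u) by rewrite !mulr_ge0//; lra.
    nra.
  have -> : `|a - a'| = a' - a by rewrite ler0_norm; lra.
  apply: (@le_trans _ _ (f y' * (1 + (u - u')) ^+ 2 *
                 ((left_deriv a' y')^-1 * (1 + (a' - a))))).
    by apply: ler_pM => //; rewrite invr_ge0 ltW.
  rewrite mulrACA; apply: ler_wpM2l; first by rewrite divr_ge0// ltW.
  rewrite mulrDl mul1r expRD; apply: ler_pM.
  - by rewrite exprn_ge0//; lra.
  - lra.
  - have -> : 2 / b * (a' - a) = (a' - a) / b + (a' - a) / b by ring.
    rewrite expRD -expr2 ler_sqr ?nnegrE ?expR_ge0//; last lra.
    by apply: le_trans (expR_ge1Dx _); lra.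
  - exact: expR_ge1Dx.
- have yy' : y' <= y.
    rewrite leNgt; apply/negP => lt; suff : left_map a y < left_map a' y'.
      by rewrite e e' ltxx.
    apply: lt_le_trans (left_map_lt a0 (introT andP (conj (ltW y0) lt))) _.
    rewrite /left_map ler_pM2l// lerD2l ger_powR//; lra.
  set u := (2 * y) `^ a; set u' := (2 * y') `^ a'.
  have u0 : 0 <= u by exact: powR_ge0.
  have uu' : u <= u'.
    by move: e'; rewrite -e /left_map -/u -/u'; nra.
  have u'u : u' - u <= (a - a') / b.
    have h := @powR_exponent_lip (2 * y') b a' a.
    have : (2 * y') `^ a <= u by apply: powR_double_le => //; lra.
    have : (2 * y') `^ a' - (2 * y') `^ a <= (a - a') / b by apply: h => //; lra.
    by rewrite -/u'; lra.
  have -> : `|a - a'| = a - a' by rewrite gtr0_norm; lra.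
  rewrite -[leRHS]mulrA; apply: ler_pM => //.
  - by rewrite invr_ge0 ltW.
  - by apply: fd => //; lra.
  rewrite ler_pdivlMl//.
  apply: (@le_trans _ _ (1 + 2 * (u' - u))).
    rewrite ler_pdivrMr// /left_deriv -/u -/u'.
    have : (1 + a') * u' <= (1 + a) * u' by apply: ler_wpM2r; lra.
    have : 0 <= (u' - u) * u by apply: mulr_ge0; lra.
    have : 0 <= (u' - u) * a * u by rewrite !mulr_ge0//; lra.
    have : (1 - a) * (u' - u) >= 0 by apply: mulr_ge0; lra.
    nra.
  apply: le_trans (expR_ge1Dx _) _; rewrite ler_expR.
  have -> : (2 / b + 1) * (a - a') = 2 * ((a - a') / b) + (a - a') by ring.
  lra.
Qed.

End left_branch.

(** * Harnack functions and the transfer operator *)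

Section harnack.
Variable R : realType.
Implicit Types (B s t x y : R) (H : R -> R -> R).

(** All conditions are stable under sums and pointwise limits. The two
    monotonicity conditions in [x] bound the logarithmic derivative of [H] by
    [2 / x]; the exponent [2] is one for which [jacobian_cone] holds. *)
Record harnack B H : Prop := Harnack {
  harnack_ge0 : forall t x, 0 <= H t x;
  harnack_out : forall t x, ~~ (0 < x <= 1) -> H t x = 0;
  harnack_dec : forall t x y, 0 < x -> x <= y -> y <= 1 -> H t y <= H t x;
  harnack_inc : forall t x y, 0 < x -> x <= y -> y <= 1 ->
    x ^+ 2 * H t x <= y ^+ 2 * H t y;
  harnack_exp : forall s t x, H s x <= H t x * expR (B * `|s - t|) }.

Definition periodic1 H := forall t x, H (t + 1) x = H t x.

Lemma periodic1_nat H : periodic1 H -> forall t x n, H (t + n%:R) x = H t x.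
Proof.
move=> pH t x; elim=> [|n IH]; first by rewrite addr0.
by rewrite -natr1 addrA pH.
Qed.

Lemma periodic1_int H : periodic1 H ->
  forall t t' x, t - t' \is a Num.int -> H t x = H t' x.
Proof.
move=> pH t t' x /intrP[[n|n] e].
- have -> : t = t' + n%:R by rewrite [n%:R](_ : _ = t - t') ?subrKC//; lra.
  exact: periodic1_nat.
- have -> : t' = t + n.+1%:R.
    by rewrite NegzE mulrNz in e; rewrite [n.+1%:R](_ : _ = t' - t); lra.
  by rewrite periodic1_nat.
Qed.

Lemma harnack_sum B (I : finType) (H : I -> R -> R -> R) :
  (forall i, harnack B (H i)) -> harnack B (fun t x => \sum_i H i t x).
Proof.
move=> hH; split.
- by move=> t x; apply: sumr_ge0 => i _; exact: harnack_ge0.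
- by move=> t x xo; apply: big1 => i _; exact: (harnack_out (hH i)).
- by move=> t x y x0 xy y1; apply: ler_sum => i _; exact: (harnack_dec (hH i)).
- move=> t x y x0 xy y1; rewrite !mulr_sumr.
  by apply: ler_sum => i _; exact: (harnack_inc (hH i)).
- move=> s t x; rewrite mulr_suml.
  by apply: ler_sum => i _; exact: (harnack_exp (hH i)).
Qed.

Lemma harnackZ B c H : 0 <= c -> harnack B H -> harnack B (fun t x => c * H t x).
Proof.
move=> c0 [h1 h2 h3 h4 h5]; split.
- by move=> t x; rewrite mulr_ge0.
- by move=> t x xo; rewrite h2// mulr0.
- by move=> t x y x0 xy y1; rewrite ler_wpM2l// h3.
- by move=> t x y x0 xy y1; rewrite !(mulrCA _ c) ler_wpM2l// h4.
- by move=> s t x; rewrite -mulrA ler_wpM2l.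
Qed.

Lemma harnack_lip B H e M s t x y : harnack B H -> 0 <= B -> 0 < e ->
  e <= x <= 1 -> e <= y <= 1 ->
  H s x <= M -> H s y <= M -> H t y <= M ->
  `|H s x - H t y| <= M * (2 / e * `|x - y| + B * `|s - t|).
Proof.
move=> hH B0 e0 /andP[ex x1] /andP[ey y1] M1 M2 M3.
have M0 : 0 <= M by apply: le_trans M1; exact: harnack_ge0 hH _ _.
have key z w : e <= z -> z <= w -> w <= 1 -> H s z <= M ->
    `|H s z - H s w| <= M * (2 / e * (w - z)).
  move=> ez zw w1 Mz; have z0 : 0 < z by lra.
  have w0 : 0 < w by lra.
  have h1 := harnack_dec hH s z0 zw w1; have h2 := harnack_inc hH s z0 zw w1.
  have h3 := harnack_ge0 hH s z.
  rewrite ger0_norm ?subr_ge0//.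
  have h4 : w ^+ 2 * (H s z - H s w) <= w ^+ 2 * (H s z * (2 * (w - z) / w)).
    rewrite (_ : w ^+ 2 * (_ * _) = H s z * (2 * (w - z) * w)); last first.
      by field; rewrite gt_eqF.
    rewrite mulrBr; apply: (@le_trans _ _ (w ^+ 2 * H s z - z ^+ 2 * H s z)).
      by rewrite lerD2l lerN2.
    rewrite -mulrBl mulrC; apply: ler_wpM2l => //.
    by rewrite !expr2; nra.
  move: h4; rewrite ler_pM2l ?exprn_gt0// => /le_trans; apply.
  apply: ler_pM => //; first by rewrite divr_ge0//; lra.
  rewrite mulrAC ler_wpM2r//; first lra.
  by rewrite ler_pM2l// lef_pV2 ?posrE//; lra.
have hx : `|H s x - H s y| <= M * (2 / e * `|x - y|).
  have [xy|/ltW xy] := leP x y.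
    by rewrite [`|x - y|]ler0_norm ?subr_le0// opprB; exact: key.
  by rewrite distrC [`|x - y|]ger0_norm ?subr_ge0//; exact: key.
have ht : `|H s y - H t y| <= M * (B * `|s - t|).
  have aux u v : H u y <= M -> H u y - H v y <= M * (B * `|u - v|).
    move=> Mu; have h := harnack_exp hH u v y; have hu := harnack_ge0 hH u y.
    set E := B * `|u - v| in h *.
    have E0 : 0 <= E by exact: mulr_ge0.
    have h1 : H u y * expR (- E) <= H v y.
      by rewrite expRN ler_pdivrMr// expR_gt0.
    have h2 := expR_ge1Dx (- E).
    apply: (@le_trans _ _ (H u y * E)); last exact: ler_wpM2r.
    nra.
  rewrite ler_norml; apply/andP; split; last exact: aux.
  by rewrite lerNl opprB distrC; exact: aux.
rewrite mulrDr; apply: le_trans (lerD hx ht).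
by rewrite (_ : H s x - H t y = (H s x - H s y) + (H s y - H t y)) ?ler_normD//; ring.
Qed.

Lemma harnack_continuous B H t x e : harnack B H -> 0 <= B -> 0 < x <= 1 ->
  0 < e -> exists2 d, 0 < d & forall s y, `|s - t| < d -> `|y - x| < d ->
    y <= 1 -> `|H s y - H t x| < e.
Proof.
move=> hH B0 /andP[x0 x1] e0.
pose M := H t (x / 2) * expR B + 1.
have HM : 0 <= H t (x / 2) * expR B by rewrite mulr_ge0 ?expR_ge0// (harnack_ge0 hH).
have M0 : 0 < M by rewrite /M; lra.
have K0 : 0 < 4 / x + B + 1 by have := divr_gt0 (ltr0n R 4) x0; lra.
pose d := Num.min (Num.min 1 (x / 2)) (e / (M * (4 / x + B + 1))).
have d1 : d <= 1 by rewrite /d !ge_min lexx.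
have d2 : d <= x / 2 by rewrite /d !ge_min lexx orbT.
have d3 : d <= e / (M * (4 / x + B + 1)) by rewrite /d ge_min lexx orbT.
have d0 : 0 < d.
  by rewrite /d !lt_min ltr01 divr_gt0// divr_gt0// mulr_gt0.
exists d => // s y st yx y1.
have xy : x / 2 <= y by move: yx; rewrite ltr_distl; lra.
have bnd u z : `|u - t| < 1 -> x / 2 <= z -> z <= 1 -> H u z <= M.
  move=> ut xz z1; apply: (@le_trans _ _ (H t (x / 2) * expR B)); last by rewrite /M; lra.
  apply: (le_trans (harnack_exp hH u t z)); apply: ler_pM.
  - exact: harnack_ge0 hH _ _.
  - exact: expR_ge0.
  - by apply: (harnack_dec hH) => //; lra.
  - by rewrite ler_expR ler_piMr// ltW.
have := @harnack_lip B H (x / 2) M s t y x hH B0.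
move/(_ (ltac:(lra)) (ltac:(lra)) (ltac:(lra))).
have h1 := bnd s y (lt_le_trans st d1) xy y1.
have h2 := bnd s x (lt_le_trans st d1) (ltac:(lra)) x1.
have h3 := bnd t x (ltac:(rewrite subrr normr0; lra)) (ltac:(lra)) x1.
move=> /(_ h1 h2 h3) /le_lt_trans; apply.
have -> : 2 / (x / 2) = 4 / x by field; rewrite gt_eqF.
apply: (@lt_le_trans _ _ (M * ((4 / x + B + 1) * d))).
  rewrite ltr_pM2l// !mulrDl mul1r.
  have : 4 / x * `|y - x| <= 4 / x * d by rewrite ler_wpM2l ?ltW// divr_gt0.
  have : B * `|s - t| <= B * d by rewrite ler_wpM2l// ltW.
  lra.
by rewrite mulrA mulrC -ler_pdivlMr// mulr_gt0.
Qed.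

End harnack.

Lemma quarter_double (R : realFieldType) (p : R) : 0 <= p -> p / 4 + p / 4 <= p.
Proof. by move=> p0; lra. Qed.

Section transfer.
Variable R : realType.
Variables (a : R -> R) (b l B : R).
Hypothesis b0 : 0 < b.
Hypothesis ab : forall t, b <= a t <= 1.
Hypothesis a_per : forall t, a (t + 1) = a t.
Hypothesis l0 : 0 <= l.
Hypothesis a_lip : forall s t, `|a s - a t| <= l * `|s - t|.
Hypothesis B_ge : l * (2 / b + 1) <= B.
Implicit Types (s t x y : R) (H : R -> R -> R).

Let a0 t : 0 < a t. Proof. by have /andP[h _] := ab t; exact: lt_le_trans b0 h. Qed.

Definition preimage_ang (k : nat) t := (t + k%:R) / 4.

(** The contribution of one of the eight inverse branches; the Boolean tells
    the left half of the fibre from the right one. *)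
Definition branch (c : bool) (k : nat) H t x :=
  let s := preimage_ang k t in
  if 0 < x <= 1 then
    if c then H s (left_inv (a s) x) / left_deriv (a s) (left_inv (a s) x) / 4
    else H s ((x + 1) / 2) / 8
  else 0.

Definition transfer H t x := \sum_(i : bool * 'I_4) branch i.1 i.2 H t x.

Lemma transferE H t x :
  transfer H t x = \sum_(k < 4) (branch true k H t x + branch false k H t x).
Proof.
rewrite /transfer; rewrite -(pair_bigA _ (fun c (k : 'I_4) => branch c k H t x))/=.
by rewrite big_bool/= big_split.
Qed.

Lemma transfer_in H t x : 0 < x <= 1 -> transfer H t x =
  \sum_(k < 4) (branch true k H t x + H (preimage_ang k t) ((x + 1) / 2) / 8).
Proof.
by move=> x01; rewrite transferE; apply: eq_bigr => k _; rewrite /branch x01.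
Qed.

Lemma B_ge0 : 0 <= B.
Proof.
apply: le_trans B_ge; apply: mulr_ge0 => //; apply: addr_ge0 => //.
by rewrite divr_ge0// ltW.
Qed.

Lemma left_side_le y z (f : R -> R) (c : R) : 0 < c <= 1 -> 0 < y -> y <= z ->
  z <= 1 -> (forall y, 0 <= f y) ->
  (forall y z, 0 < y -> y <= z -> z <= 1 -> f z <= f y) ->
  f (left_inv c z) / left_deriv c (left_inv c z) <=
  f (left_inv c y) / left_deriv c (left_inv c y).
Proof.
move=> /andP[c0 c1] y0 yz z1 f0 fd.
have hy : 0 < y <= 1 by rewrite y0 (le_trans yz).
have hz : 0 < z <= 1 by rewrite (lt_le_trans y0).
have [/andP[gy0 gy1] _] := left_invP c0 hy.
have [/andP[gz0 gz1] _] := left_invP c0 hz.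
have h := left_inv_le c0 hy hz yz.
apply: ler_pM => //.
- by rewrite invr_ge0; apply/ltW/left_deriv_gt0.
- by apply: fd => //; lra.
rewrite lef_pV2 ?posrE ?left_deriv_gt0// /left_deriv lerD2l ler_wpM2l//; first lra.
by apply: powR_double_le => //; rewrite ltW.
Qed.

Lemma left_side_inc y z (f : R -> R) (c : R) : 0 < c <= 1 -> 0 < y -> y <= z ->
  z <= 1 -> (forall y, 0 <= f y) ->
  (forall y z, 0 < y -> y <= z -> z <= 1 -> y ^+ 2 * f y <= z ^+ 2 * f z) ->
  y ^+ 2 * (f (left_inv c y) / left_deriv c (left_inv c y)) <=
  z ^+ 2 * (f (left_inv c z) / left_deriv c (left_inv c z)).
Proof.
move=> /andP[c0 c1] y0 yz z1 f0 fi.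
have hy : 0 < y <= 1 by rewrite y0 (le_trans yz).
have hz : 0 < z <= 1 by rewrite (lt_le_trans y0).
have [/andP[gy0 gy1] ey] := left_invP c0 hy.
have [/andP[gz0 gz1] ez] := left_invP c0 hz.
have h := left_inv_le c0 hy hz yz.
rewrite -{1}ey -{1}ez.
move: (left_inv c y) (left_inv c z) gy0 gy1 gz0 gz1 h {ey ez} => v w v0 v1 w0 w1 vw.
rewrite /left_map /left_deriv.
set u := (2 * v) `^ c; set u' := (2 * w) `^ c.
have e q p r : (q * p) ^+ 2 * (f q / r) = p ^+ 2 / r * (q ^+ 2 * f q).
  by rewrite exprMn; ring.
rewrite !e; apply: ler_pM.
- by rewrite divr_ge0 ?sqr_ge0//; apply/ltW/(left_deriv_gt0 v).
- by rewrite mulr_ge0// sqr_ge0.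
- apply: jacobian_cone; first by rewrite c0.
  by rewrite powR_ge0/=; apply: powR_double_le => //; rewrite ltW.
- by apply: fi => //; lra.
Qed.

(** In the angle, the two preimages are [4] times closer than the points: the
    variation of [H] from one to the other takes a quarter of the exponent
    [B * `|s - t|], and that of the left branch, whose exponent is Lipschitz in
    the angle, another quarter. *)
Lemma harnack_branch c k H : harnack B H -> harnack B (branch c k H).
Proof.
move=> hH; have B0 := B_ge0.
have aB t : 0 < a t <= 1 by rewrite a0; have /andP[] := ab t.
split; rewrite /branch /=.
- move=> t x; case: ifP => // _; case: c; rewrite ?divr_ge0 ?(harnack_ge0 hH)//.
  by apply/ltW/left_deriv_gt0/a0.
- by move=> t x /negbTE ->.
- move=> t x y x0 xy y1; rewrite x0 (le_trans xy)//= (lt_le_trans x0)//= y1.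
  case: c; rewrite ler_wpM2r//.
    apply: left_side_le => //; first exact: harnack_ge0 hH _.
    exact: harnack_dec hH _.
  by apply: (harnack_dec hH) => //; lra.
- move=> t x y x0 xy y1; rewrite x0 (le_trans xy)//= (lt_le_trans x0)//= y1.
  case: c; rewrite [_ * (_ / _)]mulrA [leRHS]mulrA ler_wpM2r//.
    apply: left_side_inc => //; first exact: harnack_ge0 hH _.
    exact: harnack_inc hH _.
  set s := preimage_ang _ _.
  have h : ((x + 1) / 2) ^+ 2 * H s ((x + 1) / 2) <=
           ((y + 1) / 2) ^+ 2 * H s ((y + 1) / 2).
    by apply: (harnack_inc hH) => //; lra.
  have q z : 0 <= z -> z ^+ 2 * H s ((z + 1) / 2) =
     (2 * z / (z + 1)) ^+ 2 * (((z + 1) / 2) ^+ 2 * H s ((z + 1) / 2)).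
    by move=> z0; field; rewrite gt_eqF//; lra.
  rewrite (q x) ?(q y); [|lra|lra]; apply: ler_pM => //; first exact: sqr_ge0.
    by rewrite mulr_ge0 ?sqr_ge0// (harnack_ge0 hH).
  rewrite ler_sqr ?nnegrE ?divr_ge0//; [|lra|lra|lra|lra].
  rewrite ler_pdivrMr; last lra.
  by rewrite mulrAC ler_pdivlMr; nra.
- move=> s t x; case: ifP => [x01|_]; last by rewrite mul0r.
  set s' := preimage_ang k s; set t' := preimage_ang k t.
  have st' : `|s' - t'| = `|s - t| / 4.
    rewrite (_ : s' - t' = (s - t) / 4); last by rewrite /s' /t' /preimage_ang; lra.
    by rewrite normrM [`|4^-1|]ger0_norm.
  have he : expR (B * `|s' - t'|) <= expR (B * `|s - t|).
    rewrite ler_expR; apply: ler_wpM2l => //.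
    by rewrite st'; have := normr_ge0 (s - t); lra.
  case: c; last first.
    rewrite mulrAC ler_wpM2r//; apply: le_trans (harnack_exp hH s' t' _) _.
    by apply: ler_wpM2l => //; exact: harnack_ge0 hH _ _.
  rewrite [leRHS]mulrAC ler_wpM2r//.
  have h1 : H s' (left_inv (a s') x) / left_deriv (a s') (left_inv (a s') x) <=
     H t' (left_inv (a s') x) / left_deriv (a s') (left_inv (a s') x) *
       expR (B * `|s' - t'|).
    rewrite mulrAC; apply: ler_wpM2r; last exact: harnack_exp hH _ _ _.
    by rewrite invr_ge0; apply/ltW/left_deriv_gt0/a0.
  have h2 := @left_term_exponent R (H t') b (a s') (a t') x b0 (ab s') (ab t') x01
    (harnack_ge0 hH t') (harnack_dec hH t') (harnack_inc hH t').
  apply: (le_trans h1); apply: (le_trans (ler_wpM2r (expR_ge0 _) h2)).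
  rewrite -[leLHS]mulrA -[in leLHS]expRD; apply: ler_wpM2l.
    by rewrite divr_ge0 ?(harnack_ge0 hH)// ltW// left_deriv_gt0.
  rewrite ler_expR.
  have K0 : 0 <= 2 / b + 1 by apply: addr_ge0 => //; rewrite divr_ge0// ltW.
  have h3 : (2 / b + 1) * `|a s' - a t'| <= B * `|s' - t'|.
    apply: (@le_trans _ _ ((2 / b + 1) * (l * `|s' - t'|))).
      exact: ler_wpM2l.
    by rewrite mulrA [_ * l]mulrC ler_wpM2r.
  apply: (@le_trans _ _ (B * `|s' - t'| + B * `|s' - t'|)); first by rewrite lerD2r.
  rewrite st' !mulrA; have : 0 <= B * `|s - t| by exact: mulr_ge0.
  exact: quarter_double.
Qed.

Lemma harnack_transfer H : harnack B H -> harnack B (transfer H).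
Proof. by move=> hH; apply: harnack_sum => i; exact: harnack_branch. Qed.

Lemma periodic_transfer H : periodic1 H -> periodic1 (transfer H).
Proof.
move=> pH t x; rewrite !transferE.
have e1 k : preimage_ang k (t + 1) = preimage_ang k.+1 t.
  by rewrite /preimage_ang -natr1; lra.
have e2 : preimage_ang 4 t = preimage_ang 0 t + 1 by rewrite /preimage_ang; lra.
pose f k := branch true k H t x + branch false k H t x.
have e3 k : branch true k H (t + 1) x + branch false k H (t + 1) x = f k.+1.
  by rewrite /f /branch e1.
under eq_bigr do rewrite e3.
rewrite -/(f _) big_ord_recr [RHS]big_ord_recl/= addrC; congr (_ + _).
by rewrite /f /branch e2 a_per !pH.
Qed.

Lemma transferD H1 H2 t x :
  transfer (fun t x => H1 t x + H2 t x) t x = transfer H1 t x + transfer H2 t x.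
Proof.
rewrite /transfer -big_split/=; apply: eq_bigr => -[c k] _ /=; rewrite /branch.
by case: ifP => _; [case: c; rewrite ?mulrDl|rewrite addr0].
Qed.

Lemma transferZ c H t x : transfer (fun t x => c * H t x) t x = c * transfer H t x.
Proof.
rewrite /transfer mulr_sumr; apply: eq_bigr => -[d k] _ /=; rewrite /branch.
by case: ifP => _; [case: d; rewrite ?mulrA|rewrite mulr0].
Qed.

Lemma eq_transfer H1 H2 : (forall t x, H1 t x = H2 t x) ->
  forall t x, transfer H1 t x = transfer H2 t x.
Proof.
by move=> e t x; apply: eq_bigr => -[c k] _; rewrite /branch /=; case: ifP; case: c; rewrite ?e.
Qed.

(** The derivative of the left branch is [1 + (1 + a) * u], while going from
    [y] to its image multiplies [y `^ g] by at most [1 + u], as [g <= 1]. The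
    gain, of order [a * u * y `^ (- g) >= b], absorbs the contribution of the
    right branches. *)
Lemma transfer_power_bound H g A K : harnack B H ->
  (forall t, a t <= g) -> g <= 1 -> 3 * K <= A * b ->
  (forall t x, 2^-1 <= x -> H t x <= K) ->
  (forall t x, 0 < x <= 1 -> H t x <= A * x `^ (- g)) ->
  forall t x, 0 < x <= 1 -> transfer H t x <= A * x `^ (- g).
Proof.
move=> hH ag g1 KA HK HA t x x01.
have /andP[x0 x1] := x01.
have K0 : 0 <= K.
  by apply: le_trans (HK 0 1 _); [exact: harnack_ge0 hH _ _|lra].
have A0 : 0 <= A by rewrite -(pmulr_lge0 _ b0); lra.
rewrite transfer_in//.
have -> : A * x `^ (- g) = \sum_(k < 4) (A * x `^ (- g) / 4).
  by rewrite sumr_const card_ord -mulr_natr; field.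
apply: ler_sum => k _; rewrite /branch x01; set s := preimage_ang k t.
have [/andP[y0 y1]] := left_invP (a0 s) x01.
move: (left_inv (a s) x) y0 y1 => y y0 y1 e.
have HR := HK s ((x + 1) / 2) (ltac:(lra)).
have HR0 : 0 <= H s ((x + 1) / 2) by exact: harnack_ge0 hH _ _.
move: (H s ((x + 1) / 2)) HR HR0 => r HR HR0.
have HL := HA s y (ltac:(rewrite y0/=; lra)).
rewrite -lerBrDr.
apply: (@le_trans _ _ (A * y `^ (- g) / left_deriv (a s) y / 4)).
  by rewrite ler_wpM2r// ler_wpM2r// invr_ge0 ltW// left_deriv_gt0.
rewrite lerBrDr -e /left_map /left_deriv; set u := (2 * y) `^ a s.
have u0 : 0 < u by rewrite powR_gt0; lra.
have u1 : u <= 1 by apply: powR_le1 => //; lra.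
have g0 : 0 < g by apply: lt_le_trans (a0 s) _.
have /andP[bs as1] := ab s.
have ags := ag s.
have uy : 1 <= u * y `^ (- g).
  rewrite powRN ler_pdivlMr ?powR_gt0// mul1r.
  apply: (@le_trans _ _ ((2 * y) `^ g)).
    apply: ge0_ler_powR; rewrite ?nnegrE; lra.
  by rewrite ger_powR//; lra.
rewrite powRM; [|lra|lra].
have ug : (1 + u)^-1 <= (1 + u) `^ (- g).
  rewrite powRN lef_pV2 ?posrE ?powR_gt0//; [|lra|lra].
  by rewrite -[leRHS]powRr1 ?ler_powR//; lra.
apply: (@le_trans _ _ (A * (y `^ (- g) * (1 + u)^-1) / 4)); last first.
  by rewrite ler_wpM2r// ler_wpM2l// ler_wpM2l// powR_ge0.
have d0 : 0 < 1 + (1 + a s) * u by have := a0 s; nra.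
rewrite -(@ler_pM2r _ ((1 + u) * (1 + (1 + a s) * u) * 8)); last first.
  by rewrite !mulr_gt0//; lra.
set p := y `^ (- g) in uy *.
rewrite [leRHS](_ : _ = 2 * A * p * (1 + (1 + a s) * u)); last first.
  by field; rewrite gt_eqF//; lra.
rewrite [leLHS](_ : _ = 2 * A * p * (1 + u) +
    r * ((1 + u) * (1 + (1 + a s) * u))); last first.
  by field; rewrite gt_eqF//; lra.
have h6 : (1 + u) * (1 + (1 + a s) * u) <= 6.
  have h : a s * u <= 1 by apply: mulr_ile1 => //; apply: ltW.
  have : (1 + a s) * u <= 2 by rewrite mulrDl mul1r (natrD _ 1 1) lerD.
  by move: ((1 + a s) * u) => v v2; nra.
have h7 : r * ((1 + u) * (1 + (1 + a s) * u)) <= K * 6.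
  by apply: ler_pM => //; rewrite mulr_ge0//; lra.
have h8 : A * b <= A * a s * (u * p).
  apply: (@le_trans _ _ (A * a s)); first exact: ler_wpM2l.
  by apply: ler_peMr => //; apply: mulr_ge0 => //; exact: ltW.
rewrite (_ : 2 * A * p * (1 + (1 + a s) * u) =
   2 * A * p * (1 + u) + 2 * (A * a s * (u * p))); last ring.
by rewrite lerD2l; lra.
Qed.

End transfer.

(** * Densities and changes of variables *)

Section density.
Context d (T : measurableType d) (R : realType).
Variables (mu : {measure set T -> \bar R}) (f : T -> R).
Hypothesis mf : measurable_fun setT f.
Hypothesis f0 : forall x, 0 <= f x.

Definition density_measure of measurable_fun setT f & (forall x, 0 <= f x) :
    set T -> \bar R :=
  fun A => (\int[mu]_(x in A) (f x)%:E)%E.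

Local Notation nu := (density_measure mf f0).

Let nu0 : nu set0 = 0%E. Proof. exact: integral_set0. Qed.

Let nu_ge0 A : (0 <= nu A)%E.
Proof. by apply: integral_ge0 => x _; rewrite lee_fin. Qed.

Let nu_additive : semi_sigma_additive nu.
Proof.
apply: semi_sigma_additive_nng_induced; first exact/measurable_EFinP.
by move=> x; rewrite lee_fin.
Qed.

HB.instance Definition _ := isMeasure.Build _ _ _ nu nu0 nu_ge0 nu_additive.

Import HBNNSimple.

Lemma ge0_integral_density (rho : {measure set T -> \bar R}) (phi : T -> \bar R) :
  (forall A, measurable A -> rho A = nu A) ->
  measurable_fun setT phi -> (forall x, (0 <= phi x)%E) ->
  (\int[rho]_x phi x = \int[mu]_x (phi x * (f x)%:E))%E.
Proof.
move=> rhoE mphi phi0; pose g := nnsfun_approx measurableT mphi.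
have gphi x : (EFin \o g ^~ x) @ \oo --> phi x by exact: cvg_nnsfun_approx.
have nd_g x : {homo (fun n => g n x) : m n / (m <= n)%N >-> m <= n}.
  by move=> m n mn; exact/lefP/nd_nnsfun_approx.
have step n : (\int[rho]_x (g n x)%:E = \int[mu]_x ((g n x)%:E * (f x)%:E))%E.
  under eq_integral do rewrite fimfunE -fsumEFin//.
  rewrite ge0_integral_fsum//; last 2 first.
    by move=> r; exact/measurable_EFinP/measurable_funM.
    by move=> r x _; rewrite nnfun_muleindic_ge0.
  transitivity (\sum_(r \in range (g n)) \int[mu]_x
      ((r * \1_(g n @^-1` [set r]) x)%:E * (f x)%:E))%E; last first.
    rewrite -ge0_integral_fsum//; last 2 first.
      move=> r; apply: emeasurable_funM; last exact/measurable_EFinP.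
      by apply/measurable_EFinP; exact: measurable_funM.
      by move=> r x _; apply: mule_ge0; rewrite ?lee_fin//; exact: nnfun_muleindic_ge0.
    apply: eq_integral => x _; rewrite -ge0_mule_fsuml; last first.
      by move=> r; rewrite nnfun_muleindic_ge0.
    by rewrite fsumEFin// -fimfunE.
  apply: eq_fsbigr => r /set_mem[y _ yr].
  have r0 : 0 <= r by rewrite -yr.
  rewrite (integralZl_indic _ (fun r => g n @^-1` [set r]))//; last first.
    by move=> r0'; rewrite preimage_nnfun0.
  rewrite integral_indic// setIT rhoE// /density_measure.
  rewrite integral_mkcond -ge0_integralZl//; last 2 first.
    by apply/(measurable_restrictT _ _).1 => //; apply/measurable_EFinP/measurable_funTS.
    by move=> x _; rewrite erestrict_ge0// => z _; rewrite lee_fin.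
  apply: eq_integral => x _; rewrite patchE indicE.
  by case: ifPn => _; rewrite ?mulr1 ?mulr0 ?mul0e ?mule0.
transitivity (limn (fun n => \int[rho]_x (g n x)%:E)%E).
  rewrite -monotone_convergence//.
  - by apply: eq_integral => x _; apply/esym/cvg_lim => //; exact: gphi.
  - by move=> n; exact/measurable_EFinP.
  - by move=> n x _; rewrite lee_fin.
  - by move=> x _ m n mn; rewrite lee_fin; exact: nd_g.
rewrite (eq_fun step) -monotone_convergence//.
- apply: eq_integral => x _; apply/cvg_lim => //.
  by apply: cvgeZr => //; exact: gphi.
- by move=> n; apply: emeasurable_funM; exact/measurable_EFinP.
- by move=> n x _; rewrite mule_ge0 ?lee_fin.
- by move=> x _ m n mn; rewrite lee_wpmul2r ?lee_fin//; exact: nd_g.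
Qed.

End density.

Lemma ge0_integral_mrestr d (T : measurableType d) (R : realType)
    (mu rho : {measure set T -> \bar R}) (D : set T) (phi : T -> \bar R) :
  measurable D -> (forall A, measurable A -> rho A = mu (A `&` D)) ->
  measurable_fun setT phi -> (forall x, (0 <= phi x)%E) ->
  (\int[rho]_x phi x = \int[mu]_(x in D) phi x)%E.
Proof.
move=> mD rhoE mphi phi0.
have mI : measurable_fun setT (\1_D : T -> R) by exact: measurable_indic.
have I0 x : 0 <= \1_D x :> R by rewrite indicE.
rewrite (@ge0_integral_density _ _ _ mu _ mI I0)// => [|A mA]; last first.
  by rewrite rhoE// /density_measure integral_indic// setIC.
rewrite [RHS]integral_mkcond; apply: eq_integral => x _.
by rewrite patchE indicE; case: ifPn; rewrite ?mule1 ?mule0.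
Qed.

Section change_of_variables.
Variable R : realType.
Variables (S S' : R -> R) (c d : R).
Hypothesis cd : c < d.
Hypothesis dS : forall y, c < y -> is_derive y 1 S (S' y).
Hypothesis cS' : forall y, c < y -> {for y, continuous S'}.
Hypothesis S'0 : forall y, c < y -> 0 <= S' y.
Hypothesis S_itv : forall y, c < y <= d -> 0 < S y <= 1.
Hypothesis S_lt : forall y z, c < y -> y < z -> z <= d -> S y < S z.
Hypothesis S_surj : forall x, 0 < x <= 1 -> exists y, c < y <= d /\ S y = x.

Local Notation mu := (@lebesgue_measure R).
Let D : set (measurableTypeR R) := `]c, d]%classic.
Let f : measurableTypeR R -> measurableTypeR R := S' \_ D.
Let s : measurableTypeR R -> measurableTypeR R := S \_ D.

Let mD : measurable D. Proof. exact: measurable_itv. Qed.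

Let cS y : c < y -> {for y, continuous S}.
Proof.
by move=> y0; apply/differentiable_continuous/derivable1_diffP; case: (dS y0).
Qed.

Let mS : measurable_fun D (S : measurableTypeR R -> measurableTypeR R).
Proof.
have m : measurable_fun (`]c, +oo[%classic : set R) S.
  apply: open_continuous_measurable_fun; first exact: interval_open.
  by move=> y /[!inE]/=; rewrite in_itv/= andbT => /cS.
by apply: measurable_funS m => //; exact: subset_itvl.
Qed.

Let mS' : measurable_fun D (S' : measurableTypeR R -> measurableTypeR R).
Proof.
have m : measurable_fun (`]c, +oo[%classic : set R) S'.
  apply: open_continuous_measurable_fun; first exact: interval_open.
  by move=> y /[!inE]/=; rewrite in_itv/= andbT => /cS'.
by apply: measurable_funS m => //; exact: subset_itvl.
Qed.

Let mf : measurable_fun setT (f : measurableTypeR R -> measurableTypeR R).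
Proof. exact/(measurable_restrictT _ _).1. Qed.

Let ms : measurable_fun setT (s : measurableTypeR R -> measurableTypeR R).
Proof. exact/(measurable_restrictT _ _).1. Qed.

Let f0 y : 0 <= f y.
Proof.
rewrite /f patchE; case: ifPn => //; rewrite inE /D/= in_itv/= => /andP[cy _].
exact: S'0.
Qed.

Let Sd : S d = 1.
Proof.
have [|y [/andP[cy]]] := S_surj (x := 1); first lra.
rewrite le_eqVlt => /predU1P[->//|yd] Sy.
have /andP[_] := S_itv (y := d) (ltac:(rewrite cd lexx//)).
by have := S_lt cy yd (lexx _); rewrite Sy; lra.
Qed.

Let nu := density_measure mu mf f0.
Let rho : set (measurableTypeR R) -> \bar R := pushforward nu s.
Let mu1 : set (measurableTypeR R) -> \bar R := mrestr mu (measurable_itv `]0, 1]).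

Let rho_tail u : rho `]u, +oo[%classic =
  (\int[mu]_(y in D `&` [set y | (u < S y)%R]) (S' y)%:E)%E.
Proof.
rewrite /rho /pushforward /nu /density_measure [LHS]integral_mkcond.
rewrite [RHS]integral_mkcond; apply: eq_integral => y _.
rewrite !patchE /f /s /= !patchE.
have [yD|yD] := boolP (y \in D); last first.
  rewrite [in RHS]memNset; last by case=> /mem_set; rewrite (negbTE yD).
  by case: ifP => //; rewrite !patchE (negbTE yD).
have -> : (y \in s @^-1` `]u, +oo[) = (y \in D `&` [set y0 | u < S y0]).
  apply/idP/idP => /set_mem h; apply/mem_set; move: h;
    rewrite /= /s in_itv/= andbT patchE yD.
    by split => //; exact/set_mem.
  by case.
by rewrite ?patchE ?yD.
Qed.

Let rho_pos u : 0 < u -> rho `]u, +oo[%classic = mu1 `]u, +oo[%classic.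
Proof.
move=> u0; rewrite rho_tail /mu1 /mrestr.
have [u1|u1] := leP 1 u.
  rewrite (_ : D `&` _ = set0) ?integral_set0; last first.
    rewrite -subset0 => y [/= /S_itv /andP[_ Sy]]; lra.
  rewrite (_ : _ `&` _ = set0) ?measure0//.
  by rewrite -subset0 => y []/=; rewrite !in_itv/= andbT; lra.
have [|e [/andP[ce ed] eS]] := S_surj (x := u); first by rewrite u0 ltW.
have ed' : e < d.
  by rewrite lt_neqAle ed andbT; apply/eqP => ed'; move: eS u1; rewrite ed' Sd; lra.
have -> : D `&` [set y | u < S y] = `]e, d]%classic.
  apply/seteqP; split => y /=; rewrite /D/= !in_itv/=.
    move=> [/andP[cy yd] uS]; rewrite yd andbT ltNge; apply/negP.
    rewrite le_eqVlt => /predU1P[ye|ye]; first by move: uS; rewrite ye eS; lra.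
    by have := S_lt cy ye ed; rewrite eS; lra.
  move=> /andP[ey yd]; rewrite yd andbT (lt_trans ce)//; split=> //.
  by rewrite -eS S_lt.
rewrite integral_itv_obnd_cbnd; last first.
  apply/measurable_EFinP; apply: measurable_funS mS' => //.
  by move=> y; rewrite /D/= !in_itv/= => /andP[ey ->]; rewrite (lt_trans ce).
rewrite (@continuous_FTC2 R S' S)//; last 3 first.
- apply: continuous_in_subspaceT => y /[!inE]/=; rewrite in_itv/= => /andP[ey _].
  by apply: cS'; exact: lt_le_trans ey.
- split.
  + move=> y; rewrite in_itv/= => /andP[ey _].
    by have [] := dS (lt_trans ce ey).
  + by apply: cvg_at_right_filter; exact: cS.
  + by apply: cvg_at_left_filter; exact: cS (lt_trans _ ed').
- move=> y; rewrite in_itv/= => /andP[ey _]; rewrite derive1E.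
  by have [_ ->] := dS (lt_trans ce ey).
rewrite Sd eS (_ : _ `&` _ = `]u, 1]%classic); last first.
  apply/seteqP; split => y /=; rewrite !in_itv/= ?andbT.
    by move=> [-> /andP[_ ->]].
  by move=> /andP[uy ->]; rewrite uy (lt_trans u0 uy).
by rewrite lebesgue_measure_itv/= lte_fin u1.
Qed.

Let rho_measure : {measure set (measurableTypeR R) -> \bar R} :=
  measure_function_pushforward__canonical__measure_function_Measure nu ms.

Let bigcup_tail : \bigcup_n (`]n.+1%:R^-1, +oo[%classic : set (measurableTypeR R)) =
  `]0, +oo[%classic.
Proof.
apply/seteqP; split => [y [n _]|y] /=; rewrite !in_itv/= !andbT.
  by apply: lt_trans; rewrite invr_gt0.
move=> y0; exists (Num.bound y^-1) => //=; rewrite in_itv/= andbT.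
rewrite invf_plt ?posrE// ; apply: (@lt_le_trans _ _ (Num.bound y^-1)%:R).
  by apply: archi_boundP; rewrite invr_ge0 ltW.
by rewrite ler_nat.
Qed.

Let tail0 (m : {measure set (measurableTypeR R) -> \bar R}) :
  (fun n => m `]n.+1%:R^-1, +oo[%classic) @ \oo --> m `]0, +oo[%classic.
Proof.
rewrite -bigcup_tail; apply: nondecreasing_cvg_mu.
- by move=> n; exact: measurable_itv.
- by apply: bigcupT_measurable => n; exact: measurable_itv.
- move=> n k nk; apply/subsetPset => y /=; rewrite !in_itv/= !andbT.
  by apply: le_lt_trans; rewrite lef_pV2 ?posrE// ler_nat.
Qed.

Let rho_zero : rho `]0, +oo[%classic = mu1 `]0, +oo[%classic.
Proof.
transitivity (limn (fun n => rho (`]n.+1%:R^-1, +oo[%classic : set (measurableTypeR R)))).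
  by apply/esym/cvg_lim => //; exact: (@tail0 rho_measure).
rewrite (_ : (fun n => _) = (fun n => mu1 `]n.+1%:R^-1, +oo[%classic)).
  by apply/cvg_lim => //; exact: (@tail0 [the measure _ _ of mu1]).
by apply/funext => n; rewrite rho_pos.
Qed.

Let rhoE A : measurable A -> rho A = mu1 A.
Proof.
have tail u : rho `]u, +oo[%classic = mu1 `]u, +oo[%classic.
  have [u0|u0] := ltP 0 u; first exact: rho_pos.
  transitivity (rho `]0, +oo[%classic).
    rewrite !rho_tail; congr (integral _ _ _); apply/seteqP.
    split=> y [/= yD _]; split => //=; have /andP[Sy _] := S_itv yD => //.
    exact: le_lt_trans Sy.
  rewrite rho_zero /mu1 /mrestr; congr (mu _); apply/seteqP.
  split=> y []/=; rewrite !in_itv/= !andbT => h /andP[y0 y1]; rewrite y0 y1; split=> //.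
  exact: le_lt_trans y0.
apply: (@measure_unique _ R (measurableTypeR R)
  [set A | exists u, A = `]u, +oo[%classic] (fun k => `]- k%:R, +oo[%classic)
  _ _ _ _ rho_measure mu1).
- exact: RGenOInfty.measurableE.
- move=> _ _ [u ->] [v ->]; exists (Num.max u v).
  by apply/seteqP; split => y /=; rewrite !in_itv/= !andbT gt_max; [move=> [-> ->]|move/andP].
- by move=> k; exists (- k%:R).
- rewrite -subTset => y _; exists (Num.bound `|y|) => //=.
  rewrite in_itv/= andbT ltrNl; apply: le_lt_trans (archi_boundP (normr_ge0 y)).
  by rewrite -normrN ler_norm.
- by move=> _ [u ->]; exact: tail.
- move=> k; rewrite -[X in (X < _)%E]/(rho _) tail /mu1 /mrestr.
  apply: (@le_lt_trans _ _ (mu `]0, 1]%classic)).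
    by apply: le_measure; rewrite ?inE//; apply: measurableI => //; exact: measurable_itv.
  by rewrite lebesgue_measure_itv/= lte_fin ltr01 sube0 ltry.
Qed.

(** Both sides are integrals for measures that agree on the half-lines
    starting at a positive point, by the fundamental theorem of calculus; the
    derivative may thus blow up at the left end of the interval. *)
Lemma increasing_substitution (phi : measurableTypeR R -> \bar R) :
  measurable_fun setT phi -> (forall x, (0 <= phi x)%E) ->
  (\int[mu]_(x in `]0%R, 1%R]) phi x =
   \int[mu]_(y in `]c, d]) (phi (S y) * (S' y)%:E))%E.
Proof.
move=> mphi phi0.
transitivity (\int[rho_measure]_x phi x)%E.
  by apply/esym/ge0_integral_mrestr => // A mA; exact: rhoE.
rewrite [LHS]ge0_integral_pushforward//.
rewrite preimage_setT.
have -> := @ge0_integral_density _ _ _ mu _ mf f0 nu (phi \o s)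
  (fun _ _ => erefl) (measurableT_comp mphi ms) (fun x => phi0 _).
rewrite [RHS]integral_mkcond; apply: eq_integral => y _ /=.
rewrite /f /s !patchE; case: ifPn => yD //=.
rewrite -[X in (_ * X)%E]/(0%:E).
by rewrite mule0.
Qed.

End change_of_variables.

(** * Measurability, and integrals over the cylinder as iterated integrals *)

Section circle_section.
Variable R : realType.
Implicit Types (w : circle R) (t : R).

Definition circle_sec w : R := repr w - (Num.floor (repr w))%:~R.

Lemma circle_secK w : circle_proj (circle_sec w) = w.
Proof.
rewrite -[RHS]reprK; apply/circle_projP; rewrite /circle_sec.
by rewrite addrAC subrr add0r rpredN intr_int.
Qed.

Lemma circle_sec_itv w : 0 <= circle_sec w < 1.
Proof.
rewrite /circle_sec subr_ge0 floor_le_tmp/= ltrBlDl.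
by have := floorD1_gt (repr w); rewrite intrD.
Qed.

Lemma circle_sec_proj t : circle_sec (circle_proj t) - t \is a Num.int.
Proof. by apply/circle_projP; rewrite circle_secK. Qed.

Lemma circle_proj_int t t' : t - t' \is a Num.int ->
  circle_proj t = circle_proj t' :> circle R.
Proof. by move/circle_projP. Qed.

Lemma circle_proj_open (U : set R) : open U -> open (@circle_proj R @` U).
Proof.
move=> oU.
have -> : open (@circle_proj R @` U) = open (@circle_proj R @^-1` (@circle_proj R @` U)) by [].
rewrite (_ : _ @^-1` _ = \bigcup_(n : int) ((fun t => t + n%:~R) @^-1` U)).
  apply: bigcup_open => n _.
  have /continuousP : continuous (fun t : R => t + n%:~R).
    by move=> t; apply: cvgD => //; exact: cvg_cst.
  exact.
apply/seteqP; split=> t /=.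
  move=> [u Uu /circle_projP/intrP[n e]]; exists n => //=.
  by rewrite -e addrC subrK.
by move=> [n _ /= Un]; exists (t + n%:~R) => //; apply/circle_projP; rewrite addrAC subrr add0r intr_int.
Qed.

Lemma circle_sec_id t : 0 <= t < 1 -> circle_sec (circle_proj t) = t.
Proof.
move=> /andP[t0 t1]; have /intrP[n e] := circle_sec_proj t.
have /andP[s0 s1] := circle_sec_itv (circle_proj t).
suff n0 : n = 0 by move: e; rewrite n0 => /eqP; rewrite subr_eq0 => /eqP.
have h1 : (n%:~R : R) < 1%:~R by rewrite -e; lra.
have h2 : ((-1)%:~R : R) < n%:~R by rewrite -e mulrN1z; lra.
move: h1 h2; rewrite !ltr_int; clear; lia.
Qed.

Lemma measurable_circle_sec :
  measurable_fun setT (circle_sec : circle R -> measurableTypeR R).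
Proof.
apply: (measurability _ (RGenOInfty.measurableE R)).
move=> _ [_ [u ->] <-]; rewrite setTI.
have [u0|u0] := ltP u 0.
  rewrite (_ : _ @^-1` _ = setT) ?measurableT//; apply/seteqP; split => // w _ /=.
  by rewrite in_itv/= andbT (lt_le_trans u0)//; have /andP[] := circle_sec_itv w.
rewrite (_ : _ @^-1` _ = @circle_proj R @` `]u, 1[%classic).
  by apply: sub_sigma_algebra; apply: circle_proj_open; exact: interval_open.
apply/seteqP; split => [w|_ [t + <-]] /=; rewrite !in_itv/= ?andbT.
  move=> uw; exists (circle_sec w); last exact: circle_secK.
  by rewrite /= in_itv/= uw; have /andP[] := circle_sec_itv w.
move=> /andP[]; rewrite !bnd_simp => ut t1.
by rewrite circle_sec_id// t1 (le_trans u0)// ltW.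
Qed.

End circle_section.

Section harnack_measurable.
Variable R : realType.
Local Notation plane := (measurableTypeR R * measurableTypeR R)%type.

Lemma measurable_harnack_slice B (H : R -> R -> R) t : harnack B H ->
  measurable_fun setT (H t : measurableTypeR R -> measurableTypeR R).
Proof.
move=> hH; apply: (measurability _ (RGenOInfty.measurableE R)).
move=> _ [_ [u ->] <-]; rewrite setTI.
have [u0|u0] := ltP u 0.
  rewrite (_ : _ @^-1` _ = setT) ?measurableT//; apply/seteqP; split => // x _ /=.
  by rewrite in_itv/= andbT (lt_le_trans u0)// (harnack_ge0 hH).
apply: is_interval_measurable => x y /=; rewrite !in_itv/= !andbT => ux uy z /andP[xz zy].
have io v : u < H t v -> 0 < v <= 1.
  by move=> uv; apply: contraTT uv => /(harnack_out hH) ->; rewrite -leNgt.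
have /andP[x0 x1] := io x ux; have /andP[y0 y1] := io y uy.
by rewrite /= in_itv/= andbT (lt_le_trans uy)// (harnack_dec hH)// (lt_le_trans x0).
Qed.

(** The lower bounds of [H] that the exponential condition draws from the
    rational angles are measurable, and [H] is their supremum. *)
Lemma measurable_harnack B (H : R -> R -> R) : 0 <= B -> harnack B H ->
  measurable_fun setT (fun p : plane => H p.1 p.2 : measurableTypeR R).
Proof.
move=> B0 hH; apply: (measurability _ (RGenOInfty.measurableE R)).
move=> _ [_ [u ->] <-]; rewrite setTI.
rewrite (_ : _ @^-1` _ = \bigcup_(r : rat) [set p : plane |
    u < H (ratr r) p.2 * expR (- (B * `|(p.1 : R) - ratr r|))]); last first.
  apply/seteqP; split => -[t x] /=.
    rewrite in_itv/= andbT => ut.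
    have H0 := harnack_ge0 hH t x.
    have [u0|u0] := ltP u 0.
      exists 0 => //=; apply: lt_le_trans u0 _; rewrite mulr_ge0 ?expR_ge0//.
      exact: harnack_ge0 hH _ _.
    pose e := (H t x - u) / (2 * B * H t x + 1).
    have K0 : 0 < 2 * B * H t x + 1 by have : 0 <= 2 * B * H t x; [rewrite !mulr_ge0|lra].
    have e0 : 0 < e by rewrite divr_gt0// subr_gt0.
    have [r] := @rat_in_itvoo R t (t + e) (ltac:(lra)).
    rewrite in_itv/= => /andP[tr re]; exists r => //=.
    set D := `|t - ratr r|.
    have De : D < e by rewrite /D ltr0_norm; lra.
    have BD : 0 <= B * D by rewrite mulr_ge0//; exact: normr_ge0.
    have h1 := harnack_exp hH t (ratr r) x; rewrite -/D in h1.
    have h2 : H t x * expR (- (B * D)) <= H (ratr r) x.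
      by rewrite expRN ler_pdivrMr// expR_gt0.
    apply: (@lt_le_trans _ _ (H t x * expR (- (B * D)) * expR (- (B * D)))); last first.
      by rewrite ler_wpM2r// expR_ge0.
    rewrite -mulrA -expRD.
    apply: (@lt_le_trans _ _ (H t x * (1 + (- (B * D) - B * D)))); last first.
      by rewrite ler_wpM2l// expR_ge1Dx.
    have h3 : D * (2 * B * H t x + 1) < H t x - u by rewrite -ltr_pdivlMr.
    have D0 : 0 <= D by exact: normr_ge0.
    nra.
  move=> [r _ /=] ur; rewrite in_itv/= andbT; apply: (lt_le_trans ur).
  by rewrite expRN ler_pdivrMr ?expR_gt0// distrC; exact: harnack_exp hH _ _ _.
apply: bigcupT_measurable_rat => r.
rewrite (_ : [set p | _] = (fun p : plane =>
    (H (ratr r) p.2 * expR (- (B * `|(p.1 : R) - ratr r|)) : measurableTypeR R))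
    @^-1` `]u, +oo[%classic); last first.
  by apply/seteqP; split=> p /=; rewrite in_itv/= andbT.
rewrite -[X in measurable X]setTI.
suff : measurable_fun setT (fun p : plane =>
    H (ratr r) p.2 * expR (- (B * `|(p.1 : R) - ratr r|)) : measurableTypeR R).
  by apply => //; exact: measurable_itv.
apply: measurable_funM.
  exact: measurableT_comp (measurable_harnack_slice _ hH) measurable_snd.
apply: (measurableT_comp (@measurable_expR R)).
apply: measurableT_comp => //; apply: measurable_funM => //.
apply: measurableT_comp => //; apply: measurable_funB => //.
Qed.

End harnack_measurable.

Section strip_integral.
Variable R : realType.
Local Notation mu := (@lebesgue_measure R).
Local Notation plane := (measurableTypeR R * measurableTypeR R)%type.
Local Open Scope ereal_scope.

(** The function on the cylinder with lift [H], when [H] is periodic. *)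
Definition descend (H : R -> R -> R) (p : cylinder R) : R :=
  H (circle_sec p.1) p.2.

Lemma measurable_descend (H : R -> R -> R) :
  measurable_fun setT (fun p : plane => H p.1 p.2 : measurableTypeR R) ->
  measurable_fun setT (descend H : cylinder R -> measurableTypeR R).
Proof.
move=> mH.
apply: (measurableT_comp (g := fun p : cylinder R =>
  (circle_sec p.1, p.2) : plane) mH).
apply: (measurable_fun_pair (T1 := measurableTypeR R) (T2 := measurableTypeR R)
  (f := fun p : cylinder R => circle_sec p.1) (g := fun p : cylinder R => p.2)).
  exact: measurableT_comp (@measurable_circle_sec R) measurable_fst.
exact: measurable_snd.
Qed.

Lemma descend_proj (H : R -> R -> R) t x : periodic1 H ->
  descend H (circle_proj t, x) = H t x.
Proof. by move=> pH; apply: periodic1_int => //; exact: circle_sec_proj. Qed.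

Lemma measurable_lift (f : cylinder R -> \bar R) : measurable_fun setT f ->
  measurable_fun setT (fun p : plane => f (circle_proj p.1, p.2)).
Proof.
move=> mf.
apply: (measurableT_comp (g := fun p : plane =>
  (circle_proj p.1, p.2) : cylinder R) mf).
apply: (measurable_fun_pair (T1 := circle R) (T2 := measurableTypeR R)
  (f := fun p : plane => circle_proj p.1) (g := fun p : plane => p.2)).
  exact: measurableT_comp (@measurable_circle_proj R) measurable_fst.
exact: measurable_snd.
Qed.

Lemma ge0_integral_leb01 (g : measurableTypeR R -> \bar R) :
  measurable_fun setT g -> (forall x, 0 <= g x) ->
  \int[@leb01 R]_x g x = \int[mu]_(x in `]0%R, 1%R]) g x.
Proof.
move=> mg g0; rewrite integral_itv_obnd_cbnd; last exact: measurable_funTS.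
by apply: ge0_integral_mrestr => //; exact: measurable_itv.
Qed.

Lemma ge0_integral_strip (f : cylinder R -> \bar R) :
  measurable_fun setT f -> (forall p, 0 <= f p) ->
  \int[@leb_strip R]_p f p =
  \int[mu]_(t in `]0%R, 1%R]) \int[mu]_(x in `]0%R, 1%R]) f (circle_proj t, x).
Proof.
move=> mf f0.
rewrite [LHS](fubini_tonelli1 f mf f0).
have mF := measurable_fun_fubini_tonelli_F (m2 := @leb01 R) f mf f0.
have F0 w : 0 <= fubini_F (@leb01 R) f w by exact: integral_ge0.
have mG := measurableT_comp mF (@measurable_circle_proj R).
have E1 := ge0_integral_pushforward (@measurable_circle_proj R) (@leb01 R)
  (@measurableT _ _) mF (fun w _ => F0 w).
have E2 := ge0_integral_leb01 mG (fun t => F0 _).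
apply: (etrans E1); rewrite preimage_setT; apply: (etrans E2).
apply: eq_integral => t _; apply: ge0_integral_leb01 => //.
exact: measurableT_comp mf (measurable_pair1 _).
Qed.

End strip_integral.

Section skew_measurable.
Variable R : realType.
Variable alpha : circle R -> R.
Hypothesis malpha : measurable_fun setT (alpha : circle R -> measurableTypeR R).
Hypothesis alpha0 : forall w, 0 < alpha w.

Lemma measurable_T_ :
  measurable_fun setT
    (fun p : cylinder R => T_ (alpha p.1) p.2 : measurableTypeR R).
Proof.
have m2 : measurable_fun setT (fun p : cylinder R => p.2 : measurableTypeR R).
  exact: measurable_snd.
have ma : measurable_fun setT (fun p : cylinder R => alpha p.1 : measurableTypeR R).
  exact: measurableT_comp malpha measurable_fst.
rewrite /T_; apply: measurable_fun_ifT.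
- by apply: measurable_fun_ler.
- apply: measurable_funM => //; apply: measurable_funD => //.
  apply: measurable_funM.
    exact: measurableT_comp (measurable_powRr _) ma.
  rewrite /powR; apply: measurable_fun_ifT.
  + by apply: measurable_fun_eqr.
  + rewrite (_ : (fun _ => _) = cst 0)//; apply/funext => p.
    by rewrite gt_eqF.
  + apply: (measurableT_comp (@measurable_expR R)).
    apply: measurable_funM => //.
    exact: measurableT_comp (@measurable_ln R) m2.
- by apply: measurable_funB => //; apply: measurable_funM.
Qed.

Lemma measurable_skew : measurable_fun setT (skew_map alpha).
Proof.
apply: (measurable_fun_pair (T1 := circle R) (T2 := measurableTypeR R)
  (f := fun p : cylinder R => F_ p.1)
  (g := fun p : cylinder R => T_ (alpha p.1) p.2)).
  apply: (measurableT_comp (f := @F_ R)) => //.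
  have -> : @F_ R = @circle_proj R \o (fun t => 4 * t) \o @circle_sec R.
    by apply/funext => w /=; rewrite -F_proj circle_secK.
  apply: measurableT_comp; last exact: measurable_circle_sec.
  apply: measurableT_comp; first exact: measurable_circle_proj.
  exact: measurable_funM.
exact: measurable_T_.
Qed.

End skew_measurable.

(** * Duality between the map and the transfer operator *)

Section fibre_duality.
Variable R : realType.
Local Notation mu := (@lebesgue_measure R).
Local Open Scope ereal_scope.

Lemma ge0_integral_itv_cat (f : measurableTypeR R -> \bar R) (u v w : R) :
  measurable_fun setT f -> (forall x, 0 <= f x) -> (u <= v)%R -> (v <= w)%R ->
  \int[mu]_(x in `]u, w]) f x =
  \int[mu]_(x in `]u, v]) f x + \int[mu]_(x in `]v, w]) f x.
Proof.
move=> mf f0 uv vw; rewrite -ge0_integral_setU//.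
- congr (integral _ _ _); apply/seteqP; split => x /=; rewrite !in_itv/=.
    move=> /andP[ux xw]; have [xv|vx] := leP x v; [left|right].
      by rewrite ux.
    by rewrite xw.
  by move=> [] /andP[h1 h2]; apply/andP; split; [|exact: le_trans vw| exact: le_lt_trans h1|].
- exact: measurable_funTS.
- apply/disj_setPS => x /= []; rewrite !in_itv/= => /andP[_ xv] /andP[vx _].
  by move: (le_lt_trans xv vx); rewrite ltxx.
Qed.

Lemma affine_substitution (f : measurableTypeR R -> \bar R) (c r : R) :
  measurable_fun setT f -> (forall x, 0 <= f x) -> (0 < r)%R ->
  \int[mu]_(x in `]c, (c + r)%R]) f x =
  \int[mu]_(z in `]0%R, 1%R]) (f (c + r * z)%R * r%:E).
Proof.
move=> mf f0 r0.
have mphi : measurable_fun setT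
    (fun z : measurableTypeR R => f (c + r * z)%R * r%:E).
  apply: emeasurable_funM => //; apply: (measurableT_comp mf).
  by apply: measurable_funD => //; exact: measurable_funM.
rewrite (@increasing_substitution R (fun y => r^-1 * (y - c))%R (cst (r^-1)%R) c (c + r)%R _ _ _ _ _ _ _
  (fun z : measurableTypeR R => f (c + r * z)%R * r%:E) mphi).
- apply: eq_integral => y _ /=.
  rewrite mulrA mulfV ?gt_eqF// mul1r subrKC -muleA -EFinM mulfV ?gt_eqF//.
  by rewrite mule1.
- by rewrite ltrDl.
- move=> y _.
  by apply: is_derive_eq; rewrite subr0 /GRing.scale/= mulr1.
- by move=> y _; exact: cvg_cst.
- by move=> y _ /=; rewrite invr_ge0 ltW.
- move=> y /andP[cy ycr]; rewrite mulr_gt0 ?invr_gt0 ?subr_gt0//=.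
  by rewrite ler_pdivrMl// mulr1 lerBlDl.
- by move=> y z _ yz _; rewrite ltr_pM2l ?invr_gt0// ltrD2r.
- move=> x /andP[x0 x1]; exists (c + r * x)%R; split.
    by rewrite ltrDl mulr_gt0//= lerD2l ler_piMr// ltW.
  by rewrite addrAC subrr add0r mulKf ?gt_eqF.
- by move=> x; rewrite mule_ge0// lee_fin ltW.
Qed.

Lemma base_duality (f : measurableTypeR R -> \bar R) :
  measurable_fun setT f -> (forall x, 0 <= f x) ->
  \int[mu]_(t in `]0%R, 1%R]) f t =
  \sum_(k < 4) \int[mu]_(s in `]0%R, 1%R]) (f (preimage_ang k s) * (4^-1)%:E).
Proof.
move=> mf f0.
have step n : \int[mu]_(t in `]0%R, (n%:R / 4)%R]) f t =
  \sum_(k < n) \int[mu]_(s in `]0%R, 1%R]) (f (preimage_ang k s) * (4^-1)%:E).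
  elim: n => [|n IH].
    by rewrite big_ord0 mul0r set_itv_ge ?integral_set0// bnd_simp ltxx.
  rewrite big_ord_recr/= -IH.
  rewrite (@ge0_integral_itv_cat f 0%R (n%:R / 4)%R)// ?divr_ge0// ?ler_pM2r ?ler_nat//.
  congr (_ + _).
  have -> : (n.+1%:R / 4 = n%:R / 4 + 4^-1 :> R)%R by rewrite -natr1; lra.
  rewrite affine_substitution//; apply: eq_integral => s _.
  by congr (f _ * _); rewrite /preimage_ang; lra.
by rewrite -(step 4%N) divff.
Qed.

(** The terms [kL] and [kR] come from the left and right halves of the fibre;
    they are given by the branch formulas on [0 < z <= 1] alone, because these
    formulas need not define measurable functions elsewhere. *)
Lemma fibre_duality (psi : measurableTypeR R -> \bar R) (h : R -> R) (c : R)
    (kL kR : measurableTypeR R -> measurableTypeR R) :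
  (0 < c)%R -> measurable_fun setT psi -> (forall x, 0 <= psi x) ->
  (forall x, 0 <= h x)%R ->
  measurable_fun setT (h : measurableTypeR R -> measurableTypeR R) ->
  measurable_fun setT (fun x : measurableTypeR R => T_ c x : measurableTypeR R) ->
  measurable_fun setT kL -> measurable_fun setT kR ->
  (forall x, 0 <= kL x)%R -> (forall x, 0 <= kR x)%R ->
  (forall z, 0 < z <= 1 ->
    kL z = h (left_inv c z) / left_deriv c (left_inv c z))%R ->
  (forall z, 0 < z <= 1 -> kR z = h ((z + 1) / 2) / 2)%R ->
  \int[mu]_(x in `]0%R, 1%R]) (psi (T_ c x) * (h x)%:E) =
  \int[mu]_(z in `]0%R, 1%R]) (psi z * (kL z + kR z)%:E).
Proof.
move=> c0 mpsi psi0 h0 mh mT mkL mkR kL0 kR0 kLE kRE.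
have mf : measurable_fun setT
    (fun x : measurableTypeR R => psi (T_ c x) * (h x)%:E).
  apply: emeasurable_funM; last exact/measurable_EFinP.
  exact: (measurableT_comp mpsi mT).
have f0 x : 0 <= psi (T_ c x) * (h x)%:E by rewrite mule_ge0// lee_fin.
rewrite (@ge0_integral_itv_cat _ 0%R (2^-1)%R)//; last lra.
have mL : measurable_fun setT (fun z => psi z * (kL z)%:E).
  by apply: emeasurable_funM => //; exact/measurable_EFinP.
have mR : measurable_fun setT (fun z => psi z * (kR z)%:E).
  by apply: emeasurable_funM => //; exact/measurable_EFinP.
have L0 z : 0 <= psi z * (kL z)%:E by rewrite mule_ge0// lee_fin.
have R0 z : 0 <= psi z * (kR z)%:E by rewrite mule_ge0// lee_fin.
transitivity (\int[mu]_(z in `]0%R, 1%R]) (psi z * (kL z)%:E + psi z * (kR z)%:E)); last first.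
  by apply: eq_integral => z _; rewrite EFinD ge0_muleDr// lee_fin.
rewrite ge0_integralD//; [|exact: measurable_funTS|exact: measurable_funTS].
congr (_ + _).
- rewrite (@increasing_substitution R (left_map c) (left_deriv c) 0%R (2^-1)%R _ _ _ _ _ _ _
    (fun z => psi z * (kL z)%:E) mL L0).
  + apply: eq_integral => y /set_mem/=; rewrite in_itv/= => /andP[y0 y1].
    have hy : (0 < left_map c y <= 1)%R.
      rewrite (lt_le_trans y0 (left_map_ge _ (ltW y0)))//= -(left_map_half c).
      by rewrite left_map_le// ltW.
    have -> : T_ c y = left_map c y by rewrite T_left// y1 ltW.
    rewrite kLE// left_mapK ?y0// -muleA -EFinM divfK//.
    by rewrite gt_eqF// left_deriv_gt0.
  + lra.
  + by move=> y y0; exact: is_derive_left_map.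
  + move=> y y0; apply/differentiable_continuous/derivable1_diffP.
    have D := is_derive_powR_double c y0.
    by rewrite /left_deriv; apply: ex_derive.
  + by move=> y _; apply/ltW/left_deriv_gt0.
  + move=> y /andP[y0 y1].
    rewrite (lt_le_trans y0 (left_map_ge _ (ltW y0)))//= -(left_map_half c).
    by rewrite left_map_le// ltW.
  + by move=> y z y0 yz _; rewrite left_map_lt// ltW.
  + by move=> x; exact: left_inv_ex.
- have := @affine_substitution _ (2^-1)%R (2^-1)%R mf f0 (ltac:(lra)).
  have -> : (2^-1 + 2^-1 = 1 :> R)%R by lra.
  move=> ->; apply: eq_integral => z /set_mem/=.
  rewrite in_itv/= => /andP[z0 z1]; rewrite kRE ?z0// T_right; last lra.
  have -> : (2 * (2^-1 + 2^-1 * z) - 1 = z :> R)%R by lra.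
  have -> : (2^-1 + 2^-1 * z = (z + 1) / 2 :> R)%R by lra.
  by rewrite -muleA -EFinM.
Qed.

End fibre_duality.

Section strip_duality.
Variable R : realType.
Local Notation mu := (@lebesgue_measure R).
Local Notation plane := (measurableTypeR R * measurableTypeR R)%type.
Local Open Scope ereal_scope.

Lemma measurable_section_integral (G : plane -> \bar R) :
  measurable_fun setT G -> (forall p, 0 <= G p) ->
  measurable_fun setT (fun t : measurableTypeR R =>
    \int[mu]_(z in `]0%R, 1%R]) G (t, z)).
Proof.
move=> mG G0.
rewrite (_ : (fun t => _) = fubini_F (@leb01 R) G).
  exact: measurable_fun_fubini_tonelli_F.
apply/funext => t; rewrite /fubini_F; apply/esym/ge0_integral_leb01 => //.
exact: measurableT_comp mG (measurable_pair1 _).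
Qed.

Variables (alpha : circle R -> R) (b l B : R).
Let a t := alpha (circle_proj t).
Hypothesis b0 : (0 < b)%R.
Hypothesis ab : forall w, (b <= alpha w <= 1)%R.
Hypothesis l0 : (0 <= l)%R.
Hypothesis a_lip : forall s t, (`|a s - a t| <= l * `|s - t|)%R.
Hypothesis B_ge : (l * (2 / b + 1) <= B)%R.
Hypothesis malpha : measurable_fun setT (alpha : circle R -> measurableTypeR R).

Let alpha0 w : (0 < alpha w)%R.
Proof. by have /andP[h _] := ab w; exact: lt_le_trans b0 h. Qed.

Let abt t : (b <= a t <= 1)%R. Proof. exact: ab. Qed.

Let B0 : (0 <= B)%R := B_ge0 b0 l0 B_ge.

Variable H : R -> R -> R.
Hypothesis hH : harnack B H.
Hypothesis pH : periodic1 H.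

Let hB c k : harnack B (branch a c k H).
Proof. exact: harnack_branch b0 abt l0 a_lip B_ge _ _ _ hH. Qed.

Let mB c k : measurable_fun setT
  (fun p : plane => branch a c k H p.1 p.2 : measurableTypeR R).
Proof. exact: measurable_harnack (hB c k). Qed.

Let branch0 c k s z :
  branch a c 0 H (4 * preimage_ang k s)%R z = branch a c k H s z.
Proof.
by rewrite /branch (_ : preimage_ang 0 _ = preimage_ang k s)//; rewrite /preimage_ang; lra.
Qed.

Variable psi : cylinder R -> \bar R.
Hypothesis mpsi : measurable_fun setT psi.
Hypothesis psi0 : forall p, 0 <= psi p.

Let mpsiB c k : measurable_fun setT (fun p : plane =>
  psi (circle_proj p.1, p.2) * (branch a c k H p.1 p.2)%:E).
Proof.
apply: emeasurable_funM; first exact: measurable_lift.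
by apply/measurable_EFinP; exact: mB.
Qed.

Let psiB0 c k (p : plane) :
  0 <= psi (circle_proj p.1, p.2) * (branch a c k H p.1 p.2)%:E.
Proof. by rewrite mule_ge0// lee_fin (harnack_ge0 (hB c k)). Qed.

Let G k (p : plane) :=
  psi (circle_proj p.1, p.2) * (branch a true k H p.1 p.2)%:E +
  psi (circle_proj p.1, p.2) * (branch a false k H p.1 p.2)%:E.

Let mG k : measurable_fun setT (G k). Proof. exact: emeasurable_funD. Qed.
Let G0 k p : 0 <= G k p. Proof. exact: adde_ge0. Qed.

Let inner t :
  \int[mu]_(x in `]0%R, 1%R])
     (psi (skew_map alpha (circle_proj t, x)) * (H t x)%:E) =
  4%:E * \int[mu]_(z in `]0%R, 1%R]) G 0 ((4 * t)%R, z).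
Proof.
have e0 : preimage_ang 0 (4 * t)%R = t by rewrite /preimage_ang; lra.
have mBs c : measurable_fun setT
    (fun z : measurableTypeR R => (4 * branch a c 0 H (4 * t) z)%R : measurableTypeR R).
  by apply: measurable_funM => //; exact: measurable_harnack_slice (hB c 0).
have Bs0 c z : (0 <= 4 * branch a c 0 H (4 * t) z)%R.
  by rewrite mulr_ge0// (harnack_ge0 (hB c 0)).
have e1 x : psi (skew_map alpha (circle_proj t, x)) =
    psi (circle_proj (4 * t)%R, T_ (a t) x) by rewrite /skew_map/= F_proj.
under eq_integral do rewrite e1.
transitivity (\int[mu]_(z in `]0%R, 1%R]) (psi (circle_proj (4 * t)%R, z) *
    (4 * branch a true 0 H (4 * t) z + 4 * branch a false 0 H (4 * t) z)%:E)).
  refine (@fibre_duality R (fun x => psi (circle_proj (4 * t)%R, x)) (H t) (a t)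
    (fun z => (4 * branch a true 0 H (4 * t) z)%R)
    (fun z => (4 * branch a false 0 H (4 * t) z)%R) _ _ _ _ _ _ _ _ _ _ _ _) => //.
- exact: alpha0.
- exact: measurableT_comp mpsi (measurable_pair1 _).
- by move=> x; exact: harnack_ge0 hH _ _.
- exact: measurable_harnack_slice hH.
- exact: measurableT_comp (measurable_T_ malpha alpha0) (measurable_pair1 _).
- by move=> z z01; rewrite /branch z01 e0 mulrC divfK.
- by move=> z z01; rewrite /branch z01 e0; lra.
- rewrite -ge0_integralZl ?lee_fin//; last first.
    by apply: measurable_funTS; exact: measurableT_comp (mG 0) (measurable_pair1 _).
  apply: eq_integral => z _; rewrite /G/= -ge0_muleDr ?lee_fin ?(harnack_ge0 (hB _ _))//.
  by rewrite -EFinD muleCA -EFinM mulrDr.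
Qed.

(** Inside a fibre and along the base, each half of the map is a change of
    variables; the eight branches that arise are those of [transfer]. *)
Lemma strip_duality :
  \int[@leb_strip R]_p (psi (skew_map alpha p) * (descend H p)%:E) =
  \int[@leb_strip R]_p (psi p * (descend (transfer a H) p)%:E).
Proof.
have mH := measurable_descend (measurable_harnack B0 hH).
have hT := harnack_transfer b0 abt l0 a_lip B_ge hH.
have pT : periodic1 (transfer a H).
  apply: periodic_transfer => // t; rewrite /a; congr alpha.
  by apply: circle_proj_int; rewrite addrAC subrr add0r.
rewrite ge0_integral_strip; last 2 first.
- apply: emeasurable_funM; last by apply/measurable_EFinP; exact: mH.
  exact: measurableT_comp mpsi (measurable_skew malpha alpha0).
- by move=> p; rewrite mule_ge0// lee_fin (harnack_ge0 hH).
rewrite ge0_integral_strip; last 2 first.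
- apply: emeasurable_funM => //.
  by apply/measurable_EFinP; exact: measurable_descend (measurable_harnack B0 hT).
- by move=> p; rewrite mule_ge0// lee_fin (harnack_ge0 hT).
pose Psi t := 4%:E * \int[mu]_(z in `]0%R, 1%R]) G 0 ((4 * t)%R, z).
have mPsi : measurable_fun setT Psi.
  apply: emeasurable_funM => //.
  apply: (measurableT_comp (measurable_section_integral (mG 0) (G0 0))).
  exact: measurable_funM.
transitivity (\int[mu]_(t in `]0%R, 1%R]) Psi t).
  apply: eq_integral => t _; rewrite /Psi -inner; apply: eq_integral => x _.
  by rewrite descend_proj.
rewrite base_duality//; last first.
  by move=> t; rewrite mule_ge0 ?lee_fin//; exact: integral_ge0.
transitivity (\sum_(k < 4) \int[mu]_(s in `]0%R, 1%R])
    \int[mu]_(z in `]0%R, 1%R]) G k (s, z)).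
  apply: eq_bigr => k _; apply: eq_integral => s _; rewrite /Psi.
  rewrite muleC muleA -EFinM mulVf// mul1e; apply: eq_integral => z _.
  rewrite /G/= !branch0 (_ : circle_proj _ = circle_proj s)//.
  apply: circle_proj_int; rewrite (_ : _ - s = k%:R)%R ?natr_int//.
  by rewrite /preimage_ang; lra.
rewrite -ge0_integral_sum//; last 2 first.
- by move=> k; apply: measurable_funTS; exact: measurable_section_integral.
- by move=> k s _; exact: integral_ge0.
apply: eq_integral => s _; rewrite -ge0_integral_sum//; last first.
  by move=> k; apply: measurable_funTS; exact: measurableT_comp (mG k) (measurable_pair1 _).
apply: eq_integral => z _; rewrite descend_proj// transferE /G/=.
rewrite -sumEFin ge0_sume_distrr; last first.
  by move=> k _; rewrite lee_fin addr_ge0// (harnack_ge0 (hB _ _)).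
by apply: eq_bigr => k _; rewrite EFinD ge0_muleDr// lee_fin (harnack_ge0 (hB _ _)).
Qed.

End strip_duality.

(** * Densities dominated by an integrable power *)

Section admissible.
Variable R : realType.
Local Notation mu := (@lebesgue_measure R).
Local Notation leb := (@leb_strip R).
Local Notation plane := (measurableTypeR R * measurableTypeR R)%type.

Record admissible (alpha : circle R -> R) (b g l : R) : Prop := Admissible {
  adm_gt0 : 0 < b;
  adm_lt1 : g < 1;
  adm_itv : forall w, b <= alpha w <= g;
  adm_lip_ge0 : 0 <= l;
  adm_lip : forall s t,
    `|alpha (circle_proj s) - alpha (circle_proj t)| <= l * `|s - t|;
  adm_measurable : measurable_fun setT (alpha : circle R -> measurableTypeR R) }.

(** The first term is what the cone condition in the angle needs; adding [1]
    puts [1 + `|s - t|] below [expR (B * `|s - t|)]. *)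
Definition harnack_cst (b l : R) := l * (2 / b + 1) + 1.

(** The densities to which compactness applies: the bound by an integrable
    power is what keeps mass from escaping to the neutral curve [x = 0]. *)
Record tame (B g A : R) (H : R -> R -> R) : Prop := Tame {
  tame_harnack : harnack B H;
  tame_periodic : periodic1 H;
  tame_le : forall t x, 0 < x <= 1 -> H t x <= A * x `^ (- g) }.

(** The angle is a dummy argument, for [descend]. *)
Definition weight (g t x : R) : R := if 0 < x <= 1 then x `^ (- g) else 0.

Lemma measurable_weight g :
  measurable_fun setT (fun p : plane => weight g p.1 p.2 : measurableTypeR R).
Proof.
have m2 : measurable_fun setT (fun p : plane => p.2 : measurableTypeR R).
  exact: measurable_snd.
rewrite /weight; apply: measurable_fun_ifT => //.
- by apply: measurable_and; [exact: measurable_fun_ltr|exact: measurable_fun_ler].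
- exact: measurableT_comp (measurable_powR _) m2.
Qed.

Lemma weight_ge0 g t x : 0 <= weight g t x.
Proof. by rewrite /weight; case: ifP => // _; exact: powR_ge0. Qed.

Lemma leb01_setT : @leb01 R setT = 1%E.
Proof.
rewrite -[LHS]/(mu (setT `&` `[0%R, 1%R]%classic)) setTI.
by rewrite lebesgue_measure_itv/= lte_fin ltr01 sube0.
Qed.

Lemma leb_circle_setT : @leb_circle R setT = 1%E.
Proof. exact: leb01_setT. Qed.

Lemma leb_strip_setT : leb setT = 1%E.
Proof.
rewrite -[X in leb X]setXTT leb_strip_prod//.
by rewrite leb_circle_setT mul1e; exact: leb01_setT.
Qed.

Lemma integral_weight g : 0 <= g < 1 ->
  (\int[leb]_p (descend (weight g) p)%:E = (1 - g)^-1%:E)%E.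
Proof.
move=> /andP[g0 g1].
have mw := measurable_descend (measurable_weight g).
rewrite ge0_integral_strip; last 2 first.
- exact/measurable_EFinP.
- by move=> p; rewrite lee_fin weight_ge0.
have pw : periodic1 (weight g) by [].
have int1 : (\int[mu]_(x in `]0%R, 1%R]) (1%:E : \bar R) = 1)%E.
  by rewrite integral_cst//= mul1e lebesgue_measure_itv/= lte_fin ltr01 sube0.
have c0 : 0 < 1 - g by lra.
have W t : (\int[mu]_(x in `]0%R, 1%R]) (weight g t x)%:E = (1 - g)^-1%:E)%E.
  have H := @increasing_substitution R (@powR R ^~ (1 - g)) (fun x => (1 - g) * x `^ (1 - g - 1))
    0 1 ltr01 _ _ _ _ _ _ (cst 1%E) _ _.
  have : (1 = \int[mu]_(y in `]0%R, 1%R]) ((1 - g)%:E * (weight g t y)%:E))%E.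
    rewrite -{1}int1 H//.
    - apply: eq_integral => x /set_mem/=; rewrite in_itv/= => x01.
      by rewrite /weight x01 mul1e -EFinM; congr (_ * _ `^ _)%:E; lra.
    - move=> y y0; apply: differentiable_continuous; apply/derivable1_diffP.
      have D := is_derive1_powR (1 - g - 1) y0.
      by apply: ex_derive.
    - by move=> y y0; rewrite mulr_ge0 ?powR_ge0// ltW.
    - move=> y /andP[y0 y1]; rewrite powR_gt0//=; apply: powR_le1 => //.
      by rewrite ltW.
    - move=> y z y0 yz _; apply: gt0_ltr_powR => //; rewrite nnegrE ltW//.
      exact: lt_trans yz.
    - move=> x /andP[x0 x1]; exists (x `^ (1 - g)^-1).
      rewrite -powRrM mulVf ?gt_eqF// powRr1; last exact: ltW.
      split => //; rewrite powR_gt0//=.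
      by apply: powR_le1; rewrite ?invr_gt0// (ltW x0).
  have mW : measurable_fun (`]0%R, 1%R]%classic : set (measurableTypeR R))
      (fun y : measurableTypeR R => (weight g t y)%:E).
    apply/measurable_EFinP; apply: measurable_funTS.
    exact: measurableT_comp (measurable_weight g) (measurable_pair1 _).
  have W0 y : (0 <= (weight g t y)%:E)%E by rewrite lee_fin weight_ge0.
  rewrite ge0_integralZl ?lee_fin ?(ltW c0)//.
  set I := (X in (_ * X)%E) => e.
  transitivity I => //; transitivity ((1 - g)^-1%:E * ((1 - g)%:E * I))%E.
    by rewrite muleA -EFinM mulVf ?gt_eqF// mul1e.
  by rewrite -e mule1.
transitivity (\int[mu]_(t in `]0%R, 1%R]) ((1 - g)^-1%:E * 1%:E))%E.
  apply: eq_integral => t _; rewrite mule1 -(W t); apply: eq_integral => x _.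
  by rewrite descend_proj.
rewrite ge0_integralZl//; first by rewrite int1 mule1.
by rewrite lee_fin invr_ge0 ltW.
Qed.

Lemma integrable_weight g : 0 <= g < 1 ->
  leb.-integrable setT (EFin \o descend (weight g)).
Proof.
move=> g01; apply/integrableP; split.
  by apply/measurable_EFinP; exact: measurable_descend (measurable_weight g).
under eq_integral => p _ do rewrite /= ger0_norm ?weight_ge0//.
by rewrite integral_weight// ltry.
Qed.

Lemma tame_le_bound B g A A' (H : R -> R -> R) : A <= A' -> tame B g A H -> tame B g A' H.
Proof.
move=> AA' [hH pH HA]; split => // t x x01; apply: le_trans (HA t x x01) _.
by rewrite ler_wpM2r// powR_ge0.
Qed.

Section tame.
Variables (B g A : R).
Hypotheses (B0 : 0 <= B) (g01 : 0 <= g < 1).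

Lemma tame_weight H : tame B g A H ->
  forall t x, H t x <= A * weight g t x.
Proof.
move=> [hH _ hA] t x; rewrite /weight; case: ifPn => [/hA//|x01].
by rewrite mulr0 (harnack_out hH).
Qed.

Lemma measurable_tame H : tame B g A H ->
  measurable_fun setT (descend H : cylinder R -> measurableTypeR R).
Proof. by move=> [hH _ _]; exact: measurable_descend (measurable_harnack B0 hH). Qed.

Lemma integrable_tame H D : measurable D -> tame B g A H ->
  leb.-integrable D (EFin \o descend H).
Proof.
move=> mD tH; apply: (@integrableS _ _ _ _ setT) => //.
apply: (@le_integrable _ _ _ _ _ _ _ (fun p => A%:E * (EFin \o descend (weight g)) p)%E) => //.
- by apply/measurable_EFinP; exact: measurable_tame.
- move=> p _; rewrite /= !ger0_norm//.
  + by rewrite lee_fin tame_weight.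
  + by apply: le_trans (tame_weight tH _ _); exact: harnack_ge0 (tame_harnack tH) _ _.
  + exact: harnack_ge0 (tame_harnack tH) _ _.
- exact: integrableZl (integrable_weight g01).
Qed.

End tame.

(** At height [1/2] or more, the cone conditions bound [H] by a multiple of
    all its values below height [1/2], at every angle, hence by the mass
    there. *)
Lemma harnack_mass B H t x : 0 <= B -> harnack B H -> periodic1 H ->
  leb.-integrable setT (EFin \o descend H) -> 2^-1 <= x ->
  H t x <= 2 * expR B * \int[leb]_p descend H p.
Proof.
move=> B0 hH pH iH x2.
have I0 : 0 <= \int[leb]_p descend H p.
  by apply: Rintegral_ge0 => p _; exact: harnack_ge0 hH _ _.
have [x1|x1] := leP x 1; last first.
  rewrite (harnack_out hH); first by rewrite !mulr_ge0 ?expR_ge0.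
  by rewrite negb_and -!ltNge x1 orbT.
pose c := H t 2^-1 * expR (- B).
have c0 : 0 <= c by rewrite mulr_ge0 ?expR_ge0 ?(harnack_ge0 hH).
pose D : set (cylinder R) := setT `*` `]0, 2^-1]%classic.
have mD : measurable D by apply: measurableX => //; exact: measurable_itv.
have lD : leb D = (2^-1)%:E.
  rewrite leb_strip_prod//.
  rewrite leb_circle_setT mul1e.
  rewrite -[LHS]/(mu (`]0, 2^-1]%classic `&` `[0%R, 1%R]%classic)).
  rewrite (_ : _ `&` _ = `]0, 2^-1]%classic).
    by rewrite lebesgue_measure_itv/= lte_fin invr_gt0 ltr0n sube0.
  apply/seteqP; split => y /=; rewrite !in_itv/=; first by case.
  by move=> /andP[y0 y2]; rewrite y0 y2; split => //; apply/andP; split; lra.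
have h : c * 2^-1 <= \int[leb]_p descend H p.
  have -> : c * 2^-1 = \int[leb]_(p in D) c.
    by rewrite Rintegral_cst//= lD.
  apply: (@le_trans _ _ (\int[leb]_(p in D) descend H p)).
    apply: le_Rintegral => //.
    - exact: finite_measure_integrable_cst.
    - exact: integrableS iH.
    move=> [w y] [_ /=]; rewrite in_itv/= => /andP[y0 y2].
    have [k kZ] : exists t', t' - t \is a Num.int /\ `|t' - circle_sec w| <= 1.
      exists (t - (Num.floor t)%:~R); split.
        by rewrite addrAC subrr add0r rpredN intr_int.
      have /andP[s0 s1] := circle_sec_itv w.
      have f1 := floor_le_tmp t; have f2 := floorD1_gt t; rewrite intrD in f2.
      by rewrite ler_norml; apply/andP; split; lra.
    have [e1 e2] := kZ.
    rewrite /c (@periodic1_int _ _ pH t k); last by rewrite -opprB rpredN.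
    apply: (@le_trans _ _ (H k y * expR (- B))).
      by rewrite ler_wpM2r ?expR_ge0//; apply: (harnack_dec hH) => //; lra.
    rewrite expRN ler_pdivrMr ?expR_gt0//.
    apply: le_trans (harnack_exp hH k (circle_sec w) y) _.
    apply: ler_wpM2l; first exact: harnack_ge0 hH _ _.
    by rewrite ler_expR ler_piMr.
  rewrite /Rintegral fine_le//.
  - by apply: integrable_fin_num => //; exact: integrableS iH.
  - exact: integrable_fin_num.
  - apply: ge0_subset_integral => //; first by have /integrableP[] := iH.
    by move=> p _; rewrite lee_fin; exact: harnack_ge0 hH _ _.
apply: (@le_trans _ _ (H t 2^-1)); first by apply: (harnack_dec hH) => //; lra.
have -> : H t 2^-1 = 2 * expR B * (c * 2^-1).
  by rewrite /c expRN; field; rewrite gt_eqF// expR_gt0.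
by rewrite ler_wpM2l// mulr_ge0 ?expR_ge0.
Qed.

End admissible.

(** * Expansion *)

Section expansion.
Variable R : realType.
Variable a : R -> R.
Hypothesis a01 : forall t, 0 < a t <= 1.
Variable P : R -> R -> Prop.
Hypothesis P_forward : forall t y, 0 < y <= 1 -> P t y -> P (4 * t) (T_ (a t) y).

Lemma bernoulli (x : R) n : 0 <= x -> 1 + n%:R * x <= (1 + x) ^+ n.
Proof.
move=> x0; elim: n => [|n IH]; first by rewrite mul0r addr0 expr0.
rewrite exprS -natr1; apply: (@le_trans _ _ ((1 + x) * (1 + n%:R * x))).
  have : 0 <= n%:R * x * x by rewrite !mulr_ge0.
  by move: (n%:R) => m; nra.
by apply: ler_wpM2l => //; lra.
Qed.

Lemma left_map_expand (c s e d0 : R) : 0 < c <= 1 -> 0 <= s -> s < e ->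
  e <= 2^-1 -> 0 < d0 -> d0 <= e ->
  (1 + 2 * d0) * (e - s) <= left_map c e - left_map c s.
Proof.
move=> /andP[c0 c1] s0 se e2 d00 d0e; rewrite /left_map.
have h1 : (2 * s) `^ c <= (2 * e) `^ c by apply: powR_double_le => //; lra.
have h2 : 2 * e <= (2 * e) `^ c by apply: ger1_powR => //; lra.
have h3 := powR_ge0 (2 * s) c.
move: ((2 * s) `^ c) ((2 * e) `^ c) h1 h2 h3 => u v h1 h2 h3.
have : s * u <= s * v by apply: ler_wpM2l.
have : (2 * d0) * (e - s) <= v * (e - s) by apply: ler_wpM2r; lra.
lra.
Qed.

Definition fills_bottom t := exists2 d, 0 < d <= 2^-1 &
  forall x, 0 < x <= d -> P t x.

Definition fills_itv t s e :=
  [/\ 0 <= s, s < e, e <= 1 & forall x, s < x <= e -> P t x].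

Lemma fills_bottom_forward t : fills_bottom t -> fills_bottom (4 * t).
Proof.
move=> [d /andP[d0 d2] Pd]; exists d; first by rewrite d0.
move=> x /andP[x0 xd]; have /andP[c0 c1] := a01 t.
have [|/andP[]] := @left_invP R (a t) x c0; first lra.
move: (left_inv _ _) => y y0 y2 e.
have yx := left_map_ge (a t) (ltW y0); rewrite e in yx.
have eT : T_ (a t) y = x by rewrite T_left// ltW.
rewrite -eT; apply: P_forward; first lra.
by apply: Pd; rewrite y0/=; lra.
Qed.

(** A fibre interval is stretched by each half of the map, by a factor bounded
    away from [1] because its right end stays above its initial length; this
    goes on until it straddles the discontinuity. *)
Lemma fills_itv_forward t s e d0 : 0 < d0 -> d0 <= e - s -> fills_itv t s e ->
  fills_bottom (4 * t) \/ exists s' e',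
    fills_itv (4 * t) s' e' /\ (1 + 2 * d0) * (e - s) <= e' - s'.
Proof.
move=> d00 d0es [s0 se e1 Ps]; have /andP[c0 c1] := a01 t.
have e0 : 0 <= e by lra.
have [e2|e2] := leP e 2^-1.
  right; exists (left_map (a t) s), (left_map (a t) e); split; last first.
    by apply: left_map_expand => //; lra.
  split.
  - by apply: le_trans s0 (left_map_ge _ s0).
  - by apply: left_map_lt => //; rewrite s0.
  - by rewrite -(left_map_half (a t)) left_map_le//; lra.
  move=> x /andP[sx xe].
  have x01 : 0 < x <= 1.
    rewrite (le_lt_trans _ sx)/=; last exact: le_trans s0 (left_map_ge _ s0).
    by apply: (le_trans xe); rewrite -(left_map_half (a t)) left_map_le//; lra.
  have [/andP[]] := left_invP c0 x01.
  move: (left_inv _ _) => y y0 y2 ey.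
  have eT : T_ (a t) y = x by rewrite T_left// ltW.
  rewrite -eT; apply: P_forward; first lra.
  apply: Ps; apply/andP; split.
    rewrite ltNge; apply/negP => h.
    have := @left_map_le R (a t) _ s c0 (introT andP (conj (ltW y0) h)).
    by rewrite ey; lra.
  rewrite leNgt; apply/negP => h.
  have := @left_map_lt R (a t) e _ c0 (introT andP (conj e0 h)).
  by rewrite ey; lra.
have [s2|s2] := leP 2^-1 s.
  right; exists (2 * s - 1), (2 * e - 1); split; last by nra.
  split; [lra|lra|lra|move=> x /andP[sx xe]].
  have -> : x = 2 * ((x + 1) / 2) - 1 by lra.
  rewrite -(@T_right _ (a t)); last lra.
  by apply: P_forward; [lra|apply: Ps; lra].
left; exists (Num.min (2 * e - 1) 2^-1).
  by rewrite ge_min lexx orbT andbT lt_min; apply/andP; split; lra.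
move=> x /andP[x0]; rewrite le_min => /andP[xe x2].
have -> : x = 2 * ((x + 1) / 2) - 1 by lra.
rewrite -(@T_right _ (a t)); last lra.
by apply: P_forward; [lra|apply: Ps; lra].
Qed.

Lemma fills_bottom_eventually t s e : fills_itv t s e ->
  exists n, forall m, (n <= m)%N -> fills_bottom (4 ^+ m * t).
Proof.
move=> Fse; have [s0 se e1 _] := Fse.
have d00 : 0 < e - s by lra.
set d0 := e - s in d00.
have step i : fills_bottom (4 ^+ i * t) \/ exists s' e',
    fills_itv (4 ^+ i * t) s' e' /\ (1 + 2 * d0) ^+ i * d0 <= e' - s'.
  elim: i => [|i [IH|[s' [e' [IH h]]]]].
  - by right; exists s, e; rewrite expr0 !mul1r.
  - by left; rewrite exprS -mulrA; exact: fills_bottom_forward.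
  - have h1 : d0 <= e' - s'.
      apply: le_trans h; rewrite ler_peMl ?exprn_ege1//; lra.
    have [F|[s'' [e'' [F h2]]]] := fills_itv_forward d00 h1 IH.
      by left; rewrite exprS -mulrA.
    right; exists s'', e''; rewrite exprS -mulrA; split => //.
    apply: le_trans h2; rewrite exprS -mulrA ler_pM2l//; lra.
have [n nP] : exists n, 1 < (1 + 2 * d0) ^+ n * d0.
  pose N := Num.bound (d0^-1 / (2 * d0)).
  exists N; have := @archi_boundP R (d0^-1 / (2 * d0)).
  rewrite -/N => /(_ _)/wrap[]; first by rewrite divr_ge0 ?invr_ge0 ?ltW//; lra.
  move=> hN; rewrite -ltr_pdivrMr// mul1r.
  apply: lt_le_trans (@bernoulli (2 * d0) N (ltac:(lra))).
  by move: hN; rewrite ltr_pdivrMr; lra.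
exists n; elim=> [|m IH].
  rewrite leqn0 => /eqP n0; case: (step 0%N) => // -[s' [e' [[h1 h2 h3 _] h4]]].
  by move: nP h4; rewrite n0; lra.
rewrite leq_eqVlt => /predU1P[<-|nm].
  case: (step n) => // -[s' [e' [[h1 h2 h3 _] h4]]].
  by move: nP h4; lra.
by rewrite exprS -mulrA; apply: fills_bottom_forward; exact: IH.
Qed.

Hypothesis P_open : forall t x, 0 < x <= 1 -> P t x -> exists2 r, 0 < r &
  forall s y, `|s - t| < r -> `|y - x| < r -> 0 < y <= 1 -> P s y.

(** The angles with a finite expansion in base [4] are dense and end up at an
    integer. *)
Lemma open_forward_fills t x : 0 < x <= 1 -> P t x ->
  exists n : int, fills_bottom n%:~R.
Proof.
move=> x01 Ptx; have [r r0 Pr] := P_open x01 Ptx.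
have /andP[x0 x1] := x01.
pose N := Num.bound r^-1.
have hN : r^-1 < 4 ^+ N.
  apply: (@lt_le_trans _ _ N%:R); first by apply: archi_boundP; rewrite invr_ge0 ltW.
  rewrite -natrX ler_nat; apply: ltnW; exact: ltn_expl.
pose k := Num.floor (4 ^+ N * t).
have q0 : 0 < 4 ^+ N :> R by rewrite exprn_gt0.
pose t' : R := k%:~R / 4 ^+ N.
have tt' : `|t' - t| < r.
  have f1 := floor_le_tmp (4 ^+ N * t); have f2 := floorD1_gt (4 ^+ N * t).
  rewrite -/k intrD in f1 f2.
  have -> : t' - t = - ((4 ^+ N * t - k%:~R) / 4 ^+ N).
    by rewrite /t'; field; rewrite gt_eqF.
  rewrite normrN ger0_norm; last by apply: divr_ge0; [lra|exact: ltW].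
  apply: (@le_lt_trans _ _ (4 ^+ N)^-1).
    by rewrite ler_pdivrMr// mulVf ?gt_eqF//; lra.
  by rewrite invf_plt// posrE.
pose d := Num.min r x / 2.
have d0 : 0 < d by rewrite divr_gt0// lt_min r0.
have mr : Num.min r x <= r by rewrite ge_min lexx.
have mx : Num.min r x <= x by rewrite ge_min lexx orbT.
have dr : d < r by rewrite /d; lra.
have dx : d < x by rewrite /d; lra.
have F : fills_itv t' (x - d) x.
  split; [lra|lra|lra|move=> y /andP[xy yx]].
  by apply: Pr => //; [rewrite ler0_norm; lra|lra].
have [n Fn] := fills_bottom_eventually F.
have := Fn (maxn n N) (leq_maxl _ _).
have -> : 4 ^+ maxn n N * t' = (4 ^+ (maxn n N - N) * k)%:~R.
  rewrite intrM rmorphXn/= /t' -[X in 4 ^+ X * _](subnK (leq_maxr n N)) exprD.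
  by rewrite -mulrA [4 ^+ N * _]mulrC divfK ?gt_eqF.
by move=> h; eexists; exact: h.
Qed.

End expansion.

(** * Uniqueness of the invariant density *)

Section comparison.
Variable R : realType.
Local Notation leb := (@leb_strip R).
Local Notation mu := (@lebesgue_measure R).

Lemma harnack_max B (F G : R -> R -> R) : harnack B F -> harnack B G ->
  harnack B (fun t x => Num.max (F t x) (G t x)).
Proof.
move=> hF hG; split.
- by move=> t x; rewrite le_max (harnack_ge0 hF).
- by move=> t x xo; rewrite (harnack_out hF)// (harnack_out hG)// maxxx.
- move=> t x y x0 xy y1; rewrite ge_max !le_max.
  by rewrite (harnack_dec hF)// (harnack_dec hG)// orbT.
- move=> t x y x0 xy y1; rewrite !maxr_pMr ?sqr_ge0// ge_max !le_max.
  by rewrite (harnack_inc hF)// (harnack_inc hG)// orbT.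
- move=> s t x; rewrite maxr_pMl ?expR_ge0// ge_max !le_max.
  by rewrite (harnack_exp hF)// (harnack_exp hG)// orbT.
Qed.

Lemma leb_strip_box (t r x r' : R) : 0 <= t -> 0 < r -> t + r < 1 ->
  0 <= x -> 0 < r' -> x + r' <= 1 ->
  (0 < leb ((@circle_sec R @^-1` `[t, (t + r)%R]%classic) `*` `[x, (x + r')%R]%classic))%E.
Proof.
move=> t0 r0 tr1 x0 r'0 xr1.
have mS : measurable (@circle_sec R @^-1` `[t, t + r]%classic).
  rewrite -[X in measurable X]setTI; exact: measurable_circle_sec.
rewrite leb_strip_prod//.
apply: mule_gt0.
  apply: (@lt_le_trans _ _ (mu `[t, (t + r)%R]%classic)).
    by rewrite lebesgue_measure_itv/= lte_fin ltrDl r0 -EFinB lte_fin; lra.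
  rewrite -[leRHS]/(mu (_ `&` `[0%R, 1%R]%classic)); apply: le_measure.
  - by rewrite inE; exact: measurable_itv.
  - rewrite inE; apply: measurableI; last exact: measurable_itv.
    rewrite -[X in measurable X]setTI; exact: measurable_circle_proj.
  - move=> s /=; rewrite !in_itv/= => /andP[ts str].
    have s01 : 0 <= s <= 1 by lra.
    by split => //; rewrite circle_sec_id ?ts//; lra.
rewrite -[ltRHS]/(mu (`[x, (x + r')%R]%classic `&` `[0%R, 1%R]%classic)).
rewrite (_ : _ `&` _ = `[x, x + r']%classic).
  by rewrite lebesgue_measure_itv/= lte_fin ltrDl r'0 -EFinB lte_fin; lra.
apply/seteqP; split => y /=; rewrite !in_itv/=; first by case.
by move=> /andP[h1 h2]; rewrite h1 h2; split=> //; apply/andP; split; lra.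
Qed.

Lemma harnack_gap B (F G : R -> R -> R) t x : 0 <= B ->
  harnack B F -> harnack B G -> 0 <= t < 1 -> 0 < x <= 1 -> F t x < G t x ->
  exists d, [/\ 0 < d, t + d < 1, d < x &
    forall s y, t <= s <= t + d -> x - d <= y <= x ->
      (G t x - F t x) / 3 <= G s y - F s y].
Proof.
move=> B0 hF hG /andP[t0 t1] x01 lt; have /andP[x0 x1] := x01.
pose e := (G t x - F t x) / 3.
have e0 : 0 < e by rewrite /e; lra.
have [d1 d10 D1] := harnack_continuous t hF B0 x01 e0.
have [d2 d20 D2] := harnack_continuous t hG B0 x01 e0.
pose d := Num.min (Num.min d1 d2) (Num.min (1 - t) x) / 2.
have [m1 m2 m3 m4] : [/\ 2 * d <= d1, 2 * d <= d2, 2 * d <= 1 - t & 2 * d <= x].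
  rewrite /d mulrC divfK//.
  by split; rewrite !ge_min lexx ?orbT.
have d0 : 0 < d.
  by rewrite /d divr_gt0// !lt_min d10 d20 x0 subr_gt0 t1.
exists d; split; [by []|lra|lra|move=> s y /andP[s1 s2] /andP[y1 y2]].
have hw : `|s - t| <= d by rewrite ger0_norm; lra.
have hy : `|y - x| <= d by rewrite ler0_norm; lra.
have y11 : y <= 1 by lra.
have dd1 : d < d1 by lra.
have dd2 : d < d2 by lra.
have := D1 s y (le_lt_trans hw dd1) (le_lt_trans hy dd1) y11.
have := D2 s y (le_lt_trans hw dd2) (le_lt_trans hy dd2) y11.
have e3 : G t x - F t x = 3 * e by rewrite /e; lra.
rewrite -/e !ltr_norml; lra.
Qed.

(** A gap between two continuous functions would persist on a box of positive
    measure. *)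
Lemma harnack_le_eq B (F G : R -> R -> R) : 0 <= B ->
  harnack B F -> harnack B G -> periodic1 F -> periodic1 G ->
  leb.-integrable setT (EFin \o descend F) ->
  leb.-integrable setT (EFin \o descend G) ->
  (forall t x, F t x <= G t x) ->
  \int[leb]_p descend F p = \int[leb]_p descend G p ->
  forall t x, F t x = G t x.
Proof.
move=> B0 hF hG pF pG iF iG FG eFG t x.
have [x01|xo] := boolP (0 < x <= 1); last by rewrite (harnack_out hF)// (harnack_out hG).
apply/eqP; rewrite eq_le FG/= leNgt; apply/negP => lt.
pose t0 := circle_sec (circle_proj t).
have [eF eG] : F t x = F t0 x /\ G t x = G t0 x.
  by split; apply: periodic1_int => //; rewrite -opprB rpredN; exact: circle_sec_proj.
rewrite {}eF {}eG in lt.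
have [d [d0 td dx gap]] := harnack_gap B0 hF hG (circle_sec_itv _) x01 lt.
set e := _ / 3 in gap.
have e0 : 0 < e by rewrite divr_gt0// subr_gt0.
have /andP[t00 _] : 0 <= t0 < 1 by exact: circle_sec_itv.
pose D : set (cylinder R) :=
  (@circle_sec R @^-1` `[t0, t0 + d]%classic) `*` `[x - d, x - d + d]%classic.
have D0 : (0 < leb D)%E.
  apply: leb_strip_box => //; first by rewrite subr_ge0 ltW.
  by rewrite subrK; case/andP: x01.
have mD : measurable D.
  apply: measurableX; last exact: measurable_itv.
  rewrite -[X in measurable X]setTI; exact: measurable_circle_sec.
have iGF : leb.-integrable setT (EFin \o (fun p => descend G p - descend F p)).
  exact: (integrableB _ iG iF).
have eq0 : \int[leb]_p (descend G p - descend F p) = 0.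
  by rewrite RintegralB// eFG subrr.
have h : e * fine (leb D) <= \int[leb]_p (descend G p - descend F p).
  have -> : e * fine (leb D) = \int[leb]_(p in D) e by rewrite Rintegral_cst.
  apply: (@le_trans _ _ (\int[leb]_(p in D) (descend G p - descend F p))).
    apply: le_Rintegral => //.
    - exact: finite_measure_integrable_cst.
    - exact: integrableS iGF.
    by move=> [w y] [/=]; rewrite !in_itv/= subrK => w1 y1; exact: gap.
  rewrite /Rintegral fine_le//.
  - by apply: integrable_fin_num => //; exact: integrableS iGF.
  - exact: integrable_fin_num.
  - apply: ge0_subset_integral => //; first by have /integrableP[] := iGF.
    by move=> p _; rewrite lee_fin subr_ge0; exact: FG.
have fD : 0 < fine (leb D).
  by rewrite fine_gt0// D0/= ltey_eq fin_num_measure.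
by have := mulr_gt0 e0 fD; rewrite ltNge -eq0 h.
Qed.

End comparison.

Section fixed_points.
Variable R : realType.
Local Notation leb := (@leb_strip R).
Variables (alpha : circle R -> R) (b g l : R).
Hypothesis adm : admissible alpha b g l.
Local Notation B := (harnack_cst b l).

Definition adm_transfer := transfer (fun t => alpha (circle_proj t)).
Local Notation L := adm_transfer.

Lemma adm_itv1 w : b <= alpha w <= 1.
Proof. by have := adm_itv adm w; have := adm_lt1 adm; lra. Qed.

Lemma adm_g01 : 0 <= g < 1.
Proof.
by have := adm_itv adm 0; have := adm_lt1 adm; have := adm_gt0 adm; lra.
Qed.

Lemma harnack_cst_ge : l * (2 / b + 1) <= B.
Proof. by rewrite /harnack_cst lerDl. Qed.

Lemma harnack_cst_ge1 : 1 <= B.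
Proof.
have b0 := adm_gt0 adm; have l0 := adm_lip_ge0 adm.
rewrite /harnack_cst lerDr; apply: mulr_ge0 => //; apply: addr_ge0 => //.
by rewrite divr_ge0// ltW.
Qed.

Lemma harnack_cst_ge0 : 0 <= B. Proof. exact: le_trans ler01 harnack_cst_ge1. Qed.

Lemma adm_harnack H : harnack B H -> harnack B (L H).
Proof.
apply: harnack_transfer (adm_gt0 adm) _ (adm_lip_ge0 adm) (adm_lip adm) harnack_cst_ge _.
by move=> t; exact: adm_itv1.
Qed.

Lemma adm_periodic H : periodic1 H -> periodic1 (L H).
Proof.
apply: periodic_transfer => t; congr alpha.
by apply: circle_proj_int; rewrite addrAC subrr add0r.
Qed.

Lemma measurable_strip : measurable (@strip R).
Proof.
rewrite (_ : @strip R = setT `*` `[0%R, 1%R]%classic).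
  by apply: measurableX => //; exact: measurable_itv.
by apply/seteqP; split => -[w x]; rewrite /strip/= in_itv/=; [|case].
Qed.

Lemma measurable_preimage_skew D : measurable D ->
  measurable (@strip R `&` skew_map alpha @^-1` D).
Proof.
move=> mD; apply: measurableI; first exact: measurable_strip.
rewrite -[X in measurable X]setTI; apply: measurable_skew => //.
  exact: adm_measurable adm.
by move=> w; apply: lt_le_trans (adm_gt0 adm) _; have /andP[] := adm_itv adm w.
Qed.

Lemma transfer_mass H D : harnack B H -> periodic1 H -> measurable D ->
  (\int[leb]_(p in @strip R `&` skew_map alpha @^-1` D) (descend H p)%:E =
   \int[leb]_(p in D) (descend (L H) p)%:E)%E.
Proof.
move=> hH pH mD.
have B0 := harnack_cst_ge0.
have mH := measurable_descend (measurable_harnack B0 hH).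
have mI : measurable_fun setT (EFin \o \1_D : cylinder R -> \bar R).
  by apply/measurable_EFinP; exact: measurable_indic.
have I0 p : (0 <= (EFin \o \1_D : cylinder R -> \bar R) p)%E by rewrite lee_fin indicE.
have mS := measurable_preimage_skew mD.
have := strip_duality (adm_gt0 adm) adm_itv1 (adm_lip_ge0 adm) (adm_lip adm)
  harnack_cst_ge (adm_measurable adm) hH pH mI I0.
have e (f : cylinder R -> R) E : (forall p, 0 <= f p) ->
    (\int[leb]_(p in E) (f p)%:E = \int[leb]_p ((\1_E p)%:E * (f p)%:E))%E.
  move=> f0; rewrite integral_mkcond; apply: eq_integral => p _.
  by rewrite patchE indicE; case: ifPn; rewrite ?mul1e ?mul0e.
rewrite -[X in _ = X -> _]e; last first.
  by move=> p; exact: harnack_ge0 (adm_harnack hH) _ _.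
move=> <-.
rewrite [LHS]e; last by move=> p; exact: harnack_ge0 hH _ _.
have alpha0 w : 0 < alpha w.
  by apply: lt_le_trans (adm_gt0 adm) _; have /andP[] := adm_itv adm w.
rewrite [LHS]ge0_integral_strip; last 2 first.
- apply: emeasurable_funM; last exact/measurable_EFinP.
  by apply/measurable_EFinP; exact: measurable_indic.
- by move=> p; rewrite mule_ge0// lee_fin ?indicE// (harnack_ge0 hH).
rewrite [RHS]ge0_integral_strip; last 2 first.
- apply: emeasurable_funM; last exact/measurable_EFinP.
  exact: measurableT_comp mI (measurable_skew (adm_measurable adm) alpha0).
- by move=> p; rewrite mule_ge0// lee_fin (harnack_ge0 hH).
apply: eq_integral => t _; apply: eq_integral => x /set_mem/=.
rewrite in_itv/= => /andP[x0 x1]; congr (_ * _)%E; rewrite !indicE.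
congr ((nat_of_bool _)%:R%:E); apply/idP/idP => /set_mem h; apply/mem_set; first by case: h.
by split => //; rewrite /strip/= x1 ltW.
Qed.

Lemma transferR_mass H D : harnack B H -> periodic1 H -> measurable D ->
  \int[leb]_(p in @strip R `&` skew_map alpha @^-1` D) descend H p =
  \int[leb]_(p in D) descend (L H) p.
Proof. by move=> hH pH mD; rewrite /Rintegral transfer_mass. Qed.

Lemma leb_strip_setC : leb (~` @strip R) = 0%E.
Proof.
rewrite (_ : ~` @strip R = setT `*` ~` `[0%R, 1%R]%classic).
  rewrite leb_strip_prod//; last by apply: measurableC; exact: measurable_itv.
  rewrite -[X in (_ * X)%E]/(@lebesgue_measure R (_ `&` `[0%R, 1%R]%classic)) setICl measure0.
  by rewrite mule0.
apply/seteqP; split => -[w x]; rewrite /strip/= in_itv/=; first by [].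
by case.
Qed.

Lemma transferR_massT H : harnack B H -> periodic1 H ->
  \int[leb]_p descend (L H) p = \int[leb]_p descend H p.
Proof.
move=> hH pH; rewrite -(transferR_mass hH pH (@measurableT _ _)).
rewrite preimage_setT setIT /Rintegral; congr fine.
have mH := measurable_descend (measurable_harnack harnack_cst_ge0 hH).
rewrite -[in RHS](setUv (@strip R)) ge0_integral_setU//; last 5 first.
- exact: measurable_strip.
- by apply: measurableC; exact: measurable_strip.
- by apply/measurable_EFinP; exact: measurable_funTS.
- by move=> p _; rewrite lee_fin; exact: harnack_ge0 hH _ _.
- by apply/disj_setPS; rewrite setICr.
rewrite [X in (_ + X)%E]null_set_integral ?adde0//.
- by apply: measurableC; exact: measurable_strip.
- by apply/measurable_EFinP; exact: measurable_funTS.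
- exact: leb_strip_setC.
Qed.

Lemma integrable_transfer H : harnack B H -> periodic1 H ->
  leb.-integrable setT (EFin \o descend H) ->
  leb.-integrable setT (EFin \o descend (L H)).
Proof.
move=> hH pH /integrableP[mH iH].
have mL := measurable_descend (measurable_harnack harnack_cst_ge0 (adm_harnack hH)).
apply/integrableP; split; first exact/measurable_EFinP.
have -> : (\int[leb]_p `|(EFin \o descend (L H)) p| =
           \int[leb]_p (descend (L H) p)%:E)%E.
  apply: eq_integral => p _; rewrite /= ger0_norm//.
  exact: harnack_ge0 (adm_harnack hH) _ _.
rewrite -transfer_mass//; apply: le_lt_trans iH.
apply: le_trans (_ : (_ <= \int[leb]_p (descend H p)%:E)%E) _.
  apply: ge0_subset_integral => //; first exact: measurable_preimage_skew.
  by move=> p _; rewrite lee_fin; exact: harnack_ge0 hH _ _.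
apply: ge0_le_integral => //.
- by move=> p _; rewrite lee_fin; exact: harnack_ge0 hH _ _.
- exact: measurableT_comp.
- by move=> p _; rewrite lee_fin ler_norm.
Qed.

Local Notation a := (fun t => alpha (circle_proj t)).

Lemma branch_le F G c k t x : (forall t x, F t x <= G t x) ->
  branch a c k F t x <= branch a c k G t x.
Proof.
move=> FG; rewrite /branch; case: ifP => // _; case: c; last by rewrite ler_wpM2r.
rewrite ler_wpM2r// ler_wpM2r// invr_ge0; apply/ltW/left_deriv_gt0.
by apply: lt_le_trans (adm_gt0 adm) _; have /andP[] := adm_itv1 (circle_proj (preimage_ang k t)).
Qed.

Lemma branch_lt F G c k t x : let s := preimage_ang k t in
  let y := if c then left_inv (a s) x else (x + 1) / 2 in F s y < G s y ->
  0 < x <= 1 -> branch a c k F t x < branch a c k G t x.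
Proof.
move=> s y; rewrite {}/y {}/s => FG x01; rewrite /branch x01; case: c FG => FG; last by rewrite ltr_pM2r.
rewrite ltr_pM2r// ltr_pM2r// invr_gt0; apply: left_deriv_gt0.
by apply: lt_le_trans (adm_gt0 adm) _; have /andP[] := adm_itv1 (circle_proj (preimage_ang k t)).
Qed.

Lemma transfer_le F G t x : (forall t x, F t x <= G t x) -> L F t x <= L G t x.
Proof. by move=> FG; apply: ler_sum => i _; exact: branch_le. Qed.

(** A nonnegative fixed function that vanishes at a point vanishes at its
    preimages; this is applied to [G - F]. *)
Lemma fixed_lt_forward F G t y : (forall t x, F t x <= G t x) ->
  (forall t x, L F t x = F t x) -> (forall t x, L G t x = G t x) ->
  0 < y <= 1 -> F t y < G t y ->
  F (4 * t) (T_ (a t) y) < G (4 * t) (T_ (a t) y).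
Proof.
move=> FG fF fG /andP[y0 y1] lt.
have a0 : 0 < a t.
  by apply: lt_le_trans (adm_gt0 adm) _; have /andP[] := adm_itv1 (circle_proj t).
have e0 : preimage_ang 0 (4 * t) = t by rewrite /preimage_ang; lra.
rewrite -fF -fG; set x := T_ _ _.
have [c cE] : exists c, 0 < x <= 1 /\ (if c then left_inv (a t) x else (x + 1) / 2) = y.
  have [y2|y2] := leP y 2^-1.
    have ex : x = left_map (a t) y by rewrite /x T_left// y2 ltW.
    exists true; rewrite ex left_mapK ?y0//; split=> //.
    rewrite (lt_le_trans y0 (left_map_ge _ (ltW y0)))//=.
    by rewrite -(left_map_half (a t)) left_map_le// y2 ltW.
  by exists false; rewrite /x T_right//; split; lra.
have [x01 ey] := cE.
rewrite /L /transfer (bigD1 (c, ord0)) 1?[ltRHS](bigD1 (c, ord0))//=.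
apply: ltr_leD; last by apply: ler_sum => i _; exact: branch_le.
by apply: branch_lt => //; rewrite e0 ey.
Qed.

Variables (A : R) (H1 H2 : R -> R -> R).
Hypotheses (t1 : tame B g A H1) (t2 : tame B g A H2).
Hypothesis f1 : forall t x, L H1 t x = H1 t x.
Hypothesis f2 : forall t x, L H2 t x = H2 t x.

Let M t x := Num.max (H1 t x) (H2 t x).
Let h1 := tame_harnack t1.
Let h2 := tame_harnack t2.
Let hM : harnack B M. Proof. exact: harnack_max. Qed.

Let tM : tame B g A M.
Proof.
split => //; first by move=> t x; rewrite /M (tame_periodic t1) (tame_periodic t2).
by move=> t x x01; rewrite ge_max (tame_le t1)// (tame_le t2).
Qed.

(** The maximum of two fixed points is below its image, which has the same
    integral. *)
Let fM t x : L M t x = M t x.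
Proof.
have B0 := harnack_cst_ge0.
have pM := tame_periodic tM.
have LM t' x' : M t' x' <= L M t' x'.
  rewrite ge_max -{1}f1 -{1}f2.
  by rewrite !transfer_le// => t'' x''; rewrite le_max lexx ?orbT.
have iM := integrable_tame B0 adm_g01 measurableT tM.
apply/esym; apply: (harnack_le_eq B0 hM (adm_harnack hM) pM (adm_periodic pM)) => //.
- exact: integrable_transfer.
- by rewrite transferR_massT.
Qed.

Let open_gap F G t x : harnack B F -> harnack B G -> 0 < x <= 1 ->
  F t x < G t x -> exists2 r, 0 < r &
  forall s y, `|s - t| < r -> `|y - x| < r -> 0 < y <= 1 -> F s y < G s y.
Proof.
move=> hF hG x01 lt; pose e := (G t x - F t x) / 2.
have e0 : 0 < e by rewrite /e; lra.
have B0 := harnack_cst_ge0.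
have [d1 d10 D1] := harnack_continuous t hF B0 x01 e0.
have [d2 d20 D2] := harnack_continuous t hG B0 x01 e0.
exists (Num.min d1 d2); first by rewrite lt_min d10.
move=> s y; rewrite !lt_min => /andP[s1 s2] /andP[y1 y2] /andP[_ y11].
have := D1 s y s1 y1 y11; have := D2 s y s2 y2 y11.
have e2 : G t x - F t x = 2 * e by rewrite /e; lra.
by rewrite !ltr_norml; lra.
Qed.

Let le_M1 t x : H1 t x <= M t x. Proof. by rewrite le_max lexx. Qed.
Let le_M2 t x : H2 t x <= M t x. Proof. by rewrite le_max lexx orbT. Qed.

Let a01 t : 0 < a t <= 1.
Proof.
have /andP[ba ->] := adm_itv1 (circle_proj t).
by rewrite (lt_le_trans (adm_gt0 adm) ba).
Qed.

(** Otherwise both functions would be below their maximum at the bottom of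
    fibres above integers; by periodicity these fibres are the same. *)
Let fixed_ordered : (forall t x, H1 t x <= H2 t x) \/ (forall t x, H2 t x <= H1 t x).
Proof.
have [[t [x [x01 P1]]]|NP] := pselect (exists t x, 0 < x <= 1 /\ H2 t x < M t x); last first.
  left=> t x; have [x01|xo] := boolP (0 < x <= 1); last first.
    by rewrite (harnack_out h1)// (harnack_out h2).
  by rewrite leNgt; apply/negP => lt; apply: NP; exists t, x; rewrite /M lt_max lt.
have [[s [y [y01 P2]]]|NP] := pselect (exists t x, 0 < x <= 1 /\ H1 t x < M t x); last first.
  right=> s y; have [y01|yo] := boolP (0 < y <= 1); last first.
    by rewrite (harnack_out h1)// (harnack_out h2).
  by rewrite leNgt; apply/negP => lt; apply: NP; exists s, y; rewrite /M lt_max lt orbT.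
exfalso.
have [n [d /andP[d0 d2] Fn]] := @open_forward_fills R a a01 (fun t x => H2 t x < M t x)
  (fun t x => fixed_lt_forward le_M2 f2 fM)
  (fun t x => open_gap h2 hM) t x x01 P1.
have [m [e /andP[e0 e2] Fm]] := @open_forward_fills R a a01 (fun t x => H1 t x < M t x)
  (fun t x => fixed_lt_forward le_M1 f1 fM)
  (fun t x => open_gap h1 hM) s y y01 P2.
pose z := Num.min d e.
have z0 : 0 < z by rewrite lt_min d0.
have zd : z <= d by rewrite ge_min lexx.
have ze : z <= e by rewrite ge_min lexx orbT.
have := Fn z (introT andP (conj z0 zd)); have := Fm z (introT andP (conj z0 ze)).
have nm : (n%:~R - m%:~R : R) \is a Num.int by rewrite rpredB ?intr_int.
rewrite /M !(periodic1_int (tame_periodic t1) _ nm) !(periodic1_int (tame_periodic t2) _ nm).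
by rewrite !lt_max !ltxx orbF/= => lt1 lt2; have := lt_trans lt1 lt2; rewrite ltxx.
Qed.

Lemma fixed_unique : \int[leb]_p descend H1 p = \int[leb]_p descend H2 p ->
  forall t x, H1 t x = H2 t x.
Proof.
move=> eI; have B0 := harnack_cst_ge0.
have i1 := integrable_tame B0 adm_g01 measurableT t1.
have i2 := integrable_tame B0 adm_g01 measurableT t2.
have p1 := tame_periodic t1; have p2 := tame_periodic t2.
case: fixed_ordered => le12 t x; first exact: (harnack_le_eq B0 h1 h2).
by apply/esym; exact: (harnack_le_eq B0 h2 h1).
Qed.

End fixed_points.

(** * Limits along an ultrafilter *)

Section ultralimit.
Variable R : realType.
Local Notation leb := (@leb_strip R).
Variable U : set_system nat.
Hypothesis ultraU : UltraFilter U.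

Lemma bounded_ultra_cvg (u : nat -> R) (m M : R) : (forall n, m <= u n <= M) ->
  cvg (u n @[n --> U]).
Proof.
move=> uM.
have FU : ProperFilter (u n @[n --> U]) by apply: fmap_proper_filter.
have Um : (u n @[n --> U]) `[m, M]%classic by apply: nearW => n /=; rewrite in_itv/= uM.
have [] := @segment_compact R m M _ FU Um.
move=> l [_ cl]; apply/cvg_ex; exists l => V lV.
have [//|UnV] := in_ultra_setVsetC (u @^-1` V) ultraU.
by have [y [/= nVy Vy]] := cl (~` V) V UnV lV.
Qed.

Variables (B g A : R).
Hypotheses (B0 : 0 <= B) (g01 : 0 <= g < 1).
Variable Hn : nat -> R -> R -> R.
Hypothesis tHn : forall n, tame B g A (Hn n).

Definition ulim (t x : R) : R := lim (Hn n t x @[n --> U]).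

Let hHn n := tame_harnack (tHn n).

Lemma ulim_cvg t x : Hn n t x @[n --> U] --> ulim t x.
Proof.
apply: (@bounded_ultra_cvg _ 0 (A * weight g t x)) => n.
by rewrite (harnack_ge0 (hHn n)) (tame_weight (tHn n)).
Qed.

Lemma ulim_tame : tame B g A ulim.
Proof.
split; first split.
- move=> t x; apply: (cvgr_to_ge (ulim_cvg (t := t) (x := x))).
  by apply: nearW => n; exact: harnack_ge0 (hHn n) _ _.
- move=> t x xo; apply/cvg_lim => //.
  rewrite (_ : (fun n => _) = cst 0); first exact: cvg_cst.
  by apply/funext => n; rewrite (harnack_out (hHn n)).
- move=> t x y x0 xy y1; apply: (ler_cvg_to (ulim_cvg (t := t) (x := y)) (ulim_cvg (t := t) (x := x))).
  by apply: nearW => n; exact: (harnack_dec (hHn n)).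
- move=> t x y x0 xy y1.
  apply: (ler_cvg_to (cvgM (cvg_cst (x ^+ 2)) (ulim_cvg (t := t) (x := x)))
    (cvgM (cvg_cst (y ^+ 2)) (ulim_cvg (t := t) (x := y)))).
  by apply: nearW => n; exact: (harnack_inc (hHn n)).
- move=> s t x.
  apply: (ler_cvg_to (ulim_cvg (t := s) (x := x))
    (cvgM (ulim_cvg (t := t) (x := x)) (cvg_cst (expR (B * `|s - t|))))).
  by apply: nearW => n; exact: (harnack_exp (hHn n)).
- move=> t x; rewrite /ulim (_ : (fun n => _) = (fun n => Hn n t x))//.
  by apply/funext => n; rewrite (tame_periodic (tHn n)).
- move=> t x x01; apply: (cvgr_to_le (ulim_cvg (t := t) (x := x))).
  by apply: nearW => n; exact: (tame_le (tHn n)).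
Qed.

(** The rational point is the same for all functions, so that convergence at
    rational points controls convergence everywhere. *)
Lemma tame_equicontinuous t x e : 0 < x <= 1 -> 0 < e ->
  exists r q : rat, forall H, tame B g A H ->
    `|H t x - H (ratr r) (ratr q)| <= e.
Proof.
move=> /andP[x0 x1] e0.
have A0 : 0 <= A.
  have := tame_le (tHn 0) 0 (x := 1); rewrite powR1 mulr1 => /(_ _)/wrap[]; first lra.
  by apply: le_trans; exact: harnack_ge0 (hHn 0) _ _.
pose M := A * (x / 2) `^ (- g).
have M0 : 0 <= M by rewrite mulr_ge0// powR_ge0.
have K0 : 0 <= M * (4 / x + B) by rewrite mulr_ge0// addr_ge0// divr_ge0// ltW.
pose d := e / (M * (4 / x + B) + 1).
have d0 : 0 < d by rewrite divr_gt0//; lra.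
have [r] := @rat_in_itvoo R t (t + d) (ltac:(lra)); rewrite in_itv/= => /andP[tr rd].
have mx : Num.max (x / 2) (x - d) < x by rewrite gt_max; apply/andP; split; lra.
have [q] := rat_in_itvoo mx; rewrite in_itv/= gt_max => /andP[/andP[xq dq] qx].
exists r, q => H tH; have hH := tame_harnack tH.
have x20 : 0 < x / 2 by lra.
have MH s y : x / 2 <= y -> y <= 1 -> H s y <= M.
  move=> xy y1; apply: (@le_trans _ _ (H s (x / 2))).
    exact: (harnack_dec hH).
  by apply: (tame_le tH); lra.
apply: le_trans (@harnack_lip R B H (x / 2) M t (ratr r) x (ratr q) hH B0 x20 _ _ _ _ _) _;
  rewrite ?MH//; try lra.
have -> : 2 / (x / 2) = 4 / x by field; rewrite gt_eqF.
rewrite gtr0_norm ?subr_gt0// ltr0_norm ?subr_lt0// opprB.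
apply: (@le_trans _ _ (M * ((4 / x + B) * d))).
  apply: ler_wpM2l => //; rewrite [leRHS]mulrDl; apply: lerD; apply: ler_wpM2l => //; try lra.
  by rewrite divr_ge0// ltW.
rewrite mulrA /d mulrA ler_pdivrMr; last lra.
by rewrite mulrC ler_wpM2l//; lra.
Qed.

Lemma rationals_ultra (e : R) m : 0 < e ->
  U [set n | forall k, (k < m)%N -> forall r q : rat, unpickle k = Some (r, q) ->
    `|Hn n (ratr r) (ratr q) - ulim (ratr r) (ratr q)| < e].
Proof.
move=> e0; elim: m => [|m IH]; first by apply: filterS (@filterT _ U _) => n _ k.
case E : (unpickle m : option (rat * rat)%type) => [[r q]|]; last first.
  apply: filterS IH => n /= h k; rewrite ltnS leq_eqVlt => /predU1P[->|km] r q.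
    by rewrite E.
  exact: h.
have /cvgrPdist_lt/(_ e e0) h2 := ulim_cvg (t := ratr r) (x := ratr q).
apply: filterS (filterI IH h2) => n /= [h h'] k; rewrite ltnS leq_eqVlt => /predU1P[->|km] r' q'.
  by rewrite E => -[<- <-]; rewrite distrC.
exact: h.
Qed.

(** Domination lets the integral pass to the limit along sequences; a sequence
    suited to the ultrafilter is extracted from the values at rational points,
    which by equicontinuity determine the limit. *)
Lemma ulim_integral D : measurable D ->
  (\int[leb]_(p in D) descend (Hn n) p) @[n --> U] -->
  \int[leb]_(p in D) descend ulim p.
Proof.
move=> mD; pose J n := \int[leb]_(p in D) descend (Hn n) p.
pose W p := A * descend (weight g) p.
have iW E : measurable E -> leb.-integrable E (EFin \o W).
  move=> mE; apply: (@integrableS _ _ _ _ setT) => //.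
  exact: integrableZl (integrable_weight g01).
have iH n : leb.-integrable D (EFin \o descend (Hn n)) by exact: integrable_tame (tHn n).
have JM n : 0 <= J n <= \int[leb]_(p in D) W p.
  apply/andP; split.
    by apply: Rintegral_ge0 => p _; exact: harnack_ge0 (hHn n) _ _.
  by apply: le_Rintegral => //; [exact: iW|move=> p _; exact: (tame_weight (tHn n))].
have cJ := bounded_ultra_cvg JM; set j := lim (J n @[n --> U]) in cJ.
suff -> : \int[leb]_(p in D) descend ulim p = j by [].
have ex i : exists n, (forall k, (k < i)%N -> forall r q : rat, unpickle k = Some (r, q) ->
    `|Hn n (ratr r) (ratr q) - ulim (ratr r) (ratr q)| < i.+1%:R^-1) /\ `|j - J n| < i.+1%:R^-1.
  have i0 : 0 < i.+1%:R^-1 :> R by rewrite invr_gt0.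
  have /cvgrPdist_lt/(_ _ i0) h2 := cJ.
  have [n [h3 h4]] := filter_ex (filterI (rationals_ultra i i0) h2).
  by exists n.
have [n_ n_P] := choice ex.
have pt p : (EFin \o descend (Hn (n_ i))) p @[i --> \oo] --> (EFin \o descend ulim) p.
  apply: cvg_EFin; first by apply: nearW.
  rewrite /comp/= /descend; move: (circle_sec p.1) (p.2 : R) => t x.
  have [x01|xo] := boolP (0 < x <= 1); last first.
    rewrite (harnack_out (tame_harnack ulim_tame))//.
    rewrite (_ : (fun i => _) = cst 0); first exact: cvg_cst.
    by apply/funext => i; rewrite (harnack_out (hHn _)).
  apply/cvgrPdist_lt => e e0.
  have e40 : 0 < e / 4 by lra.
  have [r [q rq]] := tame_equicontinuous t x01 e40.
  near=> i.
  have i1 : i.+1%:R^-1 < e / 4 by near: i; exact: near_infty_natSinv_lt (PosNum e40).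
  have [h1 _] := n_P i.
  have ki : (pickle (r, q) < i)%N by near: i; exact: nbhs_infty_gt.
  have h2 := h1 _ ki r q (pickleK _).
  have h3 := rq _ (tHn (n_ i)); have h4 := rq _ ulim_tame.
  move: h2 h3 h4 i1; rewrite ltr_norml !ler_norml ltr_norml.
  by move: (Hn _ _ _) (Hn _ _ _) (ulim _ _) (ulim _ _) (_^-1) => a b c d f; lra.
have mH n : measurable_fun D (EFin \o descend (Hn n)) by have /integrableP[] := iH n.
have mU : measurable_fun D (EFin \o descend ulim).
  by have /integrableP[] := integrable_tame B0 g01 mD ulim_tame.
have dom p i : (`|(EFin \o descend (Hn (n_ i))) p| <= (EFin \o W) p)%E.
  rewrite /= ger0_norm; last exact: harnack_ge0 (hHn _) _ _.
  by rewrite lee_fin; exact: (tame_weight (tHn (n_ i))).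
have [_ _ h] := dominated_convergence mD (fun i => mH (n_ i)) mU (aeW _ (fun p _ => pt p))
  (iW D mD) (aeW _ (fun p i _ => dom p i)).
have c1 : J (n_ i) @[i --> \oo] --> \int[leb]_(p in D) descend ulim p.
  apply: fine_cvg; rewrite /Rintegral fineK; last first.
    by apply: integrable_fin_num => //; exact: integrable_tame ulim_tame.
  exact: h.
have c2 : J (n_ i) @[i --> \oo] --> j.
  apply/cvgrPdist_lt => e e0; near=> i.
  have [_ h1] := n_P i; apply: lt_trans h1 _.
  by near: i; exact: near_infty_natSinv_lt (PosNum e0).
exact: (cvg_unique _ c1 c2).
Unshelve. all: by end_near.
Qed.

End ultralimit.

(** * Averages of the iterates of the transfer operator *)

Section averages.
Variable R : realType.
Local Notation leb := (@leb_strip R).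
Variables (alpha : circle R -> R) (b g l : R).
Hypothesis adm : admissible alpha b g l.
Local Notation B := (harnack_cst b l).
Local Notation a := (fun t => alpha (circle_proj t)).
Local Notation L := (adm_transfer alpha).
Variable U : set_system nat.
Hypothesis ultraU : UltraFilter U.
Hypothesis U_oo : \oo `<=` U.

Let B0 : 0 <= B := harnack_cst_ge0 adm.
Let g01 := adm_g01 adm.

Definition average (H : R -> R -> R) n t x :=
  n.+1%:R^-1 * \sum_(k < n.+1) iter k L H t x.

(** The mass does not change under iteration, so it gives a uniform bound
    above height [1/2]; this is the input of [transfer_power_bound]. *)
Lemma tame_iter A H : tame B g A H ->
  exists A', forall k, tame B g A' (iter k L H).
Proof.
move=> tH; have b0 := adm_gt0 adm.
pose c := \int[leb]_p descend H p.
pose K := 2 * expR B * c.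
exists (Num.max A (3 * K / b)) => k.
suff [//] : tame B g (Num.max A (3 * K / b)) (iter k L H) /\
    \int[leb]_p descend (iter k L H) p = c.
elim: k => [|k [IH IHc]].
  by split=> //; apply: tame_le_bound tH; rewrite le_max lexx.
have hk := tame_harnack IH; have pk := tame_periodic IH; rewrite iterS.
split; last by rewrite (transferR_massT adm hk pk).
split; [exact: (adm_harnack adm)|exact: adm_periodic|].
have ab t : b <= a t <= 1 by exact: adm_itv1 adm _.
have ag t : a t <= g by have /andP[] := adm_itv adm (circle_proj t).
have /andP[_ /ltW g1] := g01.
apply: (transfer_power_bound b0 ab hk ag g1 (K := K)).
- by rewrite -ler_pdivrMr// le_max lexx orbT.
- move=> t x x2; rewrite /K -IHc; apply: harnack_mass => //.
  exact: (integrable_tame B0 g01 measurableT IH).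
- exact: tame_le IH.
Qed.

Lemma tame_average A H : (forall k, tame B g A (iter k L H)) ->
  forall n, tame B g A (average H n).
Proof.
move=> tH n; split.
- apply: harnackZ; first by rewrite invr_ge0.
  by apply: harnack_sum => k; exact: tame_harnack (tH k).
- move=> t x; rewrite /average; congr (_ * _); apply: eq_bigr => k _.
  exact: tame_periodic (tH k) _ _.
- move=> t x x01; rewrite /average ler_pdivrMl//.
  apply: (@le_trans _ _ (\sum_(k < n.+1) A * x `^ (- g))).
    by apply: ler_sum => k _; exact: (tame_le (tH k)).
  by rewrite sumr_const card_ord mulr_natl.
Qed.

Lemma Rintegral_sum (D : set (cylinder R)) (f : nat -> cylinder R -> R) n :
  measurable D -> (forall k, leb.-integrable D (EFin \o f k)) ->
  \int[leb]_(p in D) (\sum_(k < n) f k p) = \sum_(k < n) \int[leb]_(p in D) f k p.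
Proof.
move=> mD iF.
have : leb.-integrable D (EFin \o (fun p => \sum_(k < n) f k p)) /\
  \int[leb]_(p in D) (\sum_(k < n) f k p) = \sum_(k < n) \int[leb]_(p in D) f k p.
  elim: n => [|n [IH1 IH2]].
    split.
      rewrite (_ : _ \o _ = cst 0%E); first exact: integrable0.
      by apply/funext => p /=; rewrite big_ord0.
    under eq_Rintegral do rewrite big_ord0.
    by rewrite big_ord0 Rintegral_cst// mul0r.
  have e : (fun p => \sum_(k < n.+1) f k p) = (fun p => \sum_(k < n) f k p + f n p).
    by apply/funext => p; rewrite big_ord_recr.
  rewrite e big_ord_recr/= -IH2; split; last exact: RintegralD.
  exact: (integrableD mD IH1 (iF n)).
by case.
Qed.

Lemma average_integral A H n D : (forall k, tame B g A (iter k L H)) ->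
  measurable D ->
  \int[leb]_(p in D) descend (average H n) p =
  n.+1%:R^-1 * \sum_(k < n.+1) \int[leb]_(p in D) descend (iter k L H) p.
Proof.
move=> tH mD.
have iH k : leb.-integrable D (EFin \o descend (iter k L H)).
  exact: (integrable_tame B0 g01 mD (tH k)).
rewrite -(@Rintegral_sum D (fun k => descend (iter k L H)) n.+1 mD iH) -RintegralZl//.
have tS := tame_average tH n.
have := integrable_tame B0 g01 mD tS.
move=> /(integrableZl mD n.+1%:R).
apply: eq_integrable => // p _.
by rewrite /= -EFinM /descend /average mulrA mulfV// mul1r.
Qed.

Lemma transfer_ulim A (Hn : nat -> R -> R -> R) t x :
  (forall n, tame B g A (Hn n)) ->
  L (Hn n) t x @[n --> U] --> L (ulim U Hn) t x.
Proof.
move=> tH; rewrite /L /adm_transfer /transfer.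
apply: cvg_big => //; first exact: add_continuous.
move=> i _; rewrite /branch; case: ifP => _; last exact: cvg_cst.
case: i.1; last by apply: cvgMr_tmp; exact: (ulim_cvg ultraU tH).
by apply: cvgMr_tmp; apply: cvgMr_tmp; exact: (ulim_cvg ultraU tH).
Qed.

Lemma transfer_average H n t x :
  L (average H n) t x - average H n t x =
  n.+1%:R^-1 * (iter n.+1 L H t x - H t x).
Proof.
have LS m : L (fun t x => \sum_(k < m) iter k L H t x) t x = \sum_(k < m) iter k.+1 L H t x.
  elim: m => [|m IH].
    rewrite big_ord0 /L /adm_transfer /transfer big1// => i _; rewrite /branch.
    by case: ifP => // _; case: i.1; rewrite !big_ord0 !mul0r.
  rewrite big_ord_recr/= -IH.
  rewrite -(transferD _ (fun t x => \sum_(k < m) iter k L H t x)).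
  by apply: eq_transfer => t' x'; rewrite big_ord_recr.
rewrite /average /L /adm_transfer transferZ -/(adm_transfer alpha _) LS -mulrBr.
congr (_ * _); rewrite big_ord_recr/=.
have -> : \sum_(k < n.+1) iter k L H t x = H t x + \sum_(k < n) L (iter k L H) t x.
  by rewrite big_ord_recl.
by rewrite opprD [X in _ + X]addrC addrACA subrr add0r.
Qed.

(** The image of an average differs from it by a telescoping sum, of order
    [1 / n]. *)
Lemma ulim_average_fixed A H : (forall k, tame B g A (iter k L H)) ->
  forall t x, L (ulim U (average H)) t x = ulim U (average H) t x.
Proof.
move=> tH t x; have tA := tame_average tH.
have c1 := transfer_ulim (t := t) (x := x) tA.
have c2 := ulim_cvg ultraU tA (t := t) (x := x).
have c3 : L (average H n) t x - average H n t x @[n --> U] --> 0.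
  under eq_fun do rewrite transfer_average.
  apply: (@cvg_trans _ ((n.+1%:R^-1 * (iter n.+1 L H t x - H t x)) @[n --> \oo])).
    by move=> V; exact: U_oo.
  apply/cvgr0Pnorm_lt => e e0; pose W := A * weight g t x.
  have HW k : 0 <= iter k L H t x <= W.
    by rewrite (harnack_ge0 (tame_harnack (tH k))) (tame_weight (tH k)).
  have W0 : 0 <= W by have /andP[] := HW 0%N; apply: le_trans.
  have W1 : 0 < W + 1 by lra.
  have e1 : 0 < e / (W + 1) by exact: divr_gt0.
  near=> n.
  have n1 : n.+1%:R^-1 < e / (W + 1) by near: n; exact: near_infty_natSinv_lt (PosNum e1).
  rewrite normrM ger0_norm ?invr_ge0//.
  have h : `|iter n.+1 L H t x - H t x| <= W.
    have /andP[] := HW n.+1; have /andP[] := HW 0%N; rewrite /= ler_norml.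
    by move: (adm_transfer _ _ _ _) (H t x) => p q; lra.
  apply: (@le_lt_trans _ _ (n.+1%:R^-1 * (W + 1))).
    by rewrite ler_wpM2l ?invr_ge0//; lra.
  by rewrite -ltr_pdivlMr.
have c4 := cvgB c1 c2.
apply/eqP; rewrite -subr_eq0; apply/eqP.
by rewrite -(cvg_lim (@Rhausdorff R) (c4 _)); exact: (cvg_lim (@Rhausdorff R) c3).
Unshelve. all: by end_near.
Qed.

Definition strip_one (t x : R) : R := if 0 < x <= 1 then 1 else 0.

Lemma tame_const c : 0 <= c -> tame B g c (fun t x => c * strip_one t x).
Proof.
move=> c0; have o x : 0 < x <= 1 -> 1 <= x `^ (- g).
  move=> /andP[x0 x1]; rewrite powRN invf_ge1 ?powR_gt0//.
  by have /andP[g0 g1] := g01; rewrite -[leRHS](powRr0 x) ger_powR ?x0 ?x1.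
have h : harnack B strip_one.
  rewrite /strip_one; split.
  - by move=> t x; case: ifP.
  - by move=> t x /negbTE ->.
  - by move=> t x y x0 xy y1; rewrite x0 (le_trans xy)// (lt_le_trans x0)//= y1.
  - move=> t x y x0 xy y1; rewrite x0 (le_trans xy)// (lt_le_trans x0)//= y1 !mulr1.
    by rewrite ler_sqr ?nnegrE ?(le_trans (ltW x0))// ltW.
  - move=> s t x; case: ifP => _; last by rewrite mul0r.
    by rewrite mul1r -expR0 ler_expR mulr_ge0.
split; first exact: harnackZ.
- by [].
- by move=> t x x01; rewrite /strip_one x01 mulr1 ler_peMr// o.
Qed.

Lemma integral_strip_one c : 0 <= c ->
  \int[leb]_p descend (fun t x => c * strip_one t x) p = c.
Proof.
move=> c0; have tc := tame_const c0.
have m := measurable_tame B0 tc.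
rewrite /Rintegral ge0_integral_strip; last 2 first.
- exact/measurable_EFinP.
- by move=> p; rewrite lee_fin (harnack_ge0 (tame_harnack tc)).
transitivity (fine (\int[@lebesgue_measure R]_(t in `]0%R, 1%R])
    \int[@lebesgue_measure R]_(x in `]0%R, 1%R]) c%:E)%E).
  congr fine; apply: eq_integral => t _; apply: eq_integral => x /set_mem/=.
  by rewrite in_itv/= /descend /strip_one => ->; rewrite mulr1.
have int1 (d : R) : (\int[@lebesgue_measure R]_(x in `]0%R, 1%R]) d%:E = d%:E)%E.
  by rewrite integral_cst//= lebesgue_measure_itv/= lte_fin ltr01 sube0 mule1.
by under eq_integral do rewrite int1; rewrite int1.
Qed.

Lemma average_mass A H n : (forall k, tame B g A (iter k L H)) ->
  \int[leb]_p descend (average H n) p = \int[leb]_p descend H p.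
Proof.
move=> tH; rewrite (average_integral _ tH measurableT).
have e k : \int[leb]_p descend (iter k L H) p = \int[leb]_p descend H p.
  elim: k => [//|k <-]; have t := tH k.
  by rewrite iterS (transferR_massT adm (tame_harnack t) (tame_periodic t)).
rewrite (eq_bigr _ (fun k _ => e (nat_of_ord k))) sumr_const card_ord -[X in _ * X]mulr_natl.
by rewrite mulrA mulVf// mul1r.
Qed.

Lemma ulim_average_mass A H : (forall k, tame B g A (iter k L H)) ->
  \int[leb]_p descend (ulim U (average H)) p = \int[leb]_p descend H p.
Proof.
move=> tH; have tA := tame_average tH.
have := ulim_integral ultraU B0 g01 tA (@measurableT _ _).
under eq_fun do rewrite (average_mass _ tH).
by move=> h; apply: (cvg_unique _ h) => //; exact: cvg_cst.
Qed.

(** The averages start from the uniform density. *)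
Definition inv_density := ulim U (average (fun t x => 1 * strip_one t x)).

Lemma inv_density_spec : [/\ exists A, tame B g A inv_density,
  forall t x, L inv_density t x = inv_density t x &
  \int[leb]_p descend inv_density p = 1].
Proof.
have [A' tk] := tame_iter (tame_const ler01).
have tA := tame_average tk.
split.
- by exists A'; exact: ulim_tame tA.
- exact: ulim_average_fixed tk.
- by rewrite (ulim_average_mass tk) integral_strip_one.
Qed.

(** The limit is a fixed density, hence determined by its mass. *)
Lemma ulim_average A H : tame B g A H -> forall t x,
  ulim U (average H) t x = (\int[leb]_p descend H p) * inv_density t x.
Proof.
move=> tH; have [A' tk] := tame_iter tH.
have tu := ulim_tame ultraU (tame_average tk).
have [[A'' td] fd id] := inv_density_spec.
set c := \int[leb]_p descend H p.
have c0 : 0 <= c.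
  by apply: Rintegral_ge0 => p _; exact: harnack_ge0 (tame_harnack tH) _ _.
have tc : tame B g (c * A'') (fun t x => c * inv_density t x).
  split; first exact: harnackZ (tame_harnack td).
  - by move=> t x; rewrite (tame_periodic td).
  - by move=> t x x01; rewrite -mulrA ler_wpM2l// (tame_le td).
pose M := Num.max A' (c * A'').
have t1 : tame B g M (ulim U (average H)) by apply: tame_le_bound tu; rewrite le_max lexx.
have t2 : tame B g M (fun t x => c * inv_density t x).
  by apply: tame_le_bound tc; rewrite le_max lexx orbT.
apply: (fixed_unique adm t1 t2).
- exact: ulim_average_fixed tk.
- by move=> t x; rewrite /adm_transfer transferZ -/(adm_transfer alpha _) fd.
- rewrite (ulim_average_mass tk) -/c; under eq_Rintegral do rewrite /descend.
  have := RintegralZl c measurableT (integrable_tame B0 g01 measurableT td).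
  by rewrite id mulr1 => {1}<-.
Qed.

Definition pull_back k (D : set (cylinder R)) :=
  iter k (fun E => @strip R `&` skew_map alpha @^-1` E) D.

Lemma measurable_pull_back k D : measurable D -> measurable (pull_back k D).
Proof.
by move=> mD; elim: k => [//|k IH]; rewrite /pull_back iterS; exact: (measurable_preimage_skew adm).
Qed.

Lemma pull_back_mass k D A H : (forall j, tame B g A (iter j L H)) ->
  measurable D ->
  \int[leb]_(p in pull_back k D) descend H p =
  \int[leb]_(p in D) descend (iter k L H) p.
Proof.
elim: k H => [//|k IH] H tH mD.
have t0 := tH 0%N.
rewrite /pull_back iterS (transferR_mass adm (tame_harnack t0) (tame_periodic t0)); last first.
  exact: measurable_pull_back.
rewrite -/(pull_back k D) IH//; first by rewrite -iterSr.
by move=> j; rewrite -iterSr.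
Qed.

Definition orbit_average D (f : cylinder R -> R) n :=
  n.+1%:R^-1 * \sum_(k < n.+1) \int[leb]_(p in pull_back k D) f p.

Lemma orbit_average_tame A H D : tame B g A H -> measurable D ->
  orbit_average D (descend H) n @[n --> U] -->
  (\int[leb]_p descend H p) * \int[leb]_(p in D) descend inv_density p.
Proof.
move=> tH mD; have [A' tk] := tame_iter tH.
have [[A'' td] _ _] := inv_density_spec.
have := ulim_integral ultraU B0 g01 (tame_average tk) mD.
rewrite -(RintegralZl _ mD (integrable_tame B0 g01 mD td)).
rewrite (_ : (fun n => \int[leb]_(p in D) _) = orbit_average D (descend H)); last first.
  apply/funext => n; rewrite (average_integral _ tk mD) /orbit_average.
  by congr (_ * _); apply: eq_bigr => k _; rewrite (pull_back_mass _ tk).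
rewrite (_ : \int[leb]_(p in D) descend (ulim U (average H)) p =
  \int[leb]_(p in D) (\int[leb]_p descend H p * descend inv_density p))//.
by apply: eq_Rintegral => p _; rewrite /descend (ulim_average tH).
Qed.

End averages.

(** * Equidistribution of integrable functions *)

Section equidistribution.
Variable R : realType.
Local Notation leb := (@leb_strip R).
Variables (alpha : circle R -> R) (b g l : R).
Hypothesis adm : admissible alpha b g l.
Local Notation B := (harnack_cst b l).
Variable U : set_system nat.
Hypothesis ultraU : UltraFilter U.
Hypothesis U_oo : \oo `<=` U.
Variable D : set (cylinder R).
Hypothesis mD : measurable D.

Let B0 : 0 <= B := harnack_cst_ge0 adm.
Let g01 := adm_g01 adm.
Local Notation h := (descend (inv_density alpha U)).
Local Notation integrable f := (leb.-integrable setT (EFin \o f)).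

Let c := \int[leb]_(p in D) h p.

(** Seen through [D], the images of the density [f] retain on average only the
    mass of [f]. *)
Definition equidistributed (f : cylinder R -> R) :=
  integrable f /\ orbit_average alpha D f n @[n --> U] --> (\int[leb]_p f p) * c.

Let c01 : 0 <= c <= 1.
Proof.
have [[A td] _ id] := inv_density_spec adm ultraU U_oo.
have h0 p : 0 <= h p by exact: harnack_ge0 (tame_harnack td) _ _.
apply/andP; split; first by apply: Rintegral_ge0 => p _.
have iE E : measurable E -> leb.-integrable E (EFin \o h).
  by move=> mE; exact: (integrable_tame B0 g01 mE td).
rewrite -id /c /Rintegral fine_le//.
- by apply: integrable_fin_num => //; exact: iE.
- by apply: integrable_fin_num => //; exact: iE.
- apply: ge0_subset_integral => //; last by move=> p _; rewrite lee_fin.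
  by have /integrableP[] := iE _ (@measurableT _ _).
Qed.

Let mP k : measurable (pull_back alpha k D).
Proof. exact: (measurable_pull_back adm). Qed.

Let iP k f : integrable f -> leb.-integrable (pull_back alpha k D) (EFin \o f).
Proof. by move=> iF; apply: integrableS iF. Qed.

Lemma orbit_averageB f1 f2 n : integrable f1 -> integrable f2 ->
  orbit_average alpha D (fun p => f1 p - f2 p) n = orbit_average alpha D f1 n - orbit_average alpha D f2 n.
Proof.
move=> i1 i2; rewrite /orbit_average -mulrBr -sumrB; congr (_ * _).
by apply: eq_bigr => k _; rewrite RintegralB//; exact: iP.
Qed.

Lemma orbit_averageD f1 f2 n : integrable f1 -> integrable f2 ->
  orbit_average alpha D (fun p => f1 p + f2 p) n = orbit_average alpha D f1 n + orbit_average alpha D f2 n.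
Proof.
move=> i1 i2; rewrite /orbit_average -mulrDr -big_split/=; congr (_ * _).
by apply: eq_bigr => k _; rewrite RintegralD//; exact: iP.
Qed.

Lemma orbit_averageZ f r n : integrable f ->
  orbit_average alpha D (fun p => r * f p) n = r * orbit_average alpha D f n.
Proof.
move=> iF; rewrite /orbit_average [RHS]mulrCA [X in _ = _ * X]mulr_sumr; congr (_ * _).
by apply: eq_bigr => k _; rewrite RintegralZl//; exact: iP.
Qed.

Lemma orbit_average_norm_le f n : integrable f ->
  `|orbit_average alpha D f n| <= \int[leb]_p `|f p|.
Proof.
move=> iF; have iN : integrable (fun p => `|f p|) by exact: (integrable_norm iF).
rewrite /orbit_average normrM ger0_norm ?invr_ge0// ler_pdivrMl//.
apply: le_trans (ler_norm_sum _ _ _) _.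
apply: (@le_trans _ _ (\sum_(k < n.+1) \int[leb]_p `|f p|)); last first.
  by rewrite sumr_const card_ord mulr_natl.
apply: ler_sum => k _; apply: le_trans (le_normr_Rintegral (mP k) (iP k iF)) _.
rewrite /Rintegral fine_le//.
- by apply: integrable_fin_num => //; exact: (iP k iN).
- exact: integrable_fin_num.
- by apply: ge0_subset_integral => //; have /integrableP[] := iN.
Qed.

Lemma equidistributed_tame A H : tame B g A H -> equidistributed (descend H).
Proof.
move=> tH; split; first exact: (integrable_tame B0 g01 measurableT tH).
exact: (orbit_average_tame adm ultraU U_oo tH mD).
Qed.

Lemma equidistributedB f1 f2 : equidistributed f1 -> equidistributed f2 ->
  equidistributed (fun p => f1 p - f2 p).
Proof.
move=> [i1 c1] [i2 c2]; split; first exact: (integrableB _ i1 i2).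
under eq_fun do rewrite orbit_averageB//.
by rewrite RintegralB// mulrBl; exact: cvgB.
Qed.

Lemma equidistributedD f1 f2 : equidistributed f1 -> equidistributed f2 ->
  equidistributed (fun p => f1 p + f2 p).
Proof.
move=> [i1 c1] [i2 c2]; split; first exact: (integrableD _ i1 i2).
under eq_fun do rewrite orbit_averageD//.
by rewrite RintegralD// mulrDl; exact: cvgD.
Qed.

Lemma equidistributedZ r f : equidistributed f -> equidistributed (fun p => r * f p).
Proof.
move=> [i1 c1]; split; first exact: (integrableZl _ _ i1).
under eq_fun do rewrite orbit_averageZ//.
by rewrite RintegralZl// -mulrA; exact: cvgMl_tmp.
Qed.

(** The orbit averages are contractions of [L^1], uniformly in [n]. *)
Lemma equidistributed_closed f : integrable f ->
  (forall e, 0 < e -> exists f', equidistributed f' /\ \int[leb]_p `|f p - f' p| <= e) ->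
  equidistributed f.
Proof.
move=> iF apx; split => //; apply/cvgrPdist_lt => e e0.
have e40 : 0 < e / 4 by lra.
have [f' [[iF' cF'] ff']] := apx _ e40.
have /cvgrPdist_lt/(_ _ e40) := cF'; apply: filterS => n hn.
have iB : integrable (fun p => f p - f' p) by exact: (integrableB _ iF iF').
have h1 := le_trans (orbit_average_norm_le n iB) ff'.
rewrite orbit_averageB// in h1.
have h2 : `|\int[leb]_p f p - \int[leb]_p f' p| <= e / 4.
  by rewrite -RintegralB//; apply: le_trans (le_normr_Rintegral _ iB) ff'.
have h3 : `|(\int[leb]_p f p) * c - (\int[leb]_p f' p) * c| <= e / 4.
  rewrite -mulrBl normrM; have /andP[c0 c1] := c01.
  by rewrite [`|c|]ger0_norm//; apply: le_trans h2; rewrite ler_piMr.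
move: h1 h3 hn; rewrite !ltr_norml !ler_norml.
move: (orbit_average _ _ _ _) (orbit_average _ _ _ _) (_ * c) (_ * c) => u v w z.
by move=> /andP[h5 h6] /andP[h7 h8] /andP[h9 h10]; apply/andP; split; lra.
Qed.

Lemma equidistributed_cvg (f_ : nat -> cylinder R -> R) f :
  (forall n, equidistributed (f_ n)) ->
  measurable_fun setT (f : cylinder R -> measurableTypeR R) ->
  (forall n p, `|f_ n p| <= 1) -> (forall p, f_ n p @[n --> \oo] --> f p) ->
  equidistributed f.
Proof.
move=> ef mf f1 cf.
have i1 : integrable (cst 1) by exact: finite_measure_integrable_cst.
have mf_ n : measurable_fun setT (EFin \o f_ n) by have [/integrableP[]] := ef n.
have mfE : measurable_fun setT (EFin \o f) by exact/measurable_EFinP.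
have ptw p : (EFin \o f_ n) p @[n --> \oo] --> (EFin \o f) p.
  by apply: cvg_EFin; [exact: nearW|exact: cf].
have dom n p : (`|(EFin \o f_ n) p| <= (EFin \o cst 1%R) p)%E by rewrite lee_fin.
have [iF h1 _] := dominated_convergence measurableT mf_ mfE
  (aeW _ (fun p _ => ptw p)) i1 (aeW _ (fun p n _ => dom n p)).
apply: equidistributed_closed => // e e0.
have h2 : \int[leb]_p `|f_ n p - f p| @[n --> \oo] --> 0 by exact: (fine_cvg h1).
have /cvgr0Pnorm_le/(_ _ e0)[n _ /(_ n (leqnn n))] := h2.
rewrite ger0_norm; last by apply: Rintegral_ge0.
move=> h3; exists (f_ n); split => //.
by under eq_Rintegral do rewrite distrC.
Qed.

Lemma equidistributed_eq f f' : integrable f -> equidistributed f' ->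
  (forall p, 0 < (p.2 : R) <= 1 -> f p = f' p) -> equidistributed f.
Proof.
move=> iF ef' ff'; apply: equidistributed_closed => // e e0; exists f'; split => //.
apply: le_trans (ltW e0); have [iF' _] := ef'.
have iB : integrable (fun p => f p - f' p) by exact: (integrableB _ iF iF').
rewrite /Rintegral ge0_integral_strip//; last first.
  by have /integrableP[] := integrable_norm iB.
rewrite (_ : integral _ _ _ = 0%E)//; apply: integral0_eq => t _.
apply: integral0_eq => x; rewrite /= in_itv/= => x01.
by rewrite ff'// subrr normr0.
Qed.

(** A Lipschitz function that decreases along the fibres becomes a Harnack
    function when its Lipschitz constant is added to it, so it is a difference
    of two of them. *)
Lemma equidistributed_lip (k : R) (phi chi : R -> R) : 0 <= k ->
  (forall t, 0 <= phi t <= 1) -> (forall x, 0 <= chi x <= 1) ->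
  (forall t, phi (t + 1) = phi t) ->
  (forall s t, phi s - phi t <= k * `|s - t|) ->
  (forall x y, x <= y -> 0 <= chi x - chi y <= k * (y - x)) ->
  equidistributed (fun p => phi (circle_sec p.1) * chi p.2).
Proof.
move=> k0 phi01 chi01 pphi lphi lchi.
have pc t x : 0 <= phi t * chi x <= 1.
  have /andP[p0 p1] := phi01 t; have /andP[c0 c1] := chi01 x.
  by rewrite mulr_ge0//= mulr_ile1.
pose H t x := phi t * (chi x * strip_one t x) + k * strip_one t x.
have B1 := harnack_cst_ge1 adm.
have hH : harnack B H.
  rewrite /H /strip_one; split.
  - move=> t x; case: ifP => _; rewrite ?mulr0 ?addr0// !mulr1 addr_ge0//.
    by have /andP[] := pc t x.
  - by move=> t x /negbTE ->; rewrite !mulr0 addr0.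
  - move=> t x y x0 xy y1; rewrite x0 (le_trans xy)// (lt_le_trans x0)//= y1 !mulr1.
    rewrite lerD2r; apply: ler_wpM2l; first by have /andP[] := phi01 t.
    by have /andP[] := lchi x y xy; lra.
  - move=> t x y x0 xy y1; rewrite x0 (le_trans xy)// (lt_le_trans x0)//= y1 !mulr1.
    have /andP[p0 p1] := phi01 t; have /andP[l0 l1] := lchi x y xy.
    have /andP[c0 c1] := chi01 y.
    have h1 : phi t * (chi x - chi y) <= k * (y - x).
      by apply: le_trans l1; rewrite ler_piMl.
    have h2 : x ^+ 2 * (phi t * (chi x - chi y)) <= x ^+ 2 * (k * (y - x)).
      by rewrite ler_wpM2l// sqr_ge0.
    have h3 : x ^+ 2 * (k * (y - x)) <= k * (y ^+ 2 - x ^+ 2).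
      have -> : x ^+ 2 * (k * (y - x)) = k * (y - x) * x ^+ 2 by ring.
      have -> : k * (y ^+ 2 - x ^+ 2) = k * (y - x) * (y + x) by ring.
      apply: ler_wpM2l; first by rewrite mulr_ge0// subr_ge0.
      by rewrite expr2; nra.
    have h4 : x ^+ 2 * (phi t * chi y) <= y ^+ 2 * (phi t * chi y).
      apply: ler_wpM2r; first exact: mulr_ge0.
      by rewrite ler_sqr ?nnegrE ?(le_trans (ltW x0))// ltW.
    nra.
  - move=> s t x; case: ifP => _; rewrite ?mulr0 ?addr0 ?mul0r// !mulr1.
    have /andP[c0 c1] := chi01 x; have lst := lphi s t.
    have d0 := normr_ge0 (s - t).
    have /andP[pc0 pc1] := pc t x.
    apply: (@le_trans _ _ ((phi t * chi x + k) * (1 + `|s - t|))); last first.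
      apply: ler_wpM2l; first by rewrite addr_ge0.
      apply: le_trans (expR_ge1Dx _) _; rewrite ler_expR.
      by rewrite ler_peMl.
    have h1 : (phi s - phi t) * chi x <= k * `|s - t|.
      apply: (@le_trans _ _ (k * `|s - t| * chi x)); first exact: ler_wpM2r.
      by rewrite ler_piMr// mulr_ge0.
    have : 0 <= phi t * chi x * `|s - t| by rewrite mulr_ge0.
    move: h1; rewrite mulrBl; move: (phi s * chi x) (phi t * chi x) `|s - t| => u v w.
    by rewrite mulrDl mulrDr mulr1 mulrDr mulr1; lra.
have tH : tame B g (1 + k) H.
  split => //.
  - by move=> t x; rewrite /H pphi.
  - move=> t x x01; have := tame_le (tame_const adm (c := 1 + k) (ltac:(lra))) t x01.
    apply: le_trans; rewrite /H /strip_one x01 !mulr1.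
    by rewrite lerD2r; have /andP[] := pc t x.
have e1 := equidistributed_tame tH.
have e2 := equidistributed_tame (tame_const adm k0).
have e3 := equidistributedB e1 e2.
have mphi : measurable_fun setT (phi : measurableTypeR R -> measurableTypeR R).
  apply: continuous_measurable_fun => t; apply/cvgrPdist_lt => e e0.
  exists (e / (k + 1)); first by rewrite /= divr_gt0//; lra.
  move=> s /= st; have k1 : 0 < k + 1 by lra.
  move: st; rewrite ltr_pdivlMr// => st.
  have h1 := lphi s t; have h2 := lphi t s; rewrite distrC in h1.
  have := normr_ge0 (t - s); rewrite ltr_norml.
  by move: `|t - s| st h1 h2 => w st h1 h2 w0; apply/andP; split; nra.
have mchi : measurable_fun setT (chi : measurableTypeR R -> measurableTypeR R).
  apply: continuous_measurable_fun => t; apply/cvgrPdist_lt => e e0.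
  exists (e / (k + 1)); first by rewrite /= divr_gt0//; lra.
  move=> s /= st; have k1 : 0 < k + 1 by lra.
  move: st; rewrite ltr_pdivlMr// => st.
  have w0 := normr_ge0 (t - s).
  apply: (@le_lt_trans _ _ (k * `|t - s|)); last by nra.
  have [ts|/ltW st'] := leP t s.
    by have /andP[h1 h2] := lchi t s ts; rewrite ger0_norm// ler0_norm; lra.
  have /andP[h1 h2] := lchi s t st'.
  by rewrite distrC [`|t - s|]ger0_norm ?ger0_norm; lra.
apply: equidistributed_eq e3 _.
  apply/integrableP; split.
    apply/measurable_EFinP; apply: measurable_funM.
      exact: measurableT_comp mphi (measurableT_comp (@measurable_circle_sec R) measurable_fst).
    exact: measurableT_comp mchi measurable_snd.
  apply: (@le_lt_trans _ _ (\int[leb]_p 1%:E)%E).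
    apply: ge0_le_integral => //.
    + apply: measurableT_comp => //; apply/measurable_EFinP; apply: measurable_funM.
        exact: measurableT_comp mphi (measurableT_comp (@measurable_circle_sec R) measurable_fst).
      exact: measurableT_comp mchi measurable_snd.
    + move=> p _; have /andP[h1 h2] := pc (circle_sec p.1) p.2.
      by rewrite lee_fin ger0_norm.
  by rewrite integral_cst//= leb_strip_setT mul1e ltry.
by move=> p p01; rewrite /descend /H /strip_one p01; ring.
Qed.

End equidistribution.

Section open_approximation.
Variable R : realType.

(** The distance to the complement of a set of angles, capped at [1] so that it
    also makes sense for the whole circle. *)
Definition dist_setC (V : set (circle R)) (t : R) : R :=
  inf [set d | d = 1 \/ exists s, ~ V (circle_proj s) /\ d = `|t - s|].

Let lb V t : has_inf [set d | d = 1 \/ exists s, ~ V (circle_proj s) /\ d = `|t - s| :> R].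
Proof.
split; first by exists 1; left.
by exists 0 => d /= [->//|[s [_ ->]]].
Qed.

Lemma dist_setC_ge0 V t : 0 <= dist_setC V t.
Proof.
apply: lb_le_inf; first by exists 1; left.
by move=> d /= [->//|[s [_ ->]]].
Qed.

Lemma dist_setC_lip V s t : dist_setC V s - dist_setC V t <= `|s - t|.
Proof.
rewrite lerBlDr -lerBlDl; apply: lb_le_inf; first by exists 1; left.
move=> d /= [->|[u [Vu ->]]].
  rewrite lerBlDr; apply: (@le_trans _ _ 1); last by rewrite lerDl.
  by apply: ge_inf; [case: (lb V s)|left].
rewrite lerBlDl; apply: (@le_trans _ _ `|s - u|).
  by apply: ge_inf; [case: (lb V s)|right; exists u].
exact: ler_distD.
Qed.

Lemma dist_setC_periodic V t : dist_setC V (t + 1) = dist_setC V t.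
Proof.
congr inf; apply/seteqP; split => d /= [->|[s [Vs ->]]]; [by left|right|by left|right].
  exists (s - 1); split; last by congr `|_|; ring.
  rewrite (_ : circle_proj (s - 1) = circle_proj s)//.
  by apply: circle_proj_int; rewrite addrAC subrr add0r rpredN rpred1.
exists (s + 1); split; last by congr `|_|; ring.
rewrite (_ : circle_proj (s + 1) = circle_proj s)//.
by apply: circle_proj_int; rewrite addrAC subrr add0r rpred1.
Qed.

Lemma dist_setC_out V t : ~ V (circle_proj t) -> dist_setC V t = 0.
Proof.
move=> Vt; apply/eqP; rewrite eq_le dist_setC_ge0 andbT.
by apply: ge_inf; [case: (lb V t)|right; exists t; rewrite subrr normr0].
Qed.

Lemma dist_setC_gt0 V t : open V -> V (circle_proj t) -> 0 < dist_setC V t.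
Proof.
move=> oV Vt.
have : nbhs t (@circle_proj R @^-1` V).
  by apply: open_nbhs_nbhs; split => //; move/continuousP: (@continuous_circle_proj R); apply.
move=> /nbhs_ballP[e /= e0 eV].
apply: (@lt_le_trans _ _ (Num.min e 1)); first by rewrite lt_min e0 ltr01.
apply: lb_le_inf; first by exists 1; left.
move=> d /= [->|[s [Vs ->]]]; first by rewrite ge_min lexx orbT.
rewrite ge_min; apply/orP; left; rewrite leNgt; apply/negP => ts.
by apply: Vs; apply: eV.
Qed.

Definition ramp (n : nat) (z : R) : R := Num.min 1 (Num.max 0 (n%:R * z)).

Lemma ramp_itv n z : 0 <= ramp n z <= 1.
Proof. by rewrite /ramp le_min ge_min !le_max !lexx ler01. Qed.

Lemma ramp_lip n y z : y <= z -> 0 <= ramp n z - ramp n y <= n%:R * (z - y).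
Proof.
move=> yz; have h : n%:R * y <= n%:R * z by rewrite ler_wpM2l.
rewrite mulrBr /ramp; move: (n%:R * y) (n%:R * z) h => u v uv.
by case: (leP 0 u) => u0; case: (leP 0 v) => v0; rewrite !minElt ?ltr10;
  case: (ltP 1 u) => u1; case: (ltP 1 v) => v1; apply/andP; split; lra.
Qed.

Lemma ramp_le0 n z : z <= 0 -> ramp n z = 0.
Proof.
move=> z0; rewrite /ramp max_l; first by rewrite min_r.
by rewrite mulr_ge0_le0.
Qed.

Lemma ramp_cvg z : 0 < z -> ramp n z @[n --> \oo] --> (1 : R).
Proof.
move=> z0; apply: cvg_near_cst; exists (Num.bound z^-1) => // n /= zn.
have : 1 <= n%:R * z.
  rewrite -ler_pdivrMr// mul1r; apply: (@le_trans _ _ (Num.bound z^-1)%:R).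
    by apply: ltW; apply: archi_boundP; rewrite invr_ge0 ltW.
  by rewrite ler_nat.
by rewrite /ramp => h; rewrite min_l// le_max h orbT.
Qed.

End open_approximation.

Section cylinder_generators.
Variable R : realType.

Definition open_box : set (set (cylinder R)) :=
  [set V `*` I | V in open & I in [set I : set (measurableTypeR R) |
     I = setT \/ exists x, I = `]-oo, x[%classic]].

Lemma setI_closed_open_box : setI_closed open_box.
Proof.
move=> _ _ [V oV [I hI <-]] [W oW [J hJ <-]].
exists (V `&` W); first exact: openI.
exists (I `&` J); last by rewrite setXI.
case: hI => [->|[x ->]]; first by rewrite setTI.
case: hJ => [->|[y ->]]; first by rewrite setIT; right; exists x.
right; exists (Num.min x y); apply/seteqP; split => z /=; rewrite !in_itv/= lt_min.
  by case=> -> ->.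
by move/andP.
Qed.

Lemma measurable_open_box : @measurable _ (cylinder R) = <<s open_box >>.
Proof.
apply/seteqP; split; last first.
  apply: smallest_sub; first exact: sigma_algebra_measurable.
  move=> _ [V oV [I hI <-]]; apply: measurableX; first exact: sub_sigma_algebra.
  by case: hI => [->//|[x ->]]; exact: measurable_itv.
rewrite measurable_prod_measurableType.
apply: smallest_sub; first exact: smallest_sigma_algebra.
move=> _ [V mV [I mI <-]].
have m1 : @measurable_fun _ _ (g_sigma_algebraType open_box) (circle R) setT fst.
  apply: (measurability (@open (circle R))) => //.
  move=> _ [W oW <-]; rewrite setTI; apply: sub_sigma_algebra.
  exists W => //; exists setT; first by left.
  by apply/seteqP; split => -[w x] //= [].
have m2 : @measurable_fun _ _ (g_sigma_algebraType open_box) (measurableTypeR R) setT snd.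
  apply: (measurability _ (RGenInftyO.measurableE R)) => //.
  move=> _ [_ [x ->] <-]; rewrite setTI; apply: sub_sigma_algebra.
  exists setT; first exact: openT.
  exists `]-oo, x[%classic; first by right; exists x.
  by apply/seteqP; split => -[w y] //= [].
have h1 := m1 measurableT V mV; have h2 := m2 measurableT I mI.
rewrite setTI in h1; rewrite setTI in h2.
rewrite (_ : V `*` I = fst @^-1` V `&` snd @^-1` I)//.
exact: (@measurableI _ (g_sigma_algebraType open_box) _ _ h1 h2).
Qed.

End cylinder_generators.

Section equidistribution_all.
Variable R : realType.
Local Notation leb := (@leb_strip R).
Variables (alpha : circle R -> R) (b g l : R).
Hypothesis adm : admissible alpha b g l.
Variable U : set_system nat.
Hypothesis ultraU : UltraFilter U.
Hypothesis U_oo : \oo `<=` U.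
Variable D : set (cylinder R).
Hypothesis mD : measurable D.
Local Notation equi := (equidistributed alpha U D).

Lemma equidistributed1 : equi (cst 1).
Proof.
apply: (equidistributed_eq adm ultraU U_oo mD) (equidistributed_tame adm ultraU U_oo mD
   (tame_const adm ler01)) _.
  exact: finite_measure_integrable_cst.
by move=> p p01; rewrite /descend /strip_one p01 mulr1.
Qed.

Lemma equidistributed_box E : open_box E -> equi (\1_E).
Proof.
move=> [V oV [I hI <-]].
have mE : measurable (V `*` I).
  apply: measurableX; first exact: sub_sigma_algebra.
  by case: hI => [->//|[x ->]]; exact: measurable_itv.
pose phi n t := ramp n (dist_setC V t).
have phi01 n t : 0 <= phi n t <= 1 by exact: ramp_itv.
have phiP n t : phi n (t + 1) = phi n t by rewrite /phi dist_setC_periodic.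
have phiL n s t : phi n s - phi n t <= n%:R * `|s - t|.
  have [st|/ltW st] := leP (dist_setC V t) (dist_setC V s).
    have /andP[_ h] := ramp_lip n st; apply: (le_trans h).
    by rewrite ler_wpM2l// dist_setC_lip.
  have /andP[h _] := ramp_lip n st; have : 0 <= n%:R * `|s - t| by rewrite mulr_ge0.
  by rewrite /phi; move: (ramp _ _) (ramp _ _) h => u v; lra.
have phiV n w : ~ V w -> phi n (circle_sec w) = 0.
  by move=> Vw; rewrite /phi dist_setC_out ?circle_secK// ramp_le0.
have phiC w : V w -> phi n (circle_sec w) @[n --> \oo] --> (1 : R).
  by move=> Vw; apply: ramp_cvg; apply: dist_setC_gt0 => //; rewrite circle_secK.
have [chi [chi01 chiL chiI chiC]] : exists chi : nat -> R -> R,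
  [/\ forall n x, 0 <= chi n x <= 1,
   forall n x y, x <= y -> 0 <= chi n x - chi n y <= n%:R * (y - x),
   forall n x, ~ I x -> chi n x = 0 &
   forall x, I x -> chi n x @[n --> \oo] --> (1 : R)].
  case: hI => [->|[z ->]].
    exists (fun _ _ => 1); split.
    - by move=> n x; rewrite ler01 lexx.
    - by move=> n x y xy; rewrite subrr lexx mulr_ge0// subr_ge0.
    - by move=> n x /(_ Logic.I).
    - by move=> x _; exact: cvg_cst.
  exists (fun n x => ramp n (z - x)); split.
  - by move=> n x; exact: ramp_itv.
  - move=> n x y xy; have zz : z - y <= z - x by rewrite lerD2l lerN2.
    by have := ramp_lip n zz; rewrite (_ : z - x - (z - y) = y - x)//; ring.
  - move=> n x /=; rewrite in_itv/= => /negP; rewrite -leNgt => zx.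
    by rewrite ramp_le0// subr_le0.
  - by move=> x /=; rewrite in_itv/= => xz; apply: ramp_cvg; rewrite subr_gt0.
apply: (equidistributed_cvg adm ultraU U_oo mD
  (f_ := fun n p => phi n (circle_sec p.1) * chi n p.2)).
- move=> n; exact: (equidistributed_lip adm ultraU U_oo mD (ler0n R n) (phi01 n)
    (chi01 n) (phiP n) (phiL n) (chiL n)).
- exact: measurable_indic.
- move=> n p; have /andP[p0 p1] := phi01 n (circle_sec p.1).
  have /andP[c0 c1] := chi01 n p.2.
  by rewrite ger0_norm ?mulr_ge0// mulr_ile1.
- move=> [w x]; rewrite /= indicE.
  have [Vw|Vw] := pselect (V w); last first.
    rewrite memNset; last by case.
    rewrite (_ : (fun n => _) = cst 0); first exact: cvg_cst.
    by apply/funext => n; rewrite phiV// mul0r.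
  have [Ix|Ix] := pselect (I x); last first.
    rewrite memNset; last by case.
    rewrite (_ : (fun n => _) = cst 0); first exact: cvg_cst.
    by apply/funext => n; rewrite chiI// mulr0.
  rewrite mem_set// -[1%:R](mulr1 1); apply: cvgM; [exact: phiC|exact: chiC].
Qed.

Lemma equidistributed_indic E : measurable E -> equi (\1_E).
Proof.
move=> mE; have : <<s @open_box R >> E by rewrite -measurable_open_box.
apply: (dynkin_induction (P := fun E => equi (\1_E)) (@measurable_open_box R)
  (@setI_closed_open_box R)).
- rewrite (_ : \1_ _ = cst 1); first exact: equidistributed1.
  by apply/funext => p; rewrite indicT.
- exact: equidistributed_box.
- move=> S mS eS; rewrite (_ : \1_ _ = (fun p => cst 1 p - \1_S p)).
    exact: (equidistributedB adm ultraU mD equidistributed1 eS).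
  by apply/funext => p; rewrite /= !indicE in_setC; case: (p \in S); rewrite ?subrr ?subr0.
- move=> F mF tF eF.
  have mU n : measurable (\big[setU/set0]_(k < n) F k).
    by apply: bigsetU_measurable.
  apply: (equidistributed_cvg adm ultraU U_oo mD
    (f_ := fun n => \1_(\big[setU/set0]_(k < n) F k))).
  + elim=> [|n IH].
      rewrite big_ord0 (_ : \1_ _ = (fun p => cst 1 p - cst 1 p)).
        exact: (equidistributedB adm ultraU mD equidistributed1 equidistributed1).
      by apply/funext => p; rewrite indic0/= subrr.
    rewrite big_ord_recr/= (_ : \1_ _ = (fun p =>
        \1_(\big[setU/set0]_(k < n) F k) p + \1_(F n) p)).
      exact: (equidistributedD adm ultraU mD IH (eF n)).
    apply/funext => p; rewrite !indicE in_setU.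
    have [pF|] := boolP (p \in F n); rewrite ?orbF ?addr0// orbT.
    rewrite memNset ?add0r//; rewrite -bigcup_mkord => -[k /= kn Fk].
    move/trivIsetP: tF => /(_ k n I I); rewrite ltn_eqF// => /(_ isT).
    by apply/eqP/set0P; exists p; split => //; exact/set_mem.
  + by apply: measurable_indic; exact: bigcupT_measurable.
  + by move=> n p; rewrite indicE; case: (_ \in _); rewrite ?normr0 ?normr1.
  + move=> p; have [[k _ Fk]|nF] := pselect ((\bigcup_k F k) p).
      apply: cvg_near_cst; exists k.+1 => // n /= kn; rewrite !indicE !mem_set//.
        by exists k.
      by rewrite -bigcup_mkord; exists k.
    apply: cvg_near_cst; apply: nearW => n; rewrite !indicE !memNset//.
    by rewrite -bigcup_mkord => -[k _ Fk]; apply: nF; exists k.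
Qed.

Import HBSimple.

Lemma equidistributed_sfun (f : {sfun cylinder R >-> R}) : equi f.
Proof.
have -> : (f : cylinder R -> R) = fun p => \sum_(y <- finmap.enum_fset (fset_set (range f)))
    y * \1_(f @^-1` [set y]) p.
  by apply/funext => p; rewrite [LHS]fimfunE fsbig_finite.
elim: (finmap.enum_fset _) => [|y s IH].
  rewrite (_ : (fun p => _) = (fun p => cst 1 p - cst 1 p)).
    exact: (equidistributedB adm ultraU mD equidistributed1 equidistributed1).
  by apply/funext => p; rewrite big_nil /= subrr.
rewrite (_ : (fun p => _) = (fun p => y * \1_(f @^-1` [set y]) p +
   \sum_(z <- s) z * \1_(f @^-1` [set z]) p)); last first.
  by apply/funext => p; rewrite big_cons.
apply: (equidistributedD adm ultraU mD _ IH).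
apply: (equidistributedZ adm ultraU mD y); apply: equidistributed_indic.
exact: measurable_sfunP.
Qed.

Lemma equidistributed_integrable f : leb.-integrable setT (EFin \o f) -> equi f.
Proof.
move=> iF; have [f_ [if_ _ f_f]] := approximation_sfun_integrable measurableT iF.
apply: (equidistributed_closed adm ultraU U_oo mD) => // e e0.
have h2 : \int[leb]_p `|f p - f_ n p| @[n --> \oo] --> 0 by exact: (fine_cvg f_f).
have /cvgr0Pnorm_le/(_ _ e0)[n _ /(_ n (leqnn n))] := h2.
rewrite ger0_norm; last by apply: Rintegral_ge0.
by move=> h3; exists (f_ n); split => //; exact: equidistributed_sfun.
Qed.

End equidistribution_all.

(** * The invariant measure *)

Lemma probability_of_density d (T : measurableType d) (R : realType)
    (mu : {measure set T -> \bar R}) (f : T -> R) :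
  measurable_fun setT f -> (forall x, 0 <= f x) ->
  (\int[mu]_x (f x)%:E = 1)%E ->
  exists m : probability T R, forall A, m A = (\int[mu]_(x in A) (f x)%:E)%E.
Proof.
move=> mf f0 f1; pose nu : {measure set T -> \bar R} := density_measure mu mf f0.
have nu1 : mnormalize nu (dirac point) = nu.
  apply/funext => A; rewrite /mnormalize [nu setT]f1 eqe oner_eq0/=.
  by rewrite invr1 mule1.
by exists (mnormalize nu (dirac point)) => A; rewrite -[LHS]/(mnormalize _ _ A) nu1.
Qed.

Section invariant_measure.
Variable R : realType.
Local Notation leb := (@leb_strip R).
Variables (alpha : circle R -> R) (b g l : R).
Hypothesis adm : admissible alpha b g l.
Variable U : set_system nat.
Hypothesis ultraU : UltraFilter U.
Hypothesis U_oo : \oo `<=` U.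
Local Notation h := (inv_density alpha U).
Local Notation B := (harnack_cst b l).
Variable m : probability (cylinder R) R.
Hypothesis mE : forall A, m A = (\int[leb]_(p in A) (descend h p)%:E)%E.

Let B0 : 0 <= B := harnack_cst_ge0 adm.
Let hspec := inv_density_spec adm ultraU U_oo.

Let hh : harnack B h. Proof. by have [[A []]] := hspec. Qed.
Let ph : periodic1 h. Proof. by have [[A []]] := hspec. Qed.

Let ih : leb.-integrable setT (EFin \o descend h).
Proof. by have [[A th] _ _] := hspec; exact: (integrable_tame B0 (adm_g01 adm) measurableT th). Qed.

Let mh : measurable_fun setT (descend h : cylinder R -> measurableTypeR R).
Proof. exact: measurable_descend (measurable_harnack B0 hh). Qed.

Lemma inv_dominates : m `<< leb.
Proof.
apply/null_content_dominatesP => A mA A0; rewrite mE null_set_integral//.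
by apply: measurable_funTS; exact/measurable_EFinP.
Qed.

Lemma inv_invariant : invariant_on (@strip R) (skew_map alpha) m.
Proof.
move=> A mA _; rewrite !mE (transfer_mass adm hh ph mA).
have [_ fh _] := hspec.
by apply: eq_integral => p _; rewrite /descend fh.
Qed.

Lemma null_outside_strip (m' : probability (cylinder R) R) A : m' `<< leb ->
  measurable A -> m' A = m' (@strip R `&` A).
Proof.
move=> /null_content_dominatesP dom mA; have mS : measurable (@strip R) by exact: measurable_strip.
have mI : measurable (A `&` @strip R) by exact: measurableI.
have mD : measurable (A `&` ~` @strip R) by exact: measurableI (measurableC mS).
have -> : m' A = (m' (A `&` @strip R) + m' (A `&` ~` @strip R))%E.
  rewrite -measureU//; last by rewrite setIACA setICr setI0.
  by rewrite -setIUr setUv setIT.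
have -> : m' (A `&` ~` @strip R) = 0%E; last by rewrite adde0 setIC.
apply/eqP; rewrite -measure_le0.
have <- : m' (~` @strip R) = 0%E.
  by apply: dom; [exact: measurableC|exact: leb_strip_setC].
by apply: le_measure; rewrite ?inE//; exact: measurableC.
Qed.

(** The orbit averages of the density of [m'] are constant, by invariance, and
    converge to the measure for [m], by equidistribution. *)
Lemma inv_unique (m' : probability (cylinder R) R) : m' `<< leb ->
  invariant_on (@strip R) (skew_map alpha) m' ->
  forall A, measurable A -> m' A = m A.
Proof.
move=> dom inv A mA.
rewrite (null_outside_strip dom mA) (null_outside_strip inv_dominates mA).
have mS : measurable (@strip R `&` A) by apply: measurableI => //; exact: measurable_strip.
have : @strip R `&` A `<=` @strip R by exact: subIsetl.
move: (_ `&` _) mS => {mA}D mD DS.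
pose nu := charge_of_finite_measure m'.
have dom' : nu `<< leb by [].
have iN := Radon_Nikodym_integrable dom'.
pose f p := fine (('d nu '/d leb) p).
have fE : EFin \o f = 'd nu '/d leb.
  by apply/funext => p; rewrite /f /= fineK// Radon_Nikodym_fin_num.
have fI E : measurable E -> \int[leb]_(p in E) f p = fine (m' E).
  move=> mE'; rewrite /Rintegral; congr fine.
  transitivity (\int[leb]_(p in E) ('d nu '/d leb) p)%E.
    by apply: eq_integral => p _; rewrite -fE.
  by rewrite -Radon_Nikodym_integral.
have iF : leb.-integrable setT (EFin \o f) by rewrite fE.
have [_ lim1] := equidistributed_integrable adm ultraU U_oo mD iF.
have pS k : pull_back alpha k D `<=` @strip R /\ m' (pull_back alpha k D) = m' D.
  elim: k => [//|k [IH1 IH2]]; rewrite /pull_back iterS; split; first exact: subIsetl.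
  by rewrite inv//; exact: (measurable_pull_back adm).
have Ik k : \int[leb]_(p in pull_back alpha k D) f p = fine (m' D).
  by rewrite fI ?(pS k).2//; exact: (measurable_pull_back adm).
have cE n : orbit_average alpha D f n = fine (m' D).
  rewrite /orbit_average.
  under eq_bigr do rewrite Ik.
  by rewrite sumr_const card_ord -[X in _ * X]mulr_natl mulrA mulVf// mul1r.
have e : fine (m' D) = (\int[leb]_p f p) * \int[leb]_(p in D) descend h p.
  have c1 : orbit_average alpha D f n @[n --> U] --> fine (m' D).
    by under eq_fun do rewrite cE; exact: cvg_cst.
  exact: (cvg_unique _ c1 lim1).
rewrite fI// probability_setT mul1r in e.
have fin1 : m' D \is a fin_num by exact: fin_num_measure.
have fin2 : m D \is a fin_num by exact: fin_num_measure.
by rewrite -(fineK fin1) -(fineK fin2) e [in RHS]mE.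
Qed.

(** Conditioning on an invariant set of positive measure would give another
    invariant probability. *)
Lemma inv_ergodic : ergodic_on (@strip R) (skew_map alpha) m.
Proof.
move=> A mA AS inA; have [A0|A0] := eqVneq (m A) 0%E; [by left|right].
have finA : m A \is a fin_num by exact: fin_num_measure.
pose m' := mnormalize (mrestr m mA) m.
have Aoo : m A != +oo%E by rewrite lt_eqF// ltey_eq finA.
have m'E E : m' E = (m (E `&` A) * (fine (m A))^-1%:E)%E.
  by rewrite /m' /mnormalize /= /mrestr !setTI (negbTE A0) (negbTE Aoo).
have dom' : m' `<< leb.
  apply/null_content_dominatesP => E mE' E0; rewrite m'E.
  have -> : m (E `&` A) = 0%E; last by rewrite mul0e.
  apply/eqP; rewrite -measure_le0.
  have <- : m E = 0%E.
    by have /null_content_dominatesP := inv_dominates; apply.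
  by apply: le_measure; rewrite ?inE//; exact: measurableI.
have inv' : invariant_on (@strip R) (skew_map alpha) m'.
  move=> E mE' ES; rewrite !m'E; congr (_ * _)%E.
  have mEA : measurable (E `&` A) by exact: measurableI.
  rewrite -(inv_invariant mEA); last by move=> p [/ES].
  congr (m _); rewrite preimage_setI -{1}inA.
  by rewrite setIACA setIid.
have e : m' A = m A := inv_unique dom' inv' mA.
have mA1 : m A = 1%E.
  by rewrite -e m'E setIid -(fineK finA) -EFinM mulfV// fine_eq0.
have mS : measurable (@strip R) by exact: measurable_strip.
apply/eqP; rewrite -measure_le0 measureD//; last 1 first.
  by rewrite ltey_eq fin_num_measure.
rewrite setIC setIidl// [X in (_ - X)%E](_ : _ = 1%E)// lee_subel_addr// add0e.
exact: probability_le1.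
Qed.

(** The height is bounded below on a compact set, where the cone conditions thus
    bound the oscillation of [h]; the estimate holds for all representatives of
    two angles, hence for the distance of the angles, an infimum. *)
Lemma inv_lipschitz (K : set (cylinder R)) : compact K ->
  K `<=` [set p | 0 < (p.2 : R) <= 1] ->
  ae_lipschitz_on K ('d (charge_of_finite_measure m) '/d leb).
Proof.
move=> cK K01; exists (descend h); split.
  have dom := inv_dominates.
  apply: integral_ae_eq => //.
  - exact: Radon_Nikodym_integrable.
  - exact/measurable_EFinP.
  - move=> E _ mE'; rewrite -Radon_Nikodym_integral//.
    by rewrite -[LHS]/(m E) mE.
have [->|/set0P K0] := eqVneq K set0; first by exists 0.
have [e e0 eK] : exists2 e, 0 < e & forall p, K p -> e <= (p.2 : R) <= 1.
  have cf : {within K, continuous (fun p : cylinder R => (p.2 : R))}.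
    apply: continuous_subspaceT => p; exact: cvg_snd.
  have [q /set_mem Kq qP] := compact_EVT_min K0 cK cf.
  exists (q.2 : R); first by have /andP[] := K01 _ Kq.
  by move=> p Kp; rewrite qP ?inE//; have /andP[] := K01 _ Kp.
pose M := h 0 e * expR B.
have hM t x : e <= x -> x <= 1 -> h t x <= M.
  move=> ex x1; pose s := circle_sec (circle_proj t).
  rewrite (@periodic1_int _ _ ph t s); last first.
    by rewrite -opprB rpredN; exact: circle_sec_proj.
  apply: le_trans (harnack_dec hh s e0 ex x1) _.
  apply: le_trans (harnack_exp hh s 0 e) _.
  apply: ler_wpM2l; first exact: harnack_ge0 hh _ _.
  rewrite ler_expR subr0; have /andP[s0 s1] := circle_sec_itv (circle_proj t).
  by rewrite ler_piMr// ger0_norm// ltW.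
have M0 : 0 <= M by rewrite mulr_ge0 ?expR_ge0// (harnack_ge0 hh).
pose C := M * (2 / e + B).
have e2 : 0 <= 2 / e by rewrite divr_ge0// ltW.
have C0 : 0 <= C by rewrite mulr_ge0// addr_ge0.
have main s t x y : e <= x <= 1 -> e <= y <= 1 ->
    `|h s x - h t y| <= C * (`|s - t| + `|x - y|).
  move=> /andP[ex x1] /andP[ey y1].
  apply: le_trans (@harnack_lip R B h e M s t x y hh B0 e0 _ _ _ _ _) _; rewrite ?ex ?ey ?hM//.
  rewrite /C -[leRHS]mulrA ler_wpM2l//.
  have h1 : 0 <= 2 / e * `|s - t| by rewrite mulr_ge0.
  have h2 : 0 <= B * `|x - y| by rewrite mulr_ge0.
  by move: h1 h2; move: (2 / e) `|s - t| `|x - y| => c u v; lra.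
exists C => p q Kp Kq; have ep := eK _ Kp; have eq := eK _ Kq.
have [C00|C00] := eqVneq C 0.
  have := main (circle_sec p.1) (circle_sec q.1) p.2 q.2 ep eq.
  by rewrite C00 !mul0r.
have Cgt0 : 0 < C by rewrite lt_neqAle eq_sym C00.
rewrite /cylinder_dist -ler_pdivrMl// -lerBlDr.
apply: lb_le_inf.
  by exists `|circle_sec p.1 - circle_sec q.1|, (circle_sec p.1), (circle_sec q.1);
    rewrite !circle_secK.
move=> _ [s [t [sp tq ->]]]; rewrite lerBlDr ler_pdivrMl//.
have hs : descend h p = h s p.2.
  by apply: periodic1_int => //; rewrite -sp; exact: circle_sec_proj.
have ht : descend h q = h t q.2.
  by apply: periodic1_int => //; rewrite -tq; exact: circle_sec_proj.
by rewrite hs ht; exact: main.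
Qed.

End invariant_measure.

Section smooth_exponent.
Variable R : realType.
Variable alpha : circle R -> R.
Hypothesis alpha_C2 : circle_C2 alpha.
Local Notation f := (circle_lift alpha).

Let f_per (t : R) : f (t + 1) = f t.
Proof.
rewrite /circle_lift /=; congr alpha.
by apply: circle_proj_int; rewrite addrAC subrr add0r.
Qed.

Let df (t : R) : is_derive t (1 : R) f (derive1 f t).
Proof.
have [d1 _ _] := alpha_C2; rewrite derive1E; exact/derivableP/d1.
Qed.

Let cf : continuous f.
Proof.
move=> t; apply/differentiable_continuous/derivable1_diffP.
by have [d1 _ _] := alpha_C2; exact: d1.
Qed.

Let derive1_per : periodic1 (fun t _ => derive1 f t).
Proof.
move=> t _; rewrite !derive1E /derive f_per.
by under [in LHS]eq_fun do rewrite /= addrA f_per.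
Qed.

(** The derivative of the lift is continuous and periodic, hence bounded. *)
Lemma C2_lip : exists2 l, 0 <= l &
  forall s t, `|alpha (circle_proj s) - alpha (circle_proj t)| <= l * `|s - t|.
Proof.
have [_ d2 _] := alpha_C2.
have cd : {within `[0, 1], continuous (fun t => `|derive1 f t|)}.
  apply: continuous_subspaceT => t; apply: continuous_comp; last exact: norm_continuous.
  apply/differentiable_continuous/derivable1_diffP; exact: d2.
have [u _ uP] := EVT_max ler01 cd.
exists `|derive1 f u|; first exact: normr_ge0.
have bnd t : `|derive1 f t| <= `|derive1 f u|.
  pose s := circle_sec (circle_proj t).
  have -> : derive1 f t = derive1 f s.
    apply: (periodic1_int derive1_per 0 (t := t) (t' := s)).
    by rewrite -opprB rpredN; exact: circle_sec_proj.
  apply: uP; rewrite in_itv/=; have /andP[-> s1] := circle_sec_itv (circle_proj t).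
  exact: ltW.
have key s t : s < t -> `|f s - f t| <= `|derive1 f u| * `|s - t|.
  move=> st; have [|c _ e] := MVT st (fun x _ => df x).
    exact: continuous_subspaceT.
  by rewrite distrC e normrM [`|s - t|]distrC ler_wpM2r.
move=> s t; have [st|ts|->] := ltgtP s t.
- exact: key.
- by rewrite distrC [`|s - t|]distrC; exact: key.
- by rewrite !subrr normr0 mulr0.
Qed.

Lemma C2_measurable : measurable_fun setT (alpha : circle R -> measurableTypeR R).
Proof.
rewrite (_ : alpha = f \o @circle_sec R); last first.
  by apply/funext => w; rewrite /circle_lift /= circle_secK.
apply: measurableT_comp; last exact: measurable_circle_sec.
exact: continuous_measurable_fun.
Qed.

End smooth_exponent.

Theorem theorem2p10 (R : realType) (alpha : circle R -> R)
    (amin amax : R) (x0 : circle R)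
    (alpha_C2 : circle_C2 alpha)
    (amin_le : forall w, amin <= alpha w)
    (alpha_x0 : alpha x0 = amin)
    (x0_unique : forall w, alpha w = amin -> w = x0)
    (le_amax : forall w, alpha w <= amax)
    (amax_attained : exists w, alpha w = amax)
    (amin_gt0 : 0 < amin) (amin_lt_amax : amin < amax) (amax_lt1 : amax < 1)
    (alpha_x0_convex : 0 < circle_derive2 alpha x0)
    (amax_lt_amin : amax < 3 / 2 * amin) :
  exists m : probability (cylinder R) R,
    [/\ m `<< leb_strip (R := R),
        invariant_on (@strip R) (skew_map alpha) m,
        forall m' : probability (cylinder R) R,
          m' `<< leb_strip (R := R) ->
          invariant_on (@strip R) (skew_map alpha) m' ->
          forall A, measurable A -> m' A = m A,
        ergodic_on (@strip R) (skew_map alpha) m &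
        forall K : set (cylinder R), compact K ->
          K `<=` [set p | 0 < (p.2 : R) <= 1] ->
          ae_lipschitz_on K
            ('d (charge_of_finite_measure m) '/d (leb_strip (R := R)))].
Proof.
have [l l0 lip] := C2_lip alpha_C2.
have adm : admissible alpha amin amax l.
  split=> //; first by move=> w; rewrite amin_le le_amax.
  exact: C2_measurable.
have [U [ultraU U_oo]] := ultraFilterLemma (@eventually_filter).
have [[A th] fh ih] := inv_density_spec adm ultraU U_oo.
have B0 := harnack_cst_ge0 adm.
have h0 p : 0 <= descend (inv_density alpha U) p.
  exact: harnack_ge0 (tame_harnack th) _ _.
have mh := measurable_tame B0 th.
have int1 : (\int[leb_strip (R := R)]_p (descend (inv_density alpha U) p)%:E = 1)%E.
  have iN := integrable_tame B0 (adm_g01 adm) measurableT th.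
  by rewrite -[LHS]fineK ?integrable_fin_num// -[fine _]/(Rintegral _ _ _) ih.
have [m mE] := probability_of_density mh h0 int1.
exists m; split.
- exact: (inv_dominates adm ultraU U_oo mE).
- exact: (inv_invariant adm ultraU U_oo mE).
- exact: (inv_unique adm ultraU U_oo mE).
- exact: (inv_ergodic adm ultraU U_oo mE).
- exact: (inv_lipschitz adm ultraU U_oo mE).
Qed.
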